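(* If $K\subset\hat{\mathbb{C}}$ is a compactum, then $S(x)=\overline{R_K}[x]$ for all $x\in K$.
   Context: For a compactum $K$ and $x\in K$, $S(x)$ is the set of all $y\in K$ for which there do NOT exist two disjoint open sets $U_x,U_y\subset K$ with $x\in U_x$, $y\in U_y$ such that $K\setminus(U_x\cup U_y)$ has at most finitely many components intersecting both $\partial U_x$ and $\partial U_y$. For disjoint simple closed curves $J_1,J_2\subset\hat{\mathbb{C}}$, $U(J_1,J_2)$ is the component of $\hat{\mathbb{C}}\setminus(J_1\cup J_2)$ with boundary $J_1\cup J_2$. The Schönflies relation $R_K$: $x\ne y$ satisfy $(x,y)\in R_K$ if there exist disjoint simple closed curves $J_1\ni x$, $J_2\ni y$ such that $\overline{U(J_1,J_2)}\cap K$ contains an infinite sequence of distinct components $P_n$ each meeting both $J_1$ and $J_2$ whose Hausdorff limit contains $\{x,y\}$. $\overline{R_K}$ is its closure in $K\times K$ and $\overline{R_K}[x]=\{y:(x,y)\in\overline{R_K}\}$. *)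

(* Defs.v *)
(* The Riemann sphere is modelled as the unit
   sphere S^2 in R^3 = 'rV[R]_3 (homeomorphic to \hat C via stereographic
   projection); all topological notions are those of the ambient R^3
   restricted to subsets of the sphere (the sphere is closed, so closures
   of subsets stay on it). *)
From HB Require Import structures.
From mathcomp Require Import all_boot all_order all_algebra.
From mathcomp Require Import all_classical all_reals all_analysis.
Set Implicit Arguments. Unset Strict Implicit. Unset Printing Implicit Defensive.
Import Order.TTheory GRing.Theory Num.Theory.
Import numFieldNormedType.Exports.
Local Open Scope classical_set_scope.
Local Open Scope ring_scope.

Section Defs.
Variable R : realType.
Local Notation P3 := 'rV[R]_3.

Definition sphere : set P3 := [set p | \sum_(i < 3) p ord0 i ^+ 2 = 1].

Definition circle : set 'rV[R]_2 := [set p | \sum_(i < 2) p ord0 i ^+ 2 = 1].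

(* J is a simple closed curve in \hat C: a homeomorphic (= continuous and
   injective, S^1 being compact) image of the circle *)
Definition simple_closed_curve (J : set P3) : Prop :=
  exists f : 'rV[R]_2 -> P3,
    [/\ {within circle, continuous f}, {in circle &, injective f},
        f @` circle `<=` sphere & J = f @` circle].

Definition components (A : set P3) : set (set P3) :=
  [set C | exists2 z, A z & C = connected_component A z].

Definition rel_open (K U : set P3) : Prop :=
  exists2 O : set P3, open O & U = O `&` K.

(* boundary of U relative to K (for U open in K): closure_K U minus U *)
Definition rel_boundary (K U : set P3) : set P3 := (closure U `&` K) `\` U.

Definition S_set (K : set P3) (x : P3) : set P3 :=
  [set y | K y /\
    ~ (exists Ux Uy : set P3,
         [/\ rel_open K Ux, rel_open K Uy, Ux `<=` K, Uy `<=` K &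
             Ux `&` Uy = set0] /\ Ux x /\ Uy y /\
         finite_set [set C | components (K `\` (Ux `|` Uy)) C /\
                             C `&` rel_boundary K Ux !=set0 /\
                             C `&` rel_boundary K Uy !=set0])].

(* U(J1,J2): the component of \hat C \ (J1 u J2) whose boundary
   (in \hat C; it is open in the sphere so its boundary is closure minus it)
   is J1 u J2 *)
Definition U_between (J1 J2 : set P3) (U : set P3) : Prop :=
  components (sphere `\` (J1 `|` J2)) U /\ closure U `\` U = J1 `|` J2.

Definition hausdorff_cvg (Pn : nat -> set P3) (L : set P3) : Prop :=
  closed L /\
  forall e : R, 0 < e -> \forall n \near \oo,
    (forall p, Pn n p -> exists2 q, L q & ball p e q) /\
    (forall q, L q -> exists2 p, Pn n p & ball q e p).

Definition schoenflies_rel (K : set P3) : set (P3 * P3) :=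
  [set xy | K xy.1 /\ K xy.2 /\
    (xy.1 = xy.2 \/
     (xy.1 <> xy.2 /\
      exists J1 J2 U : set P3,
        [/\ simple_closed_curve J1, simple_closed_curve J2,
            J1 `&` J2 = set0, J1 xy.1 & J2 xy.2] /\ U_between J1 J2 U /\
        exists (Pn : nat -> set P3) (L : set P3),
          [/\ injective Pn,
              (forall n, components (closure U `&` K) (Pn n)),
              (forall n, Pn n `&` J1 !=set0 /\ Pn n `&` J2 !=set0),
              hausdorff_cvg Pn L & L xy.1 /\ L xy.2]))].

Definition closed_rel_section (K : set P3) (x : P3) : set P3 :=
  [set y | closure (schoenflies_rel K) (x, y)].

End Defs.

(* Main.v *)
(* A point y of S(x) yields related pairs near (x, y): cut K along small Apollonius circles
   around x and y; infinitely many components of K cross the band between the circles, and a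
   Hausdorff-convergent sequence of them has a limit meeting both circles.

   Conversely let (x, y) be related through J1, J2, U and P_n, and suppose that neighbourhoods
   of x and y leave only finitely many crossing components. Then one of these, C, contains
   crossing pieces of infinitely many P_n, so it cannot stay in the closure of U. Hence
   infinitely many disjoint continua in the closure of U run from near x to near y and touch
   the same curve, say J1, away from x. Three such continua on one side of a Jordan curve are
   impossible in the plane. This follows from Janiszewski's theorem and from the separation of
   the plane by a Jordan curve, both obtained from mod 2 cochains on fine square grids. *)
Require Import Defs.
From HB Require Import structures.
From mathcomp Require Import all_boot all_order all_algebra.
From mathcomp Require Import all_classical all_reals all_analysis.
From mathcomp Require Import ring lra zify.
Set Implicit Arguments. Unset Strict Implicit. Unset Printing Implicit Defensive.
Import Order.TTheory GRing.Theory Num.Theory.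
Import numFieldNormedType.Exports.
Local Open Scope classical_set_scope.
Local Open Scope ring_scope.

(** Why C leaves the closure of U: otherwise C would lie in a single P_n by maximality of
    components, although it meets infinitely many of them. Boundary bumping then makes each crossing
    piece, continued inside C and the closure of U, reach J1 or J2. Since C avoids the two
    neighbourhoods, the contact is away from x and y; this confines the contact parameter to an
    interval [eta, 1 - eta] of the curve, and of three contacts one lies strictly between the
    others.

    Apollonius circles serve both directions: their definition is symmetric in x and y, and
    stereographic projection from y turns them into concentric circles around the image of x.

    The obstacle in the plane is that compacta carry no polygonal structure. Connectedness of a
    complement is therefore translated into dual mod 2 chains that keep a positive distance from the
    compactum, at every fine enough mesh, and translated back at one mesh. Such a chain needs no
    underlying path, only finite support and a prescribed boundary, so two of them can simply be
    added. *)

(** The form in which connectedness is mostly used below: the points of [X] satisfying [P] and those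
    violating it are both relatively open. *)
Lemma connected_loc_const (T : topologicalType) (X : set T) (P : T -> Prop) :
  connected X ->
  (forall x, X x -> \forall y \near x, X y -> (P x <-> P y)) ->
  forall x y, X x -> X y -> P x -> P y.
Proof.
move=> cX loc x y Xx Xy Px.
have open_part (Q : T -> Prop) : (forall x, X x -> \forall y \near x, X y -> Q x -> Q y) ->
    exists2 C, open C & X `&` [set z | Q z] = X `&` C.
  move=> locQ; exists (interior [set z | X z -> Q z]); first exact: open_interior.
  apply/seteqP; split=> z [Xz Qz]; split => //.
    by have := locQ z Xz; apply: filterS => t Qt Xt; apply: Qt.
  exact: (interior_subset Qz).
suff /seteqP[_ /(_ y Xy)[]] : X `&` [set z | P z] = X by [].
apply: cX; first by exists x.
  by apply: open_part => z /loc; apply: filterS => t PQ Xt; rewrite PQ.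
have [|C oC CE] := open_part (fun z => ~ P z).
  by move=> z /loc; apply: filterS => t PQ Xt; rewrite PQ.
exists (~` C); first exact: open_closedC.
apply/seteqP; split=> z [Xz Pz]; split => //.
  by move=> Cz; have : (X `&` C) z by []; rewrite -CE => -[].
by apply: contrapT => nP; apply: Pz; have : (X `&` [set z | ~ P z]) z by []; rewrite CE => -[].
Qed.

(** * Continua in metric spaces *)

Section PseudoMetric.
Variables (R : realType) (T : pseudoMetricType R).
Implicit Types (X F G : set T) (e : R) (x y z : T).

(** Stands in for Lebesgue numbers: [P] survives shrinking of the scale, so a scale valid around
    each point can be chosen uniformly on [K]. *)
Lemma compact_uniform (K : set T) (P : R -> T -> Prop) : compact K ->
  (forall e e' x, 0 < e' -> e' <= e -> P e x -> P e' x) ->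
  (forall x, K x -> exists2 e, 0 < e & forall y, K y -> ball x e y -> P e y) ->
  exists2 e, 0 < e & forall y, K y -> P e y.
Proof.
move=> /compact_near_coveringP/near_covering_withinP cK mono loc.
have [|e /= e0 H] := cK R (0^'+) P _.
  move=> x Kx; have [e e0 He] := loc x Kx.
  exists (ball x e, [set e' | 0 < e' /\ e' <= e]) => /=.
    split; first exact: nbhsx_ballx.
    near=> e'; split; near: e'; [exact: nbhs_right_gt|exact: nbhs_right_le].
  by move=> [y e'] /= [bxy [e'0 e'e]] Ky; apply: (mono e) => //; exact: He.
exists (e / 2); first by rewrite divr_gt0.
have e2 : `|0 - e / 2| < e by rewrite sub0r normrN gtr0_norm; lra.
by move=> y Ky; apply: (H (e/2) e2) => //; rewrite divr_gt0.
Unshelve. all: end_near. Qed.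

(** * Chains of small mesh, quasi-components and separations *)

Definition chain_closed X e (S : set T) :=
  forall x y, S x -> X x -> X y -> ball x e y -> S y.

(** Existence of a chain in [X] with steps shorter than [e], encoded impredicatively: induction
    along the chain is instantiation of [S]. *)
Definition reach X e x y := forall S : set T, S x -> chain_closed X e S -> S y.

Lemma reach_refl X e x : reach X e x x. Proof. by []. Qed.

Lemma reach_trans X e x y z : reach X e x y -> reach X e y z -> reach X e x z.
Proof. by move=> xy yz S Sx cS; apply: yz => //; apply: xy. Qed.

Lemma reach_ball X e x y : X x -> X y -> ball x e y -> reach X e x y.
Proof. by move=> Xx Xy b S Sx cS; apply: (cS x). Qed.

Lemma reach_le X e e' x y : e <= e' -> reach X e x y -> reach X e' x y.
Proof.
by move=> ee' r S Sx cS; apply: r => // a b Sa Xa Xb bab; apply: (cS a) => //; apply: le_ball bab.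
Qed.

Lemma reach_closed X e x : chain_closed X e [set y | reach X e x y].
Proof. by move=> a b /= xa Xa Xb bab; apply: reach_trans xa _; exact: reach_ball. Qed.

(* [Q] is the quasi-component of [x]. If it split into two separated pieces, the closed
   middle region between their neighbourhoods would, by compactness, be unreachable from
   [x] for one uniform mesh, so chains of that mesh could not leave the first piece. *)
Lemma reach_all_connected X x : compact X -> closed X -> X x ->
  connected [set y | X y /\ forall e, 0 < e -> reach X e x y].
Proof.
move=> cX clX Xx; set Q := [set y | _].
have Qx : Q x by split => // e _; exact: reach_refl.
have clQ : closed Q.
  move=> z clz; have Xz : X z by apply: clX; apply: closureS clz => ? [].
  split => // e e0; have [y [[Xy ry] bzy]] := clz _ (nbhsx_ballx z e e0).
  by apply: reach_trans (ry e e0) _; apply: reach_ball => //; exact: ball_sym.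
apply: contrapT => /connectedPn[E [E0 QE sE]].
wlog E0x : E E0 QE sE / E false x.
  move=> H; have : Q x by []. rewrite {1}QE => -[]; first exact: H.
  by apply: (H (E \o negb)) => [b||] /=; [exact: E0|rewrite setUC|rewrite separatedC].
have EQ b : E b `<=` Q by rewrite QE => y; case: b; [right|left].
have clE b : closed (E b).
  move=> y cly; have : Q y by apply: clQ; apply: closureS cly; exact: EQ.
  rewrite QE; case: b cly => cly [] // Ey; exfalso; case: sE => s1 s2.
    by have : set0 y by rewrite -s2.
  by have : set0 y by rewrite -s1.
have cE b : compact (E b).
  by apply: (subclosed_compact (clE b) cX) => y /EQ[].
have disj y : E false y -> ~ E true y.
  by move=> Ef Et; have : set0 y by rewrite -(separated_disjoint sE).
have [d d0 Hd] : exists2 e, 0 < e & forall y, E false y -> forall z, E true z -> ~ ball y e z.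
  apply: compact_uniform => //.
    by move=> e e' y _ ee' H z Ez bz; apply: (H z Ez); exact: le_ball bz.
  move=> y Ey; have : \forall z \near y, ~ E true z.
    have : open (~` E true) by exact/closed_openC/clE.
    by rewrite openE => /(_ y) /=; apply; exact: disj.
  move=> /nbhs_ballP[e /= e0 He]; exists (e/2); first by rewrite divr_gt0.
  move=> y' Ey' yy' z Ez y'z; apply: (He z) => //.
  by rewrite [e]splitr; apply: ball_triangle yy' _.
(* A step shorter than [h] from the [h]-neighbourhood of [E false] into that of [E true] would bring
   the two pieces within [3 h = d] of each other. Hence every chain leaving the first piece must
   pass through [M]. *)
pose h := d / 3; have h0 : 0 < h by rewrite divr_gt0.
pose M := [set m | X m /\ (forall y, E false y -> ~ ball y h m) /\
                          (forall y, E true y -> ~ ball y h m)].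
have [e e0 He] : exists2 e, 0 < e & forall m, M m -> ~ reach X e x m.
  have cM : compact (closure M `&` X).
    by apply: (subclosed_compact _ cX); [apply: closedI => //; exact: closed_closure | move=> ? []].
  have [] := @compact_uniform (closure M `&` X) (fun e m => M m -> ~ reach X e x m) cM.
  - by move=> e e' m _ ee' H /H; apply: contra_not; exact: reach_le.
  - move=> m [clm Xm].
    have nQ : ~ Q m.
      have nbE b : ~ E b m.
        move=> Em; have [z [[Xz [Mf Mt]] bz]] := clm _ (nbhsx_ballx m h h0).
        by case: b Em => Em; [apply: (Mt m)|apply: (Mf m)].
      by rewrite QE => -[]; exact: nbE.
    have [e e0 ne] : exists2 e, 0 < e & ~ reach X e x m.
      apply: contrapT => H; apply: nQ; split => // e e0; apply: contrapT => nr.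
      by apply: H; exists e.
    exists e => // y [_ Xy] by_ _; apply: contra_not ne => r.
    by apply: reach_trans r _; apply: reach_ball => //; exact: ball_sym.
  by move=> e e0 H; exists e => // m Mm; apply: H => //; split; [exact: subset_closure|case: Mm].
pose e1 := Num.min e h; have e10 : 0 < e1 by rewrite lt_min e0 h0.
have [w Ew] := E0 true.
have [_ /(_ _ e10) rw] : Q w by rewrite QE; right.
pose S := [set z | X z -> reach X e1 x z /\ exists2 y, E false y & ball y h z].
have /[dup] : S w.
  apply: rw => [_|a b Sa Xa Xb bab _].
    by split => //; exists x => //; exact: ballxx.
  have [ra [y Ey bya]] := Sa Xa.
  have rb : reach X e1 x b by apply: reach_trans ra _; exact: reach_ball.
  split => //; apply: contrapT => nb.
  apply: (He b); last by apply: reach_le rb; rewrite ge_min lexx.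
  split => //; split; first by move=> y' Ey' by'; apply: nb; exists y'.
  move=> y' Ey' by'b; apply: (Hd _ Ey _ Ey').
  have -> : d = h + h + h by rewrite /h; field.
  apply: ball_triangle (ball_sym by'b); apply: ball_triangle bya _.
  by apply: le_ball bab; rewrite ge_min lexx orbT.
have [Xw _] : Q w by rewrite QE; right.
move=> /(_ Xw)[_ [y Ey byw]] _; apply: (Hd _ Ey _ Ew); apply: le_ball byw.
by rewrite /h ler_pdivrMr // ler_peMr // ?ltW //; lra.
Qed.

(** Points joined by chains of every mesh lie in one component, so each pair from [F] and [G] is
    separated by some mesh. Compactness, applied first in [y] and then in [x], gives one mesh [e]
    for all pairs; the points reachable from [F] at this mesh form a clopen part of [X]. *)
Lemma closed_separation X F G : compact X -> closed X -> closed F -> closed G ->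
  (forall x y, X x -> F x -> X y -> G y -> ~ connected_component X x y) ->
  exists X1 X2, [/\ closed X1, closed X2, X = X1 `|` X2, X1 `&` X2 = set0 &
    X `&` F `<=` X1 /\ X `&` G `<=` X2].
Proof.
move=> cX clX clF clG nc.
have cXF : compact (X `&` F) by apply: (subclosed_compact _ cX); [exact: closedI|move=> ? []].
have cXG : compact (X `&` G) by apply: (subclosed_compact _ cX); [exact: closedI|move=> ? []].
have [e e0 He] : exists2 e, 0 < e &
    forall x, (X `&` F) x -> forall y, (X `&` G) y -> ~ reach X e x y.
  apply: compact_uniform => //.
    by move=> e e' x _ ee' H y /H; apply: contra_not; exact: reach_le.
  move=> x [Xx Fx].
  have [e e0 He] : exists2 e, 0 < e & forall y, (X `&` G) y -> ~ reach X e x y.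
    apply: compact_uniform => //.
      by move=> e e' y _ ee'; apply: contra_not; exact: reach_le.
    move=> y [Xy Gy].
    have [e e0 ne] : exists2 e, 0 < e & ~ reach X e x y.
      apply: contrapT => H; apply: (nc x y) => //.
      exists [set y | X y /\ forall e, 0 < e -> reach X e x y].
        split; [by split => // ? _; exact: reach_refl | by move=> ? [] | exact: reach_all_connected].
      split => // e e0; apply: contrapT => nr.
      by apply: H; exists e.
    exists e => // z [Xz _] yz; apply: contra_not ne => rz.
    by apply: reach_trans rz _; apply: reach_ball => //; exact: ball_sym.
  exists e => // x' [Xx' _] xx' y Gy rx'; apply: (He y Gy).
  by apply: reach_trans rx'; exact: reach_ball.
pose S := [set z | exists2 x, (X `&` F) x & reach X e x z].
have cS : chain_closed X e S.
  by move=> a b [x Fx rx] Xa Xb bab; exists x => //; exact: reach_closed bab.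
have clS : closed (X `&` S).
  move=> z clz; have Xz : X z by apply: clX; apply: closureS clz => ? [].
  split => //; have [y [[Xy Sy] bzy]] := clz _ (nbhsx_ballx z e e0).
  by apply: (cS y) => //; exact: ball_sym.
have clS' : closed (X `&` ~` S).
  move=> z clz; have Xz : X z by apply: clX; apply: closureS clz => ? [].
  split => // Sz; have [y [[Xy Sy] bzy]] := clz _ (nbhsx_ballx z e e0).
  by apply: Sy; exact: (cS z).
exists (X `&` S), (X `&` ~` S); split => //.
- by rewrite -setIUr setUCr setIT.
- by rewrite setIACA setICr setI0.
- split=> x [Xx Fx]; split => //; first by exists x.
  by case=> y Fy; exact: He.
Qed.

Lemma connected_closed_split X X1 X2 : connected X -> closed X1 -> closed X2 ->
  X `<=` X1 `|` X2 -> X1 `&` X2 `&` X = set0 -> (X1 `&` X) !=set0 -> X `<=` X1.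
Proof.
move=> cX cl1 cl2 sub dis [x [X1x Xx]] y Xy.
pose P z := X1 z.
apply: (@connected_loc_const _ X P cX _ x y) => // z Xz.
have open_side (A B : set T) : closed A -> X `<=` A `|` B -> ~ A z -> \forall y \near z, X y -> B y.
  move=> clA sA nA; have : open (~` A) by exact: closed_openC.
  rewrite openE => /(_ z nA); apply: filterS => t nAt Xt.
  by case: (sA t Xt).
have dz t : X t -> X1 t -> X2 t -> False by move=> *; have : set0 t by rewrite -dis.
have [X1z|nX1z] := pselect (X1 z).
  have nX2 : ~ X2 z by move=> X2z; exact: (dz z).
  have := open_side X2 X1 cl2 _ nX2; rewrite setUC => /(_ sub).
  by apply: filterS => t Ht Xt; split => // _; exact: Ht.
have := open_side X1 X2 cl1 sub nX1z.
by apply: filterS => t Ht Xt; split => // X1t; exfalso; apply: (dz t) => //; exact: Ht.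
Qed.

Lemma component_compact X x : compact X -> closed X -> compact (connected_component X x).
Proof.
by move=> cX clX; apply: (subclosed_compact (component_closed clX) cX); exact: connected_component_sub.
Qed.

(** If no component of [P] outside [A] and [B] touched both closures, a separation [X1], [X2] of
    that remainder, enlarged by the closures of [P] in [A] and in [B], would disconnect [P]. *)
Lemma continuum_between (P A B : set T) : connected P -> compact P -> closed P ->
  open A -> open B ->
  A `&` B `&` P = set0 -> P `&` A !=set0 -> P `&` B !=set0 ->
  exists T0, [/\ connected T0, compact T0, T0 `<=` P, T0 `&` (A `|` B) = set0 &
    T0 `&` closure (P `&` A) !=set0 /\ T0 `&` closure (P `&` B) !=set0].
Proof.
move=> cP kP clP oA oB AB [a [Pa Aa]] [b [Pb Bb]].
pose X := P `&` ~` (A `|` B).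
have clX : closed X by apply: closedI => //; apply: open_closedC; exact: openU.
have kX : compact X by apply: (subclosed_compact clX kP) => ? [].
apply: contrapT => nT.
have [x y Xx Ax Xy By cxy|X1 [X2 [cl1 cl2 XE X12 [FX GX]]]] :=
    closed_separation kX clX (@closed_closure _ (P `&` A)) (@closed_closure _ (P `&` B)).
  apply: nT; exists (connected_component X x); split.
  - exact: component_connected.
  - exact: component_compact.
  - by move=> z /connected_component_sub[].
  - by apply/disjoints_subset => z /connected_component_sub[].
  - split; last by exists y.
    by exists x; split => //; exact: connected_component_refl.
have nclA z : P z -> B z -> ~ closure (P `&` A) z.
  move=> Pz Bz /(_ B (open_nbhs_nbhs (conj oB Bz)))[t [[Pt At] Bt]].
  by have : set0 t by rewrite -AB.
have nclB z : P z -> A z -> ~ closure (P `&` B) z.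
  move=> Pz Az /(_ A (open_nbhs_nbhs (conj oA Az)))[t [[Pt Bt] At]].
  by have : set0 t by rewrite -AB.
have clP0 Q : closure (P `&` Q) `<=` P by move=> z clz; apply: clP; apply: closureS clz => ? [].
have X12' z : X1 z -> X2 z -> False by move=> *; have : set0 z by rewrite -X12.
have XP z : X z -> P z by case.
have X1P z : X1 z -> X z by move=> ?; rewrite XE; left.
have X2P z : X2 z -> X z by move=> ?; rewrite XE; right.
suff : (X1 `|` closure (P `&` A)) b.
  case=> [/X1P[_ []]|]; first by right.
  exact: nclA.
apply: (@connected_closed_split P _ (X2 `|` closure (P `&` B))) => //.
- by apply: closedU => //; exact: closed_closure.
- by apply: closedU => //; exact: closed_closure.
- move=> z Pz; have [Az|nA] := pselect (A z).
    by left; right; apply: subset_closure.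
  have [Bz|nB] := pselect (B z).
    by right; right; apply: subset_closure.
  have : X z by split => // -[].
  by rewrite XE => -[]; [left; left|right; left].
- rewrite -subset0 => z [[h1 h2] Pz].
  have [Xz|nXz] := pselect (X z).
    have : X1 z by case: h1 => // ?; apply: FX; split.
    have : X2 z by case: h2 => // ?; apply: GX; split.
    by move=> ? ?; exact: (X12' z).
  have {}h1 : closure (P `&` A) z by case: h1 => // /X1P.
  have {}h2 : closure (P `&` B) z by case: h2 => // /X2P.
  have [Az|nA] := pselect (A z); first exact: (nclB z).
  have [Bz|nB] := pselect (B z); first exact: (nclA z).
  by apply: nXz; split => // -[].
- by exists a; split => //; right; exact: subset_closure.
Qed.

(* Boundary bumping: a component of [C `&` V] inside the open set [O] would split off from [C]. *)
Lemma component_reaches_boundary (C V O : set T) q : connected C -> compact C -> closed C ->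
  closed V -> open O -> C `&` O `<=` V -> C q -> V q -> ~ C `<=` V ->
  connected_component (C `&` V) q `&` ~` O !=set0.
Proof.
move=> cC kC clC clV oO COV Cq Vq nCV; set X := C `&` V.
have clX : closed X by exact: closedI.
have kX : compact X by apply: (subclosed_compact clX kC) => ? [].
have Xq : X q by [].
apply: contrapT => nT.
have [x y Xx qx Xy nOy xy|X1 [X2 [cl1 cl2 XE X12 [FX GX]]]] :=
    closed_separation kX clX (component_closed (x := q) clX) (open_closedC oO).
  by apply: nT; exists y; split => //; apply: connected_component_trans qx xy.
have X1X z : X1 z -> X z by move=> ?; rewrite XE; left.
apply: nCV; suff CX1 : C `<=` X1 by move=> z /CX1/X1X[].
apply: (@connected_closed_split C _ (X2 `|` (C `&` ~` O))) => //.
- by apply: closedU => //; apply: closedI => //; exact: open_closedC.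
- move=> z Cz; have [Oz|nOz] := pselect (O z); last by right; right.
  have : X z by split => //; exact: COV.
  by rewrite XE => -[]; [left|right; left].
- rewrite -subset0 => z [[h1 h2] _].
  have X2z : X2 z by case: h2 => // -[_ nOz]; apply: GX; split => //; exact: X1X.
  by rewrite -X12.
- by exists q; split => //; apply: FX; split => //; exact: connected_component_refl.
Qed.

End PseudoMetric.

(** * Mod 2 cochains on the square grid *)

(* A vertex also names the unit face having it as lower left corner. [c true v] and [c false v]
   are the values of the cochain [c] on the horizontal and the vertical edge starting at [v]. *)
Definition vertex := (int * int)%type.
Definition nxt (d : bool) (v : vertex) : vertex :=
  if d then (v.1 + 1, v.2) else (v.1, v.2 + 1).
Definition cochain := bool -> vertex -> bool.
Definition grad (phi : vertex -> bool) : cochain := fun d v => phi v (+) phi (nxt d v).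
(** Coboundary on the face [f]: bottom, top, left and right edge. Read dually, each edge joins the
    two faces it borders, [c] is a 1-chain of faces and [curl c] is its boundary. *)
Definition curl (c : cochain) (f : vertex) : bool :=
  c true f (+) c true (nxt false f) (+) (c false f (+) c false (nxt true f)).
Definition finite_cochain (c : cochain) :=
  exists N : nat, forall d v, (N%:Z < `|v.1|) || (N%:Z < `|v.2|) -> c d v = false.
Definition addc (c c' : cochain) : cochain := fun d v => c d v (+) c' d v.

Lemma nxtC v : nxt true (nxt false v) = nxt false (nxt true v).
Proof. by []. Qed.

Lemma nxt_inj d v w : (nxt d v == nxt d w) = (v == w).
Proof.
case: v w => [i j] [k l]; rewrite /nxt; case: d => /=; rewrite !xpair_eqE.
  by rewrite (inj_eq (addIr _)).
by rewrite (inj_eq (addIr _)).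
Qed.

Lemma curl_grad phi f : curl (grad phi) f = false.
Proof.
rewrite /curl /grad -nxtC.
by case: (phi f); case: (phi (nxt true f)); case: (phi (nxt false f)); case: (phi (nxt true (nxt false f))).
Qed.

Lemma curl_addc c c' f : curl (addc c c') f = curl c f (+) curl c' f.
Proof.
rewrite /curl /addc; case: (c true f); case: (c' true f); case: (c true (nxt false f));
  case: (c' true (nxt false f)); case: (c false f); case: (c' false f);
  by case: (c false (nxt true f)); case: (c' false (nxt true f)).
Qed.

Lemma finite_addc c c' : finite_cochain c -> finite_cochain c' -> finite_cochain (addc c c').
Proof.
move=> [N HN] [M HM]; exists (N + M)%N => d v Hv.
by rewrite /addc HN ?HM //; case/orP: Hv => Hv; apply/orP; [left|right|left|right]; lia.
Qed.

Lemma finite_grad (phi : vertex -> bool) :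
  (exists N : nat, forall v, (N%:Z < `|v.1|) || (N%:Z < `|v.2|) -> phi v = false) ->
  finite_cochain (grad phi).
Proof.
move=> [N HN]; exists N.+1 => d v Hv; rewrite /grad (HN v); last by lia.
by rewrite HN //; case: v Hv => i j /=; case: d => /=; lia.
Qed.

Lemma int_primitive (a : int -> bool) :
  exists s : int -> bool, s 0 = false /\ forall i, s (i + 1) = s i (+) a i.
Proof.
exists (fun i => match i with Posz n => \big[addb/false]_(k < n) a k
                     | Negz n => \big[addb/false]_(k < n.+1) a (Negz k) end).
split; first exact: big_ord0.
case=> [n|[|n]].
- by rewrite -PoszD addn1 big_ord_recr.
- rewrite (_ : Negz 0 + 1 = Posz 0) //.
  by rewrite [LHS]big_ord0 [X in _ = X (+) _]big_ord1 addbb.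
- rewrite (_ : Negz n.+1 + 1 = Negz n); last by lia.
  by rewrite [in RHS]big_ord_recr /= -addbA addbb addbF.
Qed.

Lemma int_const (s : int -> bool) : (forall i, s (i + 1) = s i) -> forall i j, s i = s j.
Proof.
move=> H; suff s0 i : s i = s 0 by move=> i j; rewrite !s0.
elim/int_rect: i => [//|n IH|n IH]; first by rewrite -IH -(H n%:Z); congr s; lia.
by rewrite -IH -(H (- (n.+1)%:Z)); congr s; lia.
Qed.

(** Poincare lemma on the grid: the potential is integrated along row 0 and then along columns. The
    error [g] on horizontal edges is zero in row 0, and vanishing [curl] makes it the same in all
    rows. *)
Lemma closed_cochain_exact c : curl c =1 xpred0 ->
  exists phi, forall d v, c d v = grad phi d v.
Proof.
move=> cl; have [r [r0 Hr]] := int_primitive (fun i => c true (i, 0)).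
have /choice[s Hs] i := int_primitive (fun j => c false (i, j)).
exists (fun v => r v.1 (+) s v.1 v.2) => d [i j]; rewrite /grad /nxt.
have [s0 sS] := Hs i; have [s0' sS'] := Hs (i + 1).
case: d => /=; last by rewrite sS; case: (r i); case: (s i j); case: (c _ _).
pose g j := c true (i, j) (+) (r i (+) s i j (+) (r (i + 1) (+) s (i + 1) j)).
suff : g j = g 0.
  rewrite /g s0 s0' Hr; case: (c _ (i, j)); case: (c _ (i, 0)); case: (r i);
    by case: (s i j); case: (s (i+1) j).
apply: int_const => k; have := cl (i, k); rewrite /g /curl /nxt /= sS sS'.
case: (c _ (i, k)); case: (c _ (i, k + 1)); case: (c _ (i, k)); case: (c _ (i + 1, k));
  by case: (r i); case: (r (i + 1)); case: (s i k); case: (s (i + 1) k).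
Qed.

Lemma addb_telescope (a : int -> bool) (i : int) n :
  \big[addb/false]_(k < n) (a (i + k%:Z) (+) a (i + k%:Z + 1)) = a i (+) a (i + n%:Z).
Proof.
elim: n => [|n IH]; first by rewrite big_ord0 addr0 addbb.
rewrite big_ord_recr /= IH (_ : i + n.+1%:Z = i + n%:Z + 1); last by lia.
by case: (a i); case: (a (i + n)); case: (a _).
Qed.

Lemma addb_delta (i j : int) n : i <= j -> j < i + n%:Z ->
  \big[addb/false]_(k < n) (i + k%:Z == j) = true.
Proof.
move=> ij jn; have lt : (`|j - i| < n)%N by lia.
rewrite (bigD1 (Ordinal lt)) //= big1 => [|k kn].
  by rewrite addbF; apply/eqP; lia.
by apply/negbTE; apply: contra kn => /eqP E; apply/eqP/val_inj => /=; lia.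
Qed.

(* The mod 2 row sums of [c] over horizontal edges would jump exactly once, at the row of
   [f0], yet vanish on both far sides. *)
Lemma finite_curl_neq_single c f0 : finite_cochain c -> ~ forall f, curl c f = (f == f0).
Proof.
move=> [N HN] cl; case: f0 cl => i0 j0 cl.
pose M : nat := (N + `|i0| + 1)%N.
pose n := (2 * M + 1)%N.
pose t j := \big[addb/false]_(k < n) c true (- M%:Z + k%:Z, j).
have tS j : t j (+) t (j + 1) = (j == j0).
  have : \big[addb/false]_(k < n) curl c (- M%:Z + k%:Z, j) = (j == j0).
    have [->|nj] := eqVneq j j0.
      rewrite -[RHS](@addb_delta (- M%:Z) i0 n); [|lia|lia].
      by apply: eq_bigr => k _; rewrite cl xpair_eqE eqxx andbT.
    by rewrite big1 // => k _; rewrite cl xpair_eqE (negbTE nj) andbF.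
  rewrite /curl !big_split /= -/(t j) -/(t (j + 1)).
  have := addb_telescope (fun i => c false (i, j)) (- M%:Z) n.
  rewrite big_split /= => ->.
  by rewrite !HN ?addbF //=; apply/orP; left; lia.
have far j : N%:Z < `|j| -> t j = false.
  by move=> Nj; rewrite /t big1 // => k _; apply: HN; rewrite Nj orbT.
have up m : t (j0 + 1 + m%:Z) = t (j0 + 1).
  elim: m => [|m <-]; first by rewrite addr0.
  have := tS (j0 + 1 + m%:Z); rewrite (_ : (_ == j0) = false); last by lia.
  rewrite (_ : j0 + 1 + m%:Z + 1 = j0 + 1 + m.+1%:Z); last by lia.
  by case: (t _); case: (t _).
have down m : t (j0 - m%:Z) = t j0.
  elim: m => [|m <-]; first by rewrite subr0.
  have := tS (j0 - m.+1%:Z); rewrite (_ : (_ == j0) = false); last by lia.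
  rewrite (_ : j0 - m.+1%:Z + 1 = j0 - m%:Z); last by lia.
  by case: (t _); case: (t _).
have := tS j0; rewrite eqxx -(up (N + `|j0| + 1)%N) -(down (N + `|j0| + 1)%N).
by rewrite !far //; lia.
Qed.

(** * Janiszewski's theorem *)

Section Plane.
Variable R : realType.
Local Notation plane := (R * R)%type.
Implicit Types (A B X Y : set plane) (p q z w : plane) (h e r : R) (v f g : vertex).

Lemma cvg_pair_point (T : topologicalType) (f g : T -> R) (t : T) (a b : R) :
  f x @[x --> t] --> a -> g x @[x --> t] --> b -> (f x, g x) @[x --> t] --> (a, b).
Proof. by move=> fa gb; apply: (cvg_pair fa gb). Qed.

Lemma plane_ballE z e w : ball z e w <-> `|z.1 - w.1| < e /\ `|z.2 - w.2| < e.
Proof. by []. Qed.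

Definition node h v : plane := (v.1%:~R * h, v.2%:~R * h).
Definition cell h z : vertex := (Num.floor (z.1 / h), Num.floor (z.2 / h)).
Definition near_set A e z := exists2 a, A a & ball a e z.

Lemma floor_dist h (x : R) : 0 < h -> `|x - (Num.floor (x / h))%:~R * h| < h.
Proof.
move=> h0; have := floor_itv (x / h).
rewrite ler_pdivlMr // ltr_pdivrMr // intrD mulrDl mul1r => /andP[a b].
by rewrite ger0_norm; lra.
Qed.

Lemma ball_cell h z : 0 < h -> ball z h (node h (cell h z)).
Proof. by move=> h0; apply/plane_ballE; split => /=; exact: floor_dist. Qed.

Lemma cell_node h v : 0 < h -> cell h (node h v) = v.
Proof.
by move=> h0; case: v => i j; rewrite /cell /node /= !mulfK ?gt_eqF // !intrKfloor.
Qed.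

Lemma ball_nxt h d v : 0 < h -> ball (node h v) (2 * h) (node h (nxt d v)).
Proof.
move=> h0; apply/plane_ballE; rewrite /node /nxt.
by case: d; split => /=; rewrite ?intrD ?mulrDl ?mul1r ltr_distl; apply/andP; split; lra.
Qed.

Lemma interval_walk (I : int -> Prop) (P : int -> int -> Prop) :
  (forall i, P i i) -> (forall i j k, P i j -> P j k -> P i k) -> (forall i j, P i j -> P j i) ->
  (forall i j k, I i -> I k -> i <= j -> j <= k -> I j) ->
  (forall i, I i -> I (i + 1) -> P i (i + 1)) -> forall i j, I i -> I j -> P i j.
Proof.
move=> Pr Pt Ps Iconv step.
have up n i : I i -> I (i + n%:Z) -> P i (i + n%:Z).
  elim: n => [|n IH] Ii In; first by rewrite addr0.
  have In' : I (i + n%:Z) by apply: Iconv Ii In _ _; lia.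
  apply: Pt (IH Ii In') _; rewrite (_ : i + n.+1%:Z = i + n%:Z + 1); last by lia.
  by apply: step => //; rewrite (_ : i + n%:Z + 1 = i + n.+1%:Z); last by lia.
move=> i j Ii Ij; have [ij|ji] := leP i j.
  have E : j = i + `|j - i|%N%:Z by lia.
  by rewrite E; apply: up => //; rewrite -E.
have E : i = j + `|i - j|%N%:Z by lia.
by apply: Ps; rewrite E; apply: up => //; rewrite -E.
Qed.

(** Balls of the product metric are squares, so the grid walk may go horizontally to the corner
    [(k, j)] and then vertically without leaving the ball. *)
Lemma ball_walk h z r (P : vertex -> vertex -> Prop) : 0 < h ->
  (forall v, P v v) -> (forall u v v', P u v -> P v v' -> P u v') -> (forall u v, P u v -> P v u) ->
  (forall d v, ball z r (node h v) -> ball z r (node h (nxt d v)) -> P v (nxt d v)) ->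
  forall u v, ball z r (node h u) -> ball z r (node h v) -> P u v.
Proof.
move=> h0 Pr Pt Ps step [i j] [k l] /plane_ballE /= [bi bj] /plane_ballE /= [bk bl].
have conv (x : R) (a b c : int) : `|x - a%:~R * h| < r -> `|x - c%:~R * h| < r ->
    a <= b -> b <= c -> `|x - b%:~R * h| < r.
  rewrite -(ler_int R) -(ler_int R b) -(ler_pM2r h0) -(ler_pM2r h0 b%:~R).
  by rewrite !ltr_distl => /andP[? ?] /andP[? ?] ? ?; apply/andP; split; lra.
apply: (@Pt _ (k, j)).
  apply: (@interval_walk (fun a => `|z.1 - a%:~R * h| < r) (fun a b => P (a, j) (b, j))) => //.
  - by move=> a b c; exact: Pt.
  - by move=> a b; exact: Ps.
  - exact: conv.
  - by move=> a Ia Ia'; apply: (step true (a, j)); apply/plane_ballE.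
apply: (@interval_walk (fun a => `|z.2 - a%:~R * h| < r) (fun a b => P (k, a) (k, b))) => //.
- by move=> a b c; exact: Pt.
- by move=> a b; exact: Ps.
- exact: conv.
- by move=> a Ia Ia'; apply: (step false (k, a)); apply/plane_ballE.
Qed.

(** [phi] read through [cell] is locally constant on [X]: the cells of two nearby points are linked
    by a grid walk in a ball of radius [2 * h], where [grad phi] vanishes. *)
Lemma grad0_const h e X phi : 0 < h -> 4 * h <= e -> connected X ->
  (forall d v, near_set X e (node h v) -> grad phi d v = false) ->
  forall x y, X x -> X y -> phi (cell h x) = phi (cell h y).
Proof.
move=> h0 he cX gr x y Xx Xy.
apply: esym; apply: (@connected_loc_const _ X (fun z => phi (cell h z) = phi (cell h x)) cX _ x y) => //.
move=> z Xz; apply/nbhs_ballP; exists h => // w zw _.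
suff -> : phi (cell h z) = phi (cell h w) by [].
apply: (@ball_walk h z (2 * h) (fun u v => phi u = phi v)) => //.
- by move=> u v t -> ->.
- move=> d v bv _; have := gr d v; rewrite /grad.
  have -> : (phi v (+) phi (nxt d v) = false) <-> (phi v = phi (nxt d v)).
    by case: (phi v); case: (phi _).
  by apply; exists z => //; apply: le_ball bv; lra.
- by apply: le_ball (ball_cell _ h0); lra.
- by rewrite (_ : 2 * h = h + h); [apply: ball_triangle zw (ball_cell _ h0)|ring].
Qed.

(* A dual 1-chain, crossing no edge near [A], with boundary [f + g] mod 2. *)
Definition link h e A f g := exists c, [/\ finite_cochain c,
  forall d v, near_set A e (node h v) -> c d v = false &
  forall f', curl c f' = (f' == f) (+) (f' == g)].

Lemma link_refl h e A f : link h e A f f.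
Proof. by exists (fun _ _ => false); split => // [|f']; [exists 0%N|rewrite addbb]. Qed.

Lemma link_sym h e A f g : link h e A f g -> link h e A g f.
Proof. by move=> [c [? ? H]]; exists c; split => // f'; rewrite H addbC. Qed.

Lemma link_trans h e A f g k : link h e A f g -> link h e A g k -> link h e A f k.
Proof.
move=> [c [fc oc cc]] [c' [fc' oc' cc']]; exists (addc c c'); split.
- exact: finite_addc.
- by move=> d v H; rewrite /addc oc // oc'.
- by move=> f'; rewrite curl_addc cc cc'; case: (f' == f); case: (f' == g); case: (f' == k).
Qed.

Lemma near_set_le A B e e' z : A `<=` B -> e <= e' -> near_set A e z -> near_set B e' z.
Proof. by move=> AB ee' [a /AB Aa b]; exists a => //; exact: le_ball b. Qed.

Lemma link_le h e e' A f g : e' <= e -> link h e A f g -> link h e' A f g.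
Proof.
move=> ee' [c [fc oc cc]]; exists c; split => // d v n; apply: oc.
exact: near_set_le n.
Qed.

Lemma link_nxt h e A d f : ~ near_set A e (node h (nxt d f)) -> link h e A f (nxt d f).
Proof.
(* The chain is the single edge shared by the faces [f] and [nxt d f]: it starts at [nxt d f] and
   runs in the other direction. *)
move=> nA; exists (fun d' v => (d' == ~~ d) && (v == nxt d f)); split.
- exists (`|f.1| + `|f.2| + 1)%N => d' v Hv; apply/negP => /andP[_ /eqP E].
  by move: Hv; rewrite E /nxt; case: d {nA E} => /=; lia.
- by move=> d' v n; apply/negP => /andP[_ /eqP E]; apply: nA; rewrite -E.
- by move=> f'; rewrite /curl; case: d {nA}; rewrite nxt_inj; case: (f' == f); case: (f' == nxt _ f).
Qed.

Lemma link_in_ball h e A z r : 0 < h -> (forall w, ball z r w -> ~ near_set A e w) ->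
  forall u v, ball z r (node h u) -> ball z r (node h v) -> link h e A u v.
Proof.
move=> h0 nA; apply: ball_walk => //.
- exact: link_refl.
- by move=> u v w; exact: link_trans.
- by move=> u v; exact: link_sym.
- by move=> d v _ b; apply: link_nxt; exact: nA.
Qed.

Lemma closed_ballN A p : closed A -> ~ A p -> exists2 e, 0 < e & ~ near_set A e p.
Proof.
move=> clA nA; have : open (~` A) by exact: closed_openC.
rewrite openE => /(_ p nA) /nbhs_ballP[e /= e0 He]; exists e => // -[a Aa b].
by apply: (He a) => //; exact: ball_sym.
Qed.

(** Discrete counterpart of [joined]. The same [e] bounds the mesh and measures the clearance from
    [A], so the clearance does not shrink with the mesh. *)
Definition mesh_link A p q := exists2 e, 0 < e &
  forall h, 0 < h -> h < e -> link h e A (cell h p) (cell h q).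

Lemma mesh_link_local A p : closed A -> ~ A p -> exists2 e, 0 < e &
  forall q, ball p e q -> forall h, 0 < h -> h < e -> link h e A (cell h p) (cell h q).
Proof.
move=> clA nA; have [e0 e00 He0] := closed_ballN clA nA.
exists (e0 / 4); first by rewrite divr_gt0.
move=> q pq h h0 hl; apply: (@link_in_ball h _ A p (e0 / 2)) => //.
- move=> w pw [a Aa aw]; apply: He0; exists a => //.
  apply: (@le_ball _ _ _ (e0 / 4 + e0 / 2)); first by lra.
  by apply: ball_triangle aw _; exact: ball_sym.
- by apply: le_ball (ball_cell p h0); lra.
- apply: (@le_ball _ _ _ (e0 / 4 + h)); first by lra.
  by apply: ball_triangle pq _; exact: ball_cell.
Qed.

Lemma mesh_link_sym A p q : mesh_link A p q -> mesh_link A q p.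
Proof. by move=> [e e0 H]; exists e => // h h0 he; apply: link_sym; exact: H. Qed.

Lemma mesh_link_trans A p q z : mesh_link A p q -> mesh_link A q z -> mesh_link A p z.
Proof.
move=> [e e0 H] [e' e'0 H']; exists (Num.min e e'); first by rewrite lt_min e0 e'0.
move=> h h0; rewrite lt_min => /andP[h1 h2].
apply: (@link_trans _ _ _ _ (cell h q)).
  by apply: (@link_le _ e); [rewrite ge_min lexx|exact: H].
by apply: (@link_le _ e'); [rewrite ge_min lexx orbT|exact: H'].
Qed.

Definition joined A p q := connected_component (~` A) p q.

Lemma joined_mesh_link A p q : closed A -> joined A p q -> mesh_link A p q.
Proof.
move=> clA pq; have pp : joined A p p.
  exact: connected_component_trans pq (connected_component_sym pq).
apply: (connected_loc_const (component_connected (A := ~` A) (x := p)) _ pp pq); last first.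
  by exists 1 => // h _ _; exact: link_refl.
move=> z /connected_component_sub nz.
have [e e0 He] := mesh_link_local clA nz.
apply/nbhs_ballP; exists e => // w zw _.
have zw' : mesh_link A z w by exists e => // h; exact: He.
split=> H; first exact: mesh_link_trans H zw'.
by apply: mesh_link_trans H _; exact: mesh_link_sym.
Qed.

Lemma joined_mesh_link_compact A p Y : closed A -> compact Y -> (forall q, Y q -> joined A p q) ->
  exists2 e, 0 < e & forall q, Y q ->
    forall h, 0 < h -> h < e -> link h e A (cell h p) (cell h q).
Proof.
move=> clA cY pY; apply: compact_uniform => //.
  move=> e e' x e'0 ee' H h h0 he; apply: link_le (H h h0 _) => //; exact: lt_le_trans he ee'.
move=> q Yq; have [e e0 He] := joined_mesh_link clA (pY q Yq).
have [d d0 Hd] := mesh_link_local clA (connected_component_sub (pY q Yq)).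
exists (Num.min e d); first by rewrite lt_min e0 d0.
move=> z Yz qz h h0; rewrite lt_min => /andP[he hd].
apply: (@link_trans _ _ _ _ (cell h q)).
  by apply: (@link_le _ e); [rewrite ge_min lexx|exact: He].
apply: (@link_le _ d); [by rewrite ge_min lexx orbT|apply: Hd => //].
by apply: le_ball qz; rewrite ge_min lexx orbT.
Qed.

(** * From dual chains back to connectedness of complements *)

Definition seg p q (t : R) : plane := (p.1 + t * (q.1 - p.1), p.2 + t * (q.2 - p.2)).

Lemma seg_continuous p q : continuous (seg p q).
Proof.
move=> t; apply: cvg_pair_point.
  by apply: cvgD; [exact: cvg_cst|apply: cvgMr_tmp; exact: cvg_id].
by apply: cvgD; [exact: cvg_cst|apply: cvgMr_tmp; exact: cvg_id].
Qed.

Lemma joined_seg A p q : (forall t, 0 <= t <= 1 -> ~ A (seg p q t)) -> joined A p q.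
Proof.
move=> nA; exists (seg p q @` `[0, 1]); last first.
  exists 1; first by rewrite /= in_itv /= ler01 lexx.
  by case: p q {nA} => p1 p2 [q1 q2]; congr pair => /=; ring.
split.
- exists 0; first by rewrite /= in_itv /= ler01 lexx.
  by case: p q {nA} => p1 p2 [q1 q2]; congr pair => /=; ring.
- by move=> _ [t /= + <-]; rewrite in_itv; exact: nA.
- apply: connected_continuous_connected; first exact: segment_connected.
  by apply: continuous_subspaceT; exact: seg_continuous.
Qed.

Lemma joined_ball A p q z0 e : ball z0 e p -> ball z0 e q -> (forall z, ball z0 e z -> ~ A z) ->
  joined A p q.
Proof.
move=> /plane_ballE[p1 p2] /plane_ballE[q1 q2] nA; apply: joined_seg => t /andP[t0 t1].
have conv (c a b : R) : `|c - a| < e -> `|c - b| < e -> `|c - (a + t * (b - a))| < e.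
  rewrite !ltr_distl => /andP[? ?] /andP[? ?].
  have ta : 0 <= t * `|b - a| <= `|b - a| by rewrite mulr_ge0 //= ler_piMl.
  by apply/andP; move: ta; case: (leP a b) => ab; [rewrite ger0_norm|rewrite ltr0_norm];
    rewrite ?subr_ge0 ?subr_lt0 // => /andP[? ?]; split; nra.
by apply: nA; apply/plane_ballE; split; apply: conv.
Qed.

(** Let [S] mark the grid points joined to [p]. The two faces bordering an edge of [c] are both in
    [S] or both outside, so restricting [c] to [S] keeps exactly the boundary faces in [S]. If the
    cell of [q] were outside, a finite chain would have a single boundary face. *)
Lemma link_joined h e A p q : 0 < h -> 2 * h < e -> ~ near_set A e p -> ~ near_set A e q ->
  link h e A (cell h p) (cell h q) -> joined A p q.
Proof.
move=> h0 he np nq [c [fc oc cc]].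
have jb z w : ~ near_set A e z -> ball z e w -> joined A z w.
  move=> nz zw; apply: (@joined_ball A z w z e) => //; first by apply: ballxx; lra.
  by move=> t zt At; apply: nz; exists t => //; exact: ball_sym.
have jc z : ~ near_set A e z -> joined A z (node h (cell h z)).
  by move=> nz; apply: jb => //; apply: le_ball (ball_cell z h0); lra.
pose S v := `[< joined A p (node h v) >].
suff Sq : S (cell h q).
  move/asboolP: Sq => Sq; apply: connected_component_trans Sq _.
  by apply: connected_component_sym; exact: jc.
have Sp : S (cell h p) by apply/asboolP; exact: jc.
apply: contrapT => /negP nSq.
have Snxt d v : c (~~ d) (nxt d v) -> S (nxt d v) = S v.
  move=> cv; have nv : ~ near_set A e (node h (nxt d v)) by move=> /(oc (~~ d)); rewrite cv.
  have jv : joined A (node h (nxt d v)) (node h v).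
    apply: jb => //; apply: ball_sym; apply: le_ball (ball_nxt d v h0); exact: ltW.
  apply/asboolP/asboolP => H; first exact: connected_component_trans H jv.
  by apply: connected_component_trans H _; exact: connected_component_sym.
pose c' : cochain := fun d v => c d v && S v.
apply: (@finite_curl_neq_single c' (cell h p)).
  by case: fc => N HN; exists N => d v Hv; rewrite /c' HN.
move=> f; have -> : curl c' f = S f && curl c f.
  rewrite /curl /c'.
  have S1 : c false (nxt true f) -> S (nxt true f) = S f := Snxt true f.
  have S2 : c true (nxt false f) -> S (nxt false f) = S f := Snxt false f.
  case: (c false (nxt true f)) S1 => [/(_ isT) ->|_];
    case: (c true (nxt false f)) S2 => [/(_ isT) ->|_] //;
    by case: (S f); case: (c true f); case: (c false f).
rewrite cc; have [->|_] := eqVneq f (cell h p).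
  by rewrite Sp; case: eqP => // E; move: nSq; rewrite -E Sp.
by have [->|_] := eqVneq f (cell h q); rewrite ?andbF // (negbTE nSq).
Qed.

Lemma near_setU A B e z : near_set (A `|` B) e z <-> near_set A e z \/ near_set B e z.
Proof.
split=> [[a [Aa|Ba] b]|[[a Aa b]|[a Ba b]]]; [by left; exists a|by right; exists a| |].
  by exists a => //; left.
by exists a => //; right.
Qed.

Lemma near_setI A B e : 0 < e -> compact A -> closed B -> exists2 e', 0 < e' &
  forall z, near_set A e' z -> near_set B e' z -> near_set (A `&` B) e z.
Proof.
move=> e0 cA clB; suff [d d0 Hd] : exists2 d, 0 < d &
    forall a, A a -> forall b, B b -> ball a d b -> near_set (A `&` B) (e / 2) a.
  exists (Num.min (d / 2) (e / 2)); first by rewrite lt_min !divr_gt0.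
  move=> z [a Aa az] [b Bb bz].
  have [|x ABx xa] := Hd a Aa b Bb _.
    rewrite [d]splitr; apply: ball_triangle (le_ball _ az) (le_ball _ (ball_sym bz));
      by rewrite ge_min lexx.
  have az' : ball a (e / 2) z by apply: le_ball az; rewrite ge_min lexx orbT.
  by exists x => //; have := ball_triangle xa az'; rewrite -splitr.
apply: compact_uniform => //.
  by move=> d d' a _ dd' H b Bb ab; apply: (H b Bb); exact: le_ball ab.
move=> a Aa; have [Ba|nBa] := pselect (B a).
  exists (e / 2); first by rewrite divr_gt0.
  by move=> a' Aa' aa' b Bb _; exists a => //; exact: (conj Aa Ba).
have [d d0 Hd] := closed_ballN clB nBa.
exists (d / 2); first by rewrite divr_gt0.
move=> a' Aa' aa' b Bb a'b; exfalso; apply: Hd; exists b => //.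
by rewrite [d]splitr; apply: ball_sym; exact: ball_triangle aa' a'b.
Qed.

Lemma compact_plane_bounded B : compact B ->
  exists2 M, 0 < M & forall z, B z -> `|z.1| <= M /\ `|z.2| <= M.
Proof.
move=> cB; have [] := @compact_uniform R _ B (fun e z => `|z.1| <= e^-1 /\ `|z.2| <= e^-1) cB.
- move=> e e' z e'0 ee' [z1 z2]; have H : e^-1 <= e'^-1 by rewrite lef_pV2 // posrE (lt_le_trans e'0).
  by split; exact: le_trans H.
- move=> z _; pose M := `|z.1| + `|z.2| + 1.
  have [n1 n2] : 0 <= `|z.1| /\ 0 <= `|z.2| by rewrite !normr_ge0.
  have M1 : 1 <= M by rewrite /M; lra.
  have M0 : 0 < M by lra.
  exists M^-1; first by rewrite invr_gt0.
  move=> y _ /plane_ballE[]; have Mi : M^-1 <= 1 by rewrite invf_le1.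
  rewrite invrK /M => b1 b2.
  have t1 : `|y.1| <= `|z.1| + `|z.1 - y.1|.
    by rewrite -{1}(subKr z.1 y.1); exact: ler_normB.
  have t2 : `|y.2| <= `|z.2| + `|z.2 - y.2|.
    by rewrite -{1}(subKr z.2 y.2); exact: ler_normB.
  by split; lra.
- by move=> e e0 H; exists e^-1; rewrite ?invr_gt0.
Qed.

Lemma near_set_finite B e h : 0 < h -> compact B -> exists N : nat,
  forall v, (N%:Z < `|v.1|) || (N%:Z < `|v.2|) -> ~ near_set B e (node h v).
Proof.
move=> h0 /compact_plane_bounded[M M0 HM].
exists (Num.bound ((M + `|e|) / h)) => v Hv [b Bb /plane_ballE[b1 b2]].
have [m1 m2] := HM b Bb.
have bnd : (M + `|e|) / h < (Num.bound ((M + `|e|) / h))%:R.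
  by apply: archi_boundP; rewrite divr_ge0 ?addr_ge0 // ltW.
have far (x c : R) (i : int) : `|c| <= M -> `|c - i%:~R * h| < e ->
    (Num.bound ((M + `|e|) / h))%:Z < `|i| -> False.
  move=> cM ce; rewrite -(ltr_int R) intr_norm -pmulrn => lti.
  have := lt_trans bnd lti; rewrite ltr_pdivrMr //.
  have : `|i%:~R * h| = `|i%:~R| * h by rewrite normrM (gtr0_norm h0).
  have := ler_normB c (c - i%:~R * h); rewrite subKr => t.
  by have := ler_norm e; lra.
by case/orP: Hv; [exact: (far _ b.1)|exact: (far _ b.2)].
Qed.

(* Janiszewski. The two connecting cochains differ by the gradient of some [phi], which is
   constant near [A `&` B]; correcting the first one by the gradient of [phi] cut off near [B]
   makes it avoid both sets. *)
Lemma joinedU A B p q : compact A -> compact B -> closed A -> closed B ->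
  connected (A `&` B) -> joined A p q -> joined B p q -> joined (A `|` B) p q.
Proof.
move=> cA cB clA clB cAB jA jB.
have clU : closed (A `|` B) by exact: closedU.
have nU z : joined A p z -> joined B p z -> ~ (A `|` B) z.
  by move=> /connected_component_sub nA /connected_component_sub nB [].
have pp C : joined C p q -> joined C p p.
  by move=> j; exact: connected_component_trans j (connected_component_sym j).
have [e1 e10 H1] := joined_mesh_link clA jA.
have [e2 e20 H2] := joined_mesh_link clB jB.
have [e3 e30 H3] := closed_ballN clU (nU p (pp _ jA) (pp _ jB)).
have [e4 e40 H4] := closed_ballN clU (nU q jA jB).
pose e := Num.min e1 e2; have e0 : 0 < e by rewrite lt_min e10 e20.
have [d d0 Hd] := near_setI (divr_gt0 e0 (ltr0n R 2)) cA clB.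
pose m := Num.min (Num.min (d / 2) (e / 2)) (Num.min e3 e4).
have m0 : 0 < m by rewrite !lt_min !divr_gt0 // e30 e40.
have [md me m3 m4] : [/\ m <= d / 2, m <= e / 2, m <= e3 & m <= e4].
  by rewrite !ge_min !lexx !orbT.
have [ee1 ee2] : e <= e1 /\ e <= e2 by rewrite !ge_min !lexx !orbT.
pose h := m / 8; have h0 : 0 < h by rewrite divr_gt0.
have hm : 8 * h = m by rewrite /h; field.
have [a [fa oa ca]] := H1 h h0 ltac:(lra).
have [b [fb ob cb]] := H2 h h0 ltac:(lra).
have [phi Hphi] : exists phi, forall d v, addc a b d v = grad phi d v.
  by apply: closed_cochain_exact => f; rewrite curl_addc ca cb addbb.
have [k Hk] : exists k, forall v, near_set (A `&` B) (e / 2) (node h v) -> phi v = k.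
  have [E|/set0P[x ABx]] := eqVneq (A `&` B) set0.
    by exists false => v [t]; rewrite E.
  exists (phi (cell h x)) => v [y ABy yv].
  have g0 d' v' : near_set (A `&` B) e (node h v') -> grad phi d' v' = false.
    move=> nw; rewrite -Hphi /addc oa ?ob //.
      by apply: near_set_le nw => // t [].
    by apply: near_set_le nw => // t [].
  rewrite (grad0_const h0 _ cAB g0 ABx ABy); last by lra.
  apply: (@ball_walk h y (e / 2 + h) (fun u v => phi u = phi v)) => //.
  - by move=> u w t -> ->.
  - move=> d' w bw _; have /(g0 d') : near_set (A `&` B) e (node h w).
      by exists y => //; apply: le_ball bw; lra.
    by rewrite /grad; case: (phi w); case: (phi _).
  - by apply: le_ball yv; lra.
  - by apply: le_ball (ball_cell y h0); lra.
(* Subtracting the constant [k] makes [psi] vanish near the intersection, hence near all of [A].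
   Near [B] its gradient is that of [phi], which equals [a] there because [b] vanishes near [B]. *)
pose psi v := if `[< near_set B d (node h v) >] then phi v (+) k else false.
apply: (@link_joined h m) => //; first by lra.
- by move: H3; apply: contra_not; apply: near_set_le.
- by move: H4; apply: contra_not; apply: near_set_le.
exists (addc a (grad psi)); split.
- apply: finite_addc => //.
    apply: finite_grad; have [N HN] := near_set_finite d h0 cB.
  by exists N => v /HN nB; rewrite /psi; case: asboolP.
- move=> d' v; rewrite /addc /grad.
  have nn C (u : vertex) : near_set C m (node h u) -> near_set C d (node h u) /\ near_set C d (node h (nxt d' u)).
    move=> [t Ct tw]; split; exists t => //; first by apply: le_ball tw; lra.
    apply: (@le_ball _ _ _ (m + 2 * h)); first by lra.
    by apply: ball_triangle tw _; exact: ball_nxt.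
  have psi0 (u : vertex) : near_set A d (node h u) -> psi u = false.
    rewrite /psi => nA; case: asboolP => // nB; rewrite (Hk u) ?addbb //; exact: Hd.
  move=> /near_setU[nA|nB].
    have [n1 n2] := nn _ _ nA; rewrite !psi0 // oa //.
    by apply: near_set_le nA => //; lra.
  have [n1 n2] := nn _ _ nB; rewrite /psi; do 2!(case: asboolP => // _).
  have -> : a d' v = grad phi d' v.
    rewrite -Hphi /addc ob ?addbF //.
    by apply: near_set_le nB => //; lra.
  by rewrite /grad; case: (phi v); case: (phi _); case: (k).
- by move=> f; rewrite curl_addc curl_grad addbF ca.
Qed.

(** * Two continua with exactly two common points separate the plane *)

Lemma open_near_set A e : 0 < e -> open (near_set A e).
Proof.
move=> e0; rewrite (_ : near_set A e = \bigcup_(a in A) ball a e).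
  by apply: bigcup_open => a _; exact: ball_open.
by apply/seteqP; split=> z [a Aa b]; exists a.
Qed.

(** Each face of [l] is linked to the base face [f0]; the flag [m] is the parity of the number of
    links, so it tells whether [f0] is left over as a boundary face. *)
Lemma link_list h e A f0 (l : seq vertex) : (forall f, f \in l -> link h e A f0 f) ->
  exists c m, [/\ finite_cochain c,
    forall d v, near_set A e (node h v) -> c d v = false &
    forall f, curl c f = odd (count_mem f l) (+) (m && (f == f0))].
Proof.
elim: l => [|f l IH] Hl.
  by exists (fun _ _ => false), false; split => //; exists 0%N.
have [c [m [fc oc cc]]] : exists c m, [/\ finite_cochain c,
    forall d v, near_set A e (node h v) -> c d v = false &
    forall f, curl c f = odd (count_mem f l) (+) (m && (f == f0))].
  by apply: IH => g gl; apply: Hl; rewrite inE gl orbT.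
have [c' [fc' oc' cc']] := Hl f (mem_head _ _).
exists (addc c c'), (~~ m); split.
- exact: finite_addc.
- by move=> d v H; rewrite /addc oc // oc'.
- move=> g; rewrite curl_addc cc cc' /= oddD (eq_sym g f).
  by case: (f == g); case: (odd _); case: (g == f0); case: (m).
Qed.

Lemma compact_complement_nonempty A : compact A -> exists p, ~ A p.
Proof.
move=> /compact_plane_bounded[M M0 HM]; exists (M + 1, 0) => /HM[/= + _].
by rewrite ger0_norm; lra.
Qed.

Lemma cochain_support_list (c : cochain) : finite_cochain c ->
  exists l : seq vertex, uniq l /\ forall f, (f \in l) = curl c f.
Proof.
(* The box is one larger than the support because [curl] at a face also reads the edges one step
   further. *)
move=> [N HN]; pose s := [seq (k%:Z - N.+1%:Z) | k <- iota 0 (2 * N + 3)].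
exists (undup [seq f <- [seq (i, j) | i <- s, j <- s] | curl c f]); split; first exact: undup_uniq.
move=> [i j]; rewrite mem_undup mem_filter; case cf: (curl c (i, j)) => //=.
have ins (k : int) : `|k| <= N.+1%:Z -> k \in s.
  by move=> kN; apply/mapP; exists (absz (k + N.+1%:Z)); [rewrite mem_iota; lia|lia].
apply/allpairsP; exists (i, j); split => //=; apply: ins; rewrite leNgt; apply/negP => H;
  move: cf; rewrite /curl !HN //= ?H ?orbT //; lia.
Qed.

(* Mayer-Vietoris: the gradient of the indicator [g] of a neighbourhood of [a], kept near [A]
   only, is a cocycle near [A `|` B]. If the complement were connected, its finitely many bad
   faces could be joined in pairs, giving a global cocycle whose potential has different
   variations from [a] to [b] along [A] and along [B]. *)
Lemma connected_union_separates A B a b : compact A -> compact B -> closed A -> closed B ->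
  connected A -> connected B -> A a -> A b -> B a -> B b -> a != b ->
  A `&` B `<=` [set a; b] ->
  exists p q, [/\ ~ (A `|` B) p, ~ (A `|` B) q & ~ joined (A `|` B) p q].
Proof.
move=> kA kB clA clB cA cB Aa Ab Ba Bb ab AB; apply: contrapT => nsep.
set X := A `|` B in nsep *.
have clX : closed X by exact: closedU.
have kX : compact X by exact: compactU.
have joinX p q : ~ X p -> ~ X q -> joined X p q.
  by move=> nX nY; apply: contrapT => nj; apply: nsep; exists p, q.
have [p0 Xp0] := compact_complement_nonempty kX.
have [rho0 rho00 Hrho0] : exists2 r, 0 < r & ~ ball a r b.
  have [e e0 He] := @closed_ballN [set a] b (compact_closed (@norm_hausdorff _ _) (compact_set1 (x := a))) (fun E => (negP ab) (introT eqP (esym E))).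
  by exists e => // abe; apply: He; exists a.
pose rho := rho0 / 8; have rhoE : 8 * rho = rho0 by rewrite /rho; field.
have rho_gt0 : 0 < rho by rewrite divr_gt0.
have far z : ball a (3 * rho) z -> ball b (3 * rho) z -> False.
  move=> az bz; apply: Hrho0; apply: le_ball (ball_triangle az (ball_sym bz)); lra.
have [e1 e10 He1] := near_setI rho_gt0 kA clB.
have {}He1 z : near_set A e1 z -> near_set B e1 z -> ball a rho z \/ ball b rho z.
  by move=> nA nB; have [t /AB[]->] := He1 z nA nB; [left|right].
have [M M0 HM] := compact_plane_bounded kA.
pose M' := M + 2 * e1.
(* All bad faces will lie in this compact set, whatever the mesh. This makes it possible to find the
   threshold [e2] for linking them before [h] is fixed. *)
pose Y := (`[- M', M'] `*` `[- M', M']) `&` ~` near_set X (e1 / 2).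
have kY : compact Y.
  apply: (@subclosed_compact _ _ (`[- M', M'] `*` `[- M', M'])); last by move=> ? [].
    apply: closedI; last by apply: open_closedC; apply: open_near_set; rewrite divr_gt0.
    apply: compact_closed; first exact: norm_hausdorff.
    by apply: compact_setX; exact: segment_compact.
  by apply: compact_setX; exact: segment_compact.
have [e2 e20 He2] : exists2 e, 0 < e & forall q, Y q ->
    forall h, 0 < h -> h < e -> link h e X (cell h p0) (cell h q).
  apply: joined_mesh_link_compact => // q [_ nq]; apply: joinX => // Xq; apply: nq.
  by exists q => //; apply: ballxx; rewrite divr_gt0.
pose e := Num.min (Num.min e1 e2) rho.
have e0 : 0 < e by rewrite !lt_min e10 e20.
have [ee1 ee2 erho] : [/\ e <= e1, e <= e2 & e <= rho] by rewrite !ge_min !lexx !orbT.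
pose h := e / 8; have h0 : 0 < h by rewrite divr_gt0.
have hE : 8 * h = e by rewrite /h; field.
(* Points near both sets are within [rho] of [a] or of [b], where [g] is constantly true or
   constantly false. So cutting its gradient off to a neighbourhood of [A] leaves nothing near
   [B]. *)
pose g v := `[< ball a (3 * rho) (node h v) >].
pose c : cochain := fun d v => grad g d v && `[< near_set A e1 (node h v) >].
have cA' d v : near_set A e1 (node h v) -> c d v = grad g d v.
  by move=> nA; rewrite /c; case: asboolP; rewrite ?andbT.
have cB' d v : near_set B e1 (node h v) -> c d v = false.
  rewrite /c => nB; case: asboolP => [nA|_]; last by rewrite andbF.
  rewrite andbT /grad /g; have bn := ball_nxt d v h0; case: (He1 _ nA nB) => bv.
    rewrite !asboolT //; first by apply: le_ball (ball_triangle bv bn); lra.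
    by apply: le_ball bv; lra.
  rewrite !asboolF // => /far; apply.
    by apply: le_ball (ball_triangle bv bn); lra.
  by apply: le_ball bv; lra.
have finc : finite_cochain c.
  have [N HN] : finite_cochain (grad g).
    apply: finite_grad; have [N HN] := near_set_finite (3 * rho) h0 (compact_set1 (x := a)).
    by exists N => v /HN nv; apply/asboolP => b'; apply: nv; exists a.
  by exists N => d v Hv; rewrite /c HN.
have near_nxt (C : set plane) d v r : near_set C r (node h v) -> near_set C (r + 2 * h) (node h (nxt d v)).
  by move=> [t Ct tv]; exists t => //; exact: ball_triangle tv (ball_nxt d v h0).
have near_half (C : set plane) d v : near_set C (e1 / 2) (node h v) -> near_set C e1 (node h (nxt d v)).
  by move=> /(near_nxt C d) H; apply: near_set_le H => //; lra.
have half1 (C : set plane) v : near_set C (e1 / 2) (node h v) -> near_set C e1 (node h v).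
  by apply: near_set_le => //; lra.
have bad f : curl c f -> Y (node h f).
  move=> cf; split; last first.
    move=> /near_setU[nA|nB]; move: cf; rewrite /curl.
      rewrite !cA' -/(curl (grad g) f) ?curl_grad //; [exact: near_half|exact: half1|exact: near_half|exact: half1].
    by rewrite !cB' //; [exact: near_half|exact: half1|exact: near_half|exact: half1].
  have [t At tf] : near_set A (2 * e1) (node h f).
    have nA d v : c d v -> near_set A e1 (node h v).
      by rewrite /c => /andP[_ /asboolP].
    have back d v : near_set A e1 (node h (nxt d v)) -> near_set A (2 * e1) (node h v).
      move=> [t At tv]; exists t => //; have := ball_triangle tv (ball_sym (ball_nxt d v h0)).
      by apply: le_ball; lra.
    have self v : near_set A e1 (node h v) -> near_set A (2 * e1) (node h v).
      by apply: near_set_le => //; lra.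
    move: cf; rewrite /curl; case c1: (c true f); first by move=> _; apply: self; exact: nA c1.
    case c2: (c true _); first by move=> _; apply: (back false); exact: nA c2.
    case c3: (c false f); first by move=> _; apply: self; exact: nA c3.
    by case c4: (c false _) => // _; apply: (back true); exact: nA c4.
  have [t1 t2] := HM t At; move: (node h f) tf t1 t2 => u /plane_ballE.
  rewrite !ler_norml !ltr_distl => -[/andP[? ?] /andP[? ?]] /andP[? ?] /andP[? ?].
  by split; rewrite /= in_itv /= /M'; apply/andP; split; lra.
have [l [ul Hl]] := cochain_support_list finc.
have Hlink f : f \in l -> link h e2 X (cell h p0) f.
  rewrite Hl => /bad Yf; have := He2 _ Yf h h0; rewrite cell_node //; apply; lra.
have [c' [m [fc' oc' cc']]] := link_list Hlink.
have curlE f : curl (addc c c') f = m && (f == cell h p0).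
  by rewrite curl_addc cc' count_uniq_mem // Hl oddb addbA addbb.
have m0 : m = false.
  apply/negP => mt; apply: (@finite_curl_neq_single (addc c c') (cell h p0)).
    exact: finite_addc.
  by move=> f; rewrite curlE mt.
have [phi Hphi] : exists phi, forall d v, addc c c' d v = grad phi d v.
  by apply: closed_cochain_exact => f; rewrite curlE m0.
have Bconst : phi (cell h a) = phi (cell h b).
  apply: (@grad0_const h e B) => //; first by lra.
  move=> d v nB; rewrite -Hphi /addc cB' ?oc' //.
    by apply: near_set_le nB => // z; right.
  exact: near_set_le nB.
have Aconst : phi (cell h a) (+) g (cell h a) = phi (cell h b) (+) g (cell h b).
  apply: (@grad0_const h e A (fun v => phi v (+) g v)) => //; first by lra.
  move=> d v nA; have : addc c c' d v = grad g d v.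
    rewrite /addc cA' ?oc' ?addbF //.
      by apply: near_set_le nA => // z; left.
    exact: near_set_le nA.
  rewrite Hphi /grad; case: (phi v); case: (phi _); by case: (g v); case: (g _).
have ga : g (cell h a).
  by apply/asboolP; apply: le_ball (ball_cell a h0); lra.
have gb : g (cell h b) = false.
  apply/asboolP => /far; apply; apply: le_ball (ball_cell b h0); lra.
by move: Aconst; rewrite Bconst ga gb; case: (phi _).
Qed.
End Plane.

(** * Jordan curves in the plane *)

Section Loops.
Variable R : realType.
Local Notation plane := (R * R)%type.
Implicit Types (A B X Y : set plane) (p q z : plane) (h e r s t : R) (gamma : R -> plane).

Lemma closed_compact_plane A : compact A -> closed A.
Proof. by apply: compact_closed; exact: norm_hausdorff. Qed.

Lemma joined_refl A p : ~ A p -> joined A p p.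
Proof. exact: connected_component_refl. Qed.

Lemma joined_sym A p q : joined A p q -> joined A q p.
Proof. exact: connected_component_sym. Qed.

Lemma joined_trans A p q z : joined A p q -> joined A q z -> joined A p z.
Proof. exact: connected_component_trans. Qed.

Lemma joined_notin A p q : joined A p q -> ~ A q.
Proof. exact: connected_component_sub. Qed.

Lemma joined_sub A B p q : A `<=` B -> joined B p q -> joined A p q.
Proof.
move=> AB [C [Cp CB cC] Cq]; exists C => //; split => // z /CB nB Az; apply: nB; exact: AB.
Qed.

Lemma joined_connected A X p q : connected X -> X `&` A = set0 -> X p -> X q -> joined A p q.
Proof. by move=> cX XA Xp Xq; exists X => //; split => //; exact/disjoints_subset. Qed.

Lemma joined_near A p : closed A -> ~ A p -> exists2 e, 0 < e & forall q, ball p e q -> joined A p q.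
Proof.
move=> clA nA; have [e e0 He] := closed_ballN clA nA; exists e => // q pq.
apply: (@joined_ball _ A p q p e) => //; first exact: ballxx.
by move=> z pz Az; apply: He; exists z => //; exact: ball_sym.
Qed.

Lemma convex_gt0 (u v t : R) : 0 < u -> 0 < v -> 0 <= t -> t <= 1 -> 0 < u + t * (v - u).
Proof. by move=> u0 v0 t0 t1; case: (leP u v) => uv; nra. Qed.

Lemma joined_point z p q : p <> z -> q <> z -> joined [set z] p q.
Proof.
case: z p q => a b; pose c : plane := (a + 1, b).
have H p : p <> (a, b) -> joined [set (a, b)] p c.
  case: p => x y npz.
  have seg_ne (p q : plane) : (p.1 < a /\ q.1 < a) \/ (a < p.1 /\ a < q.1) \/
      (p.2 < b /\ q.2 < b) \/ (b < p.2 /\ b < q.2) -> joined [set (a, b)] p q.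
    move=> sd; apply: joined_seg => t /andP[t0 t1] [E1 E2].
    clear npz c; move: p.1 p.2 q.1 q.2 sd E1 E2 => p1 p2 q1 q2 sd E1 E2.
    move: sd => [[u1 u2]|[[u1 u2]|[[u1 u2]|[u1 u2]]]]; rewrite -subr_gt0 in u1; rewrite -subr_gt0 in u2;
      by have := convex_gt0 u1 u2 t0 t1; lra.
  have tr p' q' z' : joined [set (a, b)] p' q' -> joined [set (a, b)] q' z' -> joined [set (a, b)] p' z'.
    exact: joined_trans.
  have right_ (y' : R) : joined [set (a, b)] (a + 1, y') c by apply: seg_ne => /=; right; left; lra.
  have [ax|xa|xa] := ltgtP a x.
  - by apply: seg_ne => /=; right; left; lra.
  - apply: (tr _ (a - 1, b + 1)); first by apply: seg_ne => /=; left; lra.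
    apply: (tr _ (a + 1, b + 1)); last exact: right_.
    by apply: seg_ne => /=; right; right; right; lra.
  - have [yb|yb|yb] := ltgtP y b.
    + apply: (tr _ (a + 1, b - 1)); last exact: right_.
      by apply: seg_ne => /=; right; right; left; lra.
    + apply: (tr _ (a + 1, b + 1)); last exact: right_.
      by apply: seg_ne => /=; right; right; right; lra.
    + by exfalso; apply: npz; rewrite xa yb.
by move=> p q /H Hp /H Hq; exact: joined_trans Hp (joined_sym Hq).
Qed.

(** A chain linking [p] and [q] off the point [z] keeps a positive clearance, hence also avoids
    every set close enough to [z]; [link_joined] turns it back into connectedness at one mesh. *)
Lemma joined_small z p q : p <> z -> q <> z ->
  exists2 e, 0 < e & forall X, X `<=` ball z e -> joined X p q.
Proof.
move=> pz qz; have cl1 : closed [set z] by apply: closed_compact_plane; exact: compact_set1.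
have [e1 e10 H1] := joined_mesh_link cl1 (joined_point pz qz).
have [e2 e20 H2] := closed_ballN cl1 pz.
have [e3 e30 H3] := closed_ballN cl1 qz.
pose m := Num.min e1 (Num.min e2 e3); have m0 : 0 < m by rewrite !lt_min e10 e20.
have [m1 m2 m3] : [/\ m <= e1, m <= e2 & m <= e3] by rewrite !ge_min !lexx !orbT.
exists (m / 2); first by rewrite divr_gt0.
move=> X Xz; have nX e w : m <= e -> near_set X (m / 2) w -> near_set [set z] e w.
  move=> me [t /Xz zt tw]; exists z => //; apply: (le_ball me).
  by rewrite [m]splitr; exact: ball_triangle zt tw.
pose h := m / 8; have h0 : 0 < h by rewrite divr_gt0.
have hE : 8 * h = m by rewrite /h; field.
apply: (@link_joined _ h (m / 2)) => //; first by lra.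
- by move=> /(nX _ _ m2).
- by move=> /(nX _ _ m3).
- have [c [fc oc cc]] := H1 h h0 ltac:(lra).
  by exists c; split => // d v /(nX _ _ m1); exact: oc.
Qed.

(** * Arcs do not separate, loops do *)

Definition path_arc (T : Type) (gamma : R -> T) s t := gamma @` `[s, t].

Lemma arc_compact gamma s t : continuous gamma -> compact (path_arc gamma s t).
Proof.
move=> cg; apply: continuous_compact; last exact: segment_compact.
exact: continuous_subspaceT.
Qed.

Lemma arc_closed gamma s t : continuous gamma -> closed (path_arc gamma s t).
Proof. by move=> cg; apply: closed_compact_plane; exact: arc_compact. Qed.

Lemma arc_connected gamma s t : continuous gamma -> connected (path_arc gamma s t).
Proof.
move=> cg; apply: connected_continuous_connected; first exact: segment_connected.
exact: continuous_subspaceT.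
Qed.

Lemma arcP (T : Type) (gamma : R -> T) s t (z : T) : path_arc gamma s t z <-> exists2 u, s <= u <= t & z = gamma u.
Proof.
split=> [[u /=]|[u su ->]]; first by rewrite in_itv /= => su <-; exists u.
by exists u => //=; rewrite in_itv.
Qed.

Lemma arc_mem (T : Type) (gamma : R -> T) s t u : s <= u <= t -> path_arc gamma s t (gamma u).
Proof. by move=> su; apply/arcP; exists u. Qed.

Lemma arc_sub (T : Type) (gamma : R -> T) s t s' t' : s' <= s -> t <= t' -> path_arc gamma s t `<=` path_arc gamma s' t'.
Proof. by move=> ss tt z /arcP[u su ->]; apply: arc_mem; lra. Qed.

Lemma continuous_plane_ball gamma t e : continuous gamma -> 0 < e ->
  exists2 d, 0 < d & forall u, `|t - u| < d -> ball (gamma t) e (gamma u).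
Proof.
move=> cg e0; have /nbhs_ballP[d /= d0 Hd] := cg t _ (nbhsx_ballx (gamma t) e e0).
by exists d => // u tu; exact: Hd.
Qed.

(** Induction along the arc: that the part up to [u] does not separate [p] from [q] is locally
    constant in [u]. A short extension does not separate by [joined_small] and meets the earlier
    part in one point, so Janiszewski applies. *)
Lemma arc_joined gamma s t p q : continuous gamma -> s <= t ->
  (forall u v, s <= u <= t -> s <= v <= t -> gamma u = gamma v -> u = v) ->
  ~ path_arc gamma s t p -> ~ path_arc gamma s t q -> joined (path_arc gamma s t) p q.
Proof.
move=> cg st inj np nq.
apply: (@connected_loc_const _ `[s, t]%classic (fun u => joined (path_arc gamma s u) p q) _ _ s t) => //=.
- exact: segment_connected.
- move=> u /=; rewrite in_itv /= => /andP[su ut].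
  have ne z : ~ path_arc gamma s t z -> z <> gamma u.
    by move=> na E; apply: na; apply/arcP; exists u => //; rewrite su.
  have [e e0 He] := joined_small (ne _ np) (ne _ nq).
  have [d d0 Hd] := continuous_plane_ball u cg e0.
  have step lo hi : s <= lo -> lo <= hi -> hi <= t ->
      (forall v, lo <= v <= hi -> `|u - v| < d) ->
      joined (path_arc gamma s lo) p q <-> joined (path_arc gamma s hi) p q.
    move=> slo lohi hit near_; split; last by apply: joined_sub; exact: arc_sub.
    move=> jlo.
    have jd : joined (path_arc gamma lo hi) p q.
      by apply: He => z /arcP[v lv ->]; apply: Hd; exact: near_.
    have jU : joined (path_arc gamma s lo `|` path_arc gamma lo hi) p q.
      apply: joinedU => //; try exact: arc_compact; try exact: arc_closed.
      rewrite (_ : _ `&` _ = [set gamma lo]); first exact: connected1.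
      apply/seteqP; split=> [z [/arcP[v v1 ->] /arcP[w w1 E]]|z ->].
        have vw : v = w by apply: inj => //; lra.
        by rewrite (_ : v = lo) //; lra.
      by split; apply: arc_mem; lra.
    apply: joined_sub jU => z /arcP[v /andP[sv vh] ->].
    by have [vl|lv] := leP v lo; [left|right]; apply/arcP; exists v; rewrite // ?sv ?vl // ltW.
  apply/nbhs_ballP; exists d => //= v; rewrite /ball /= => uv; rewrite in_itv /= => /andP[sv vt].
  have [uv'|vu] := leP u v; first by apply: step => // w /andP[? ?]; move: uv; rewrite !ltr_distl; lra.
  by symmetry; apply: step => //; [exact: ltW|move=> w /andP[? ?]; move: uv; rewrite !ltr_distl; lra].
- by rewrite in_itv /= lexx.
- by rewrite in_itv /= lexx st.
- rewrite (_ : path_arc gamma s s = [set gamma s]).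
    by apply: joined_point => E; [apply: np|apply: nq]; rewrite E; apply/arcP; exists s; rewrite ?lexx.
  apply/seteqP; split=> [z /arcP[v v1 ->]|z ->]; last by apply/arcP; exists s; rewrite ?lexx.
  by rewrite (_ : v = s) //; lra.
Qed.

(** A Jordan curve as a map on the line with period 1, so that arcs may start at any parameter and
    cross the base point without a case distinction. *)
Definition loop (T : topologicalType) (gamma : R -> T) :=
  [/\ continuous gamma, forall t, gamma (t + 1) = gamma t &
  forall s t, `|s - t| < 1 -> gamma s = gamma t -> s = t].

Lemma loop_int (T : topologicalType) (gamma : R -> T) t (n : int) : loop gamma -> gamma (t + n%:~R) = gamma t.
Proof.
move=> [_ per _]; have nat_per (m : nat) u : gamma (u + m%:R) = gamma u.
  by elim: m => [|m IH]; rewrite ?addr0 // -natr1 addrA per.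
case: n => m; first exact: nat_per.
by rewrite -[LHS](nat_per m.+1) NegzE rmorphN /= subrK.
Qed.

Lemma loop_range (T : topologicalType) (gamma : R -> T) c : loop gamma -> range gamma = path_arc gamma c (c + 1).
Proof.
move=> lg; apply/seteqP; split=> [_ [t _ <-]|z /arcP[u _ ->]]; last by exists u.
apply/arcP; exists (t - (Num.floor (t - c))%:~R); last first.
  by rewrite -(loop_int (t - (Num.floor (t - c))%:~R) (Num.floor (t - c)) lg) subrK.
by have := floor_itv (t - c); rewrite intrD => /andP[? ?]; lra.
Qed.

Lemma arc_range (T : Type) (gamma : R -> T) s t : path_arc gamma s t `<=` range gamma.
Proof. by move=> z /arcP[u _ ->]; exists u. Qed.

Lemma loop_continuous (T : topologicalType) (gamma : R -> T) : loop gamma -> continuous gamma. Proof. by case. Qed.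
Lemma loop_inj (T : topologicalType) (gamma : R -> T) s t : loop gamma -> `|s - t| < 1 -> gamma s = gamma t -> s = t.
Proof. by move=> [_ _]; exact. Qed.

Lemma loop_compact gamma : loop gamma -> compact (range gamma).
Proof. by move=> lg; rewrite (loop_range 0 lg); apply: arc_compact; exact: loop_continuous. Qed.

Lemma loop_separates gamma : loop gamma ->
  exists p q, [/\ ~ range gamma p, ~ range gamma q & ~ joined (range gamma) p q].
Proof.
move=> lg; have cg := loop_continuous lg.
have -> : range gamma = path_arc gamma 0 (1 / 2) `|` path_arc gamma (1 / 2) 1.
  rewrite (loop_range 0 lg) add0r; apply/seteqP; split=> [z /arcP[u /andP[u0 u1] ->]|z].
    by have [ul|lu] := leP u (1 / 2); [left|right]; apply/arcP; exists u; rewrite // ?u0 ?ul // ltW.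
  by case; apply: arc_sub; lra.
apply: (@connected_union_separates _ _ _ (gamma 0) (gamma (1 / 2)));
  try exact: arc_compact; try exact: arc_closed; try exact: arc_connected.
- by apply: arc_mem; lra.
- by apply: arc_mem; lra.
- by case: lg => _ per _; rewrite -per add0r; apply: arc_mem; lra.
- by apply: arc_mem; lra.
- by apply/eqP => /(loop_inj lg); rewrite sub0r normrN gtr0_norm; lra.
- move=> z [/arcP[u /andP[u0 u1] ->] /arcP[v /andP[v0 v1] E]].
  have [uv|uv] := ltP `|u - v| 1.
    by right; have := loop_inj lg uv E => uv'; rewrite (_ : u = 1 / 2) //; lra.
  by left; move: uv; rewrite ler_normr => ?; rewrite (_ : u = 0) //; lra.
Qed.

(** If the side of [q0] stayed away from [gamma t], deleting a short arc around [gamma t] would not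
    enlarge it. But the remaining arc [A] does not separate [q0] from [p0]. *)
Lemma loop_boundary gamma p0 q0 w : loop gamma -> ~ range gamma p0 -> ~ range gamma q0 ->
  ~ joined (range gamma) p0 q0 -> range gamma w -> closure [set z | joined (range gamma) q0 z] w.
Proof.
move=> lg np nq nj [t _ <-]; apply: contrapT => ncl.
have cg := loop_continuous lg.
have [e e0 He] : exists2 e, 0 < e & forall z, ball (gamma t) e z -> ~ joined (range gamma) q0 z.
  apply: contrapT => H; apply: ncl => B /nbhs_ballP[e /= e0 HB].
  apply: contrapT => nB; apply: H; exists e => // z /HB Bz jz; apply: nB.
  by exists z.
have [d d0 Hd] := continuous_plane_ball t cg e0.
pose n := Num.min (d / 2) (1 / 4).
have n0 : 0 < n by rewrite lt_min !divr_gt0.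
have [nd n4] : n <= d / 2 /\ n <= 1 / 4 by rewrite !ge_min !lexx orbT.
pose A := path_arc gamma (t + n) (t + 1 - n).
have AJ : A `<=` range gamma by exact: arc_range.
have JA z : range gamma z -> A z \/ ball (gamma t) e z.
  rewrite (loop_range (t - n) lg) => /arcP[u /andP[u1 u2] ->].
  have [ul|lu] := ltP u (t + n); last by left; apply: arc_mem; lra.
  by right; apply: Hd; rewrite ltr_distl; lra.
have jA : joined A q0 p0.
  apply: arc_joined => //; [lra| |by move=> /AJ|by move=> /AJ].
  by move=> u v u1 v1; apply: (loop_inj lg); rewrite ltr_distl; lra.
have clA : closed A by exact: arc_closed.
have clJ : closed (range gamma) by apply: closed_compact_plane; exact: loop_compact.
apply: nj; apply: joined_sym.
apply: (connected_loc_const (component_connected (A := ~` A) (x := q0)) _ _ jA (joined_refl nq)).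
- move=> z /connected_component_sub nAz; have [Jz|nJz] := pselect (range gamma z).
    have [//|bz] := JA z Jz.
    have : open (ball (gamma t) e) by exact: ball_open.
    rewrite openE => /(_ z bz); apply: filterS => y /He ny _.
    by split=> [/(He z bz)|/ny].
  have [r r0 Hr] := joined_near clJ nJz.
  apply/nbhs_ballP; exists r => // y /Hr zy _; split=> H; first exact: joined_trans H zy.
  exact: joined_trans H (joined_sym zy).
- exact: joined_trans jA (joined_sym jA).
Qed.

(* [W1] and [W3], linked by [L], and the two arcs between [gamma t1] and [gamma t3] form the
   closed sets [Z] and [Zc] below. Both sides of the loop meet near [gamma t2] and near
   [gamma 0]. Following [W2] on the side of [U], then [D], then the other side [V] back to
   [gamma t2], one avoids [Z]; near [gamma t2] one crosses directly without meeting [Zc]. By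
   Janiszewski the two sides of the loop would be joined off the loop. *)
Lemma loop_no_middle_continuum gamma U W1 W2 W3 L D t1 t2 t3 :
  loop gamma -> connected U -> U `&` range gamma = set0 ->
  W1 `<=` closure U -> W2 `<=` closure U -> W3 `<=` closure U ->
  compact W1 -> compact W3 -> compact L -> connected W1 -> connected W2 -> connected W3 ->
  connected L -> L `&` range gamma = set0 -> W1 `&` L !=set0 -> W3 `&` L !=set0 ->
  W2 `&` (W1 `|` L `|` W3) = set0 ->
  connected D -> open D -> D (gamma 0) -> D `&` (W1 `|` L `|` W3) = set0 -> W2 `&` D !=set0 ->
  t1 < t2 -> t2 < t3 -> t3 < t1 + 1 -> W1 (gamma t1) -> W2 (gamma t2) -> W3 (gamma t3) ->
  D `&` path_arc gamma t1 t3 = set0 -> False.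
Proof.
move=> lg cU UJ W1U W2U W3U kW1 kW3 kL cW1 cW2 cW3 cL LJ [x1 [W1o Lo]] [x3 [W3o Lo3]] W2psi.
move=> cD oD D0 Dpsi [qD [W2D DqD]] t12 t23 t31 W1t W2t W3t DA.
set psi := W1 `|` L `|` W3 in W2psi Dpsi; set J := range gamma in UJ LJ *.
have cg := loop_continuous lg.
have kpsi : compact psi by apply: compactU => //; exact: compactU.
have clpsi := closed_compact_plane kpsi.
have cpsi : connected psi.
  apply: connectedU => //; first by exists x3; split => //; right.
  by apply: connectedU => //; exists x1.
have kJ : compact J by exact: loop_compact.
have clJ := closed_compact_plane kJ.
have sub0 (S S' : set plane) z : S `&` S' = set0 -> S z -> S' z -> False.
  by move=> E Sz S'z; have : (S `&` S') z by []; rewrite E.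
have jUJ u u' : U u -> U u' -> joined J u u' by exact: joined_connected.
have clJpsi : closed (J `|` psi) by exact: closedU.
(* The delicate case is [q] on the loop. With [A] the loop minus a short arc around [q], the two
   points are joined off [J] through [U], and off [psi] and [A] inside a small ball. These two
   obstacles meet exactly in [A], because [psi] avoids the short arc. *)
have locU q : W2 q -> exists2 r, 0 < r & forall u u', U u -> U u' -> ball q r u -> ball q r u' ->
    joined (J `|` psi) u u'.
  move=> W2q; have nq : ~ psi q by exact: sub0 W2psi W2q.
  have [e1 e10 He1] := closed_ballN clpsi nq.
  have {}He1 z : ball q e1 z -> ~ psi z by move=> qz pz; apply: He1; exists z => //; exact: ball_sym.
  have [[t _ tq]|nJq] := pselect (J q); last first.
    have [e2 e20 He2] := closed_ballN clJ nJq.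
    exists (Num.min e1 e2); first by rewrite lt_min e10.
    move=> u u' _ _ bu bu'; apply: (joined_ball bu bu') => z bz [Jz|].
      by apply: He2; exists z => //; apply: ball_sym; apply: le_ball bz; rewrite ge_min lexx orbT.
    by apply: He1; apply: le_ball bz; rewrite ge_min lexx.
  have [d d0 Hd] := continuous_plane_ball t cg e10.
  pose n := Num.min (d / 2) (1 / 4).
  have n0 : 0 < n by rewrite lt_min !divr_gt0.
  have [nd n4] : n <= d / 2 /\ n <= 1 / 4 by rewrite !ge_min !lexx orbT.
  pose A := path_arc gamma (t + n) (t + 1 - n).
  have nA : ~ A q.
    move=> /arcP[v v1]; rewrite -tq => /(loop_inj lg) H.
    have : t = v by apply: H; rewrite ltr_distl; lra.
    lra.
  have clA : closed A by exact: arc_closed.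
  have [e3 e30 He3] := closed_ballN clA nA.
  exists (Num.min e1 e3); first by rewrite lt_min e10.
  move=> u u' Uu Uu' bu bu'.
  have j2 : joined (psi `|` A) u u'.
    apply: (joined_ball bu bu') => z bz [|Az].
      by apply: He1; apply: le_ball bz; rewrite ge_min lexx.
    by apply: He3; exists z => //; apply: ball_sym; apply: le_ball bz; rewrite ge_min lexx orbT.
  have kA : compact A by exact: arc_compact.
  have jU : joined (J `|` (psi `|` A)) u u'.
    apply: joinedU => //; [exact: compactU|exact: closedU| |exact: jUJ].
    rewrite (_ : _ `&` _ = A); first exact: arc_connected.
    apply/seteqP; split=> [z [Jz [pz|//]]|z Az]; last by split; [exact: arc_range Az|right].
    move: Jz; rewrite /J (loop_range (t - n) lg) => /arcP[v /andP[v1 v2] zv].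
    have [vl|lv] := ltP v (t + n); last by rewrite zv; apply: arc_mem; lra.
    exfalso; apply: (He1 z) => //; rewrite zv -tq; apply: Hd; rewrite ltr_distl; lra.
  by apply: joined_sub jU => z [Jz|pz]; [left|right; left].
have Uball z r : closure U z -> 0 < r -> exists2 u, U u & ball z r u.
  by move=> clz r0; have [u [Uu zu]] := clz _ (nbhsx_ballx z r r0); exists u.
pose Z := psi `|` path_arc gamma t1 t3; pose Zc := psi `|` path_arc gamma t3 (t1 + 1).
have kZ : compact Z by apply: compactU => //; exact: arc_compact.
have kZc : compact Zc by apply: compactU => //; exact: arc_compact.
have nZc : ~ Zc (gamma t2).
  move=> [pt|/arcP[v v1 /(loop_inj lg)]]; first exact: sub0 W2psi W2t pt.
  rewrite ltr_distl => H; have : t2 = v by apply: H; lra.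
  lra.
have [rz rz0 Hrz] := closed_ballN (closed_compact_plane kZc) nZc.
have {}Hrz z : ball (gamma t2) rz z -> ~ Zc z.
  by move=> tz zc; apply: Hrz; exists z => //; exact: ball_sym.
have [r2 r20 Hr2] := locU _ W2t.
have [s Us ts] : exists2 s, U s & ball (gamma t2) (Num.min rz r2) s.
  by apply: Uball; [exact: W2U|rewrite lt_min rz0].
have [uD UuD [DuD suD]] : exists2 u, U u & D u /\ joined (J `|` psi) s u.
  (* [W2] itself may touch the loop, so the walk uses points of [U] near it; [P] is locally constant
     along [W2]. *)
  pose P q := exists2 r, 0 < r & forall u, U u -> ball q r u -> joined (J `|` psi) s u.
  have [r r0 Hr] : P qD.
    apply: (connected_loc_const cW2 _ W2t W2D).
      move=> q W2q; have [r r0 Hr] := locU q W2q.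
      have r20' : 0 < r / 2 by rewrite divr_gt0.
      apply/nbhs_ballP; exists (r / 2) => // q' qq' W2q'; split=> -[r' r'0 H'].
        have [u0 Uu0] := Uball q (Num.min r r') (W2U _ W2q) ltac:(by rewrite lt_min r0).
        move=> bu0; exists (r / 2) => // u Uu q'u.
        apply: (@joined_trans _ _ u0); first by apply: H' => //; apply: le_ball bu0; rewrite ge_min lexx orbT.
        apply: Hr => //; first by apply: le_ball bu0; rewrite ge_min lexx.
        by rewrite [r]splitr; exact: ball_triangle qq' q'u.
      have [u0 Uu0] := Uball q' (Num.min (r / 2) r') (W2U _ W2q') ltac:(by rewrite lt_min r20').
      move=> bu0; exists r => // u Uu qu.
      apply: (@joined_trans _ _ u0); first by apply: H' => //; apply: le_ball bu0; rewrite ge_min lexx orbT.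
      apply: Hr => //; rewrite [r]splitr; apply: ball_triangle qq' _.
      by apply: le_ball bu0; rewrite ge_min lexx.
    exists r2 => // u Uu tu; apply: Hr2 => //.
    by apply: le_ball ts; rewrite ge_min lexx orbT.
  have := oD; rewrite openE => /(_ qD DqD) /nbhs_ballP[r' /= r'0 Hr'].
  have [u Uu bu] := Uball qD (Num.min r r') (W2U _ W2D) ltac:(by rewrite lt_min r0).
  exists u => //; split.
    by apply: Hr'; apply: le_ball bu; rewrite ge_min lexx orbT.
  by apply: Hr => //; apply: le_ball bu; rewrite ge_min lexx.
have nJs : ~ J s by exact: sub0 UJ Us.
have [v0 [nJv0 nsv]] : exists v0, ~ J v0 /\ ~ joined J s v0.
  have [p [q [np nq npq]]] := loop_separates lg.
  have [sp|nsp] := pselect (joined J s p); last by exists p.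
  by exists q; split => // sq; apply: npq; exact: joined_trans (joined_sym sp) sq.
(* The other side stays clear of [W1] and [W3], which lie in the closure of [U], and of [L], which
   misses the loop and touches [W1]. *)
have nVU z : joined J v0 z -> ~ closure U z.
  move=> vz clz; have [r r0 Hr] := joined_near clJ (joined_notin vz).
  have [u Uu /Hr zu] := Uball z r clz r0.
  by apply: nsv; apply: joined_trans (jUJ _ _ Us Uu) (joined_sym (joined_trans vz zu)).
have nVpsi z : joined J v0 z -> ~ psi z.
  move=> vz [[W1z|Lz]|W3z]; [exact: nVU vz (W1U _ W1z)| |exact: nVU vz (W3U _ W3z)].
  apply: (nVU x1); last exact: W1U.
  by apply: joined_trans vz _; exact: joined_connected cL LJ Lz Lo.
have clV w : J w -> closure [set z | joined J v0 z] w.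
  by move=> Jw; apply: (loop_boundary lg nJs nJv0 nsv Jw).
have [e0 [ve0 De0]] : exists z, joined J v0 z /\ D z.
  by have [z [vz Dz]] := clV (gamma 0) (ex_intro2 _ _ 0 I erefl) D (open_nbhs_nbhs (conj oD D0)); exists z.
have [s0 [vs0 ts0]] : exists z, joined J v0 z /\ ball (gamma t2) rz z.
  by have [z [vz bz]] := clV (gamma t2) (ex_intro2 _ _ t2 I erefl) _ (nbhsx_ballx (gamma t2) rz rz0); exists z.
have jZ : joined Z s s0.
  apply: (@joined_trans _ _ uD).
    by apply: joined_sub suD => z [pz|Az]; [right|left; exact: arc_range Az].
  apply: (@joined_trans _ _ e0).
    by apply: (joined_connected cD) => //; rewrite setIUr Dpsi DA setU0.
  apply: (@joined_connected _ (connected_component (~` J) v0)) => //; first exact: component_connected.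
  rewrite -subset0 => z [vz [pz|Az]]; first exact: nVpsi vz pz.
  exact: (joined_notin vz) (arc_range Az).
have jZc : joined Zc s s0.
  apply: (@joined_ball _ _ s s0 (gamma t2) rz) => //.
  by apply: le_ball ts; rewrite ge_min lexx.
(* The two arcs share only [gamma t1] and [gamma t3], which belong to [W1] and [W3]; so [Z] and [Zc]
   meet exactly in the connected set [psi]. *)
have jU : joined (Z `|` Zc) s s0.
  apply: joinedU => //; try exact: closed_compact_plane.
  rewrite -setUIr (_ : _ `|` _ = psi) //; apply/setUidPl => z [/arcP[v /andP[v1 v2] ->] /arcP[u /andP[u1 u2] E]].
  have [uv|uv] := ltP `|v - u| 1.
    by right; have := loop_inj lg uv E => uv'; rewrite (_ : v = t3) //; lra.
  left; left; rewrite (_ : v = t1) //; move: uv; rewrite ler_normr; lra.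
apply: nsv; apply: joined_trans (joined_sym vs0); apply: joined_sub jU => z.
rewrite /J (loop_range t1 lg) => /arcP[u /andP[u1 u2] ->].
by have [ul|lu] := leP u t3; [left; right|right; right]; apply: arc_mem; lra.
Qed.

End Loops.

Section Circle.
Variable R : realType.
Local Notation plane := (R * R)%type.
Implicit Types (s t c : R).

Definition cis t : plane := (cos (2 * pi * t), sin (2 * pi * t)).

Lemma cis_continuous : continuous cis.
Proof.
move=> t; have lin : 2 * pi * x @[x --> t] --> 2 * pi * t by apply: cvgMl_tmp; exact: cvg_id.
by apply: cvg_pair_point; [apply: (continuous_comp lin); exact: continuous_cos
  |apply: (continuous_comp lin); exact: continuous_sin].
Qed.

Lemma cisD1 t : cis (t + 1) = cis t.
Proof. by rewrite /cis mulrDr mulr1 mulr_natl cosD2pi sinD2pi. Qed.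

Lemma cis_norm t : (cis t).1 ^+ 2 + (cis t).2 ^+ 2 = 1.
Proof. exact: cos2Dsin2. Qed.

Lemma cis_inj s t : `|s - t| < 1 -> cis s = cis t -> s = t.
Proof.
move=> st [Ec Es]; apply/eqP; rewrite -subr_eq0; apply/eqP.
set u := s - t in st *; pose y := pi * u.
have pi0 := @pi_gt0 R.
have sy : sin y = 0.
  have : cos (2 * pi * u) = 1.
    by rewrite /u mulrBr cosB Ec Es -!expr2 cos2Dsin2.
  rewrite (_ : 2 * pi * u = y + y); last by rewrite /y; ring.
  by rewrite cosD; have := cos2Dsin2 y => H1 H2; nra.
have [u0|u0|//] := ltgtP u 0; exfalso.
  have : 0 < sin (- y).
    apply: sin_gt0_pi; rewrite /y; move: st; rewrite ltr0_norm // => st.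
    by apply/andP; split; nra.
  by rewrite sinN sy oppr0 ltxx.
have : 0 < sin y.
  apply: sin_gt0_pi; rewrite /y; move: st; rewrite gtr0_norm // => st.
  by apply/andP; split; nra.
by rewrite sy ltxx.
Qed.

Lemma cis_surj (c s : R) : c ^+ 2 + s ^+ 2 = 1 -> exists2 t, - 1 <= t <= 1 & cis t = (c, s).
Proof.
move=> cs; have c1 : -1 <= c <= 1 by apply/andP; split; nra.
have pi0 := @pi_gt0 R; have a0 := acos_ge0 c1; have api := acos_lepi c1.
have [_ ca] := acos_def c1.
have sa : sin (acos c) = `|s|.
  rewrite sin_acos // (_ : 1 - c ^+ 2 = s ^+ 2); last by lra.
  exact: sqrtr_sqr.
pose t := acos c / (2 * pi).
have t0 : 0 <= t <= 1.
  rewrite /t; apply/andP; split; first by apply: divr_ge0 => //; lra.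
  by rewrite ler_pdivrMr ?mulr_gt0 // mul1r; lra.
have tE : 2 * pi * t = acos c by rewrite /t mulrC divfK // gt_eqF // mulr_gt0.
have [s0|s0] := leP 0 s.
  by exists t; [lra|rewrite /cis tE ca sa ger0_norm].
exists (- t); first by lra.
by rewrite /cis mulrN tE cosN sinN ca sa ltr0_norm // opprK.
Qed.

Definition nsq (z : plane) := z.1 ^+ 2 + z.2 ^+ 2.

Lemma continuous_fst : continuous (fst : plane -> R). Proof. by move=> z; exact: cvg_fst. Qed.
Lemma continuous_snd : continuous (snd : plane -> R). Proof. by move=> z; exact: cvg_snd. Qed.

Lemma nsq_continuous : continuous nsq.
Proof.
move=> z; apply: cvgD; rewrite /= expr2 => //.
  by under eq_fun do rewrite expr2; apply: cvgM; exact: continuous_fst.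
by under eq_fun do rewrite expr2; apply: cvgM; exact: continuous_snd.
Qed.

Lemma nsq_ge0 z : 0 <= nsq z. Proof. by rewrite addr_ge0 ?sqr_ge0. Qed.

Lemma open_nsq_lt (r : R) : open [set z | nsq z < r].
Proof. by apply: (open_comp (f := nsq)) (@open_lt R r) => z _; exact: nsq_continuous. Qed.

Lemma star_connected (S : set plane) (c : plane) : S c ->
  (forall p t, S p -> 0 <= t <= 1 -> S (seg c p t)) -> connected S.
Proof.
move=> Sc star; rewrite (_ : S = connected_component S c); first exact: component_connected.
apply/seteqP; split=> [p Sp|]; last exact: connected_component_sub.
have := @joined_seg R (~` S) c p; rewrite /joined setCK; apply => t t01.
by move=> /(_ (star p t Sp t01)).
Qed.

(** Complex multiplication by [q]. *)
Definition rotate (q z : plane) : plane := (q.1 * z.1 - q.2 * z.2, q.1 * z.2 + q.2 * z.1).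

Lemma nsq_rotate q z : nsq (rotate q z) = nsq q * nsq z.
Proof. by rewrite /nsq /rotate /=; ring. Qed.

Lemma rotate_continuous q : continuous (rotate q).
Proof.
move=> z; apply: cvg_pair_point.
  by apply: cvgB; apply: cvgMl_tmp; [exact: continuous_fst|exact: continuous_snd].
by apply: cvgD; apply: cvgMl_tmp; [exact: continuous_snd|exact: continuous_fst].
Qed.

(* The two points are joined outside the disc: out radially to twice the radius, then along
   the larger circle. *)
Lemma outer_connection (p q : plane) (r : R) : 0 < r -> nsq p = r -> nsq q = r ->
  exists L : set plane, [/\ compact L, connected L, L p, L q &
    forall z, L z -> z = p \/ z = q \/ r < nsq z].
Proof.
move=> r0 pr qr; pose spoke (p : plane) := seg p (2 * p.1, 2 * p.2) @` `[0, 1].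
pose C := (fun t => rotate (2 * p.1, 2 * p.2) (cis t)) @` `[- 1, 1].
have cC : continuous (fun t => rotate (2 * p.1, 2 * p.2) (cis t)).
  by move=> t; apply: continuous_comp; [exact: cis_continuous|exact: rotate_continuous].
have spoke_ends p' : spoke p' p' /\ spoke p' (2 * p'.1, 2 * p'.2).
  split; [exists 0|exists 1]; rewrite /= ?in_itv /= ?lexx ?ler01 //;
    by case: p' => x y; congr pair => /=; ring.
(* The complex quotient of [q] by [p]: [t] is the angle, in full turns, from [p] to [q]. *)
have [t t1 tE] : exists2 t, - 1 <= t <= 1 & cis t = ((p.1 * q.1 + p.2 * q.2) / r, (p.1 * q.2 - p.2 * q.1) / r).
  apply: cis_surj; have H : (p.1 * q.1 + p.2 * q.2) ^+ 2 + (p.1 * q.2 - p.2 * q.1) ^+ 2 = nsq p * nsq q.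
    by rewrite /nsq; ring.
  by rewrite !expr_div_n -mulrDl H pr qr -expr2 divff // expf_neq0 ?gt_eqF.
have Cp : C (2 * p.1, 2 * p.2).
  exists 0; first by rewrite /= in_itv /=; lra.
  by rewrite /rotate /cis !mulr0 cos0 sin0 /=; congr pair; ring.
have Cq : C (2 * q.1, 2 * q.2).
  exists t; first by rewrite /= in_itv.
  have rn : r != 0 by rewrite gt_eqF.
  rewrite tE /rotate; move: pr rn; rewrite /nsq => <- rn /=.
  by congr pair; field.
have cS p' : connected (spoke p').
  apply: connected_continuous_connected; first exact: segment_connected.
  by apply: continuous_subspaceT; exact: seg_continuous.
have kS p' : compact (spoke p').
  apply: continuous_compact; last exact: segment_compact.
  by apply: continuous_subspaceT; exact: seg_continuous.
exists (spoke p `|` C `|` spoke q); split.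
- apply: compactU => //; apply: compactU => //.
  by apply: continuous_compact; [exact: continuous_subspaceT|exact: segment_compact].
- have CC : connected C.
    apply: connected_continuous_connected; first exact: segment_connected.
    exact: continuous_subspaceT.
  apply: connectedU => //; first by exists (2 * q.1, 2 * q.2); split; [right|case: (spoke_ends q)].
  by apply: connectedU => //; exists (2 * p.1, 2 * p.2); split => //; case: (spoke_ends p).
- by left; left; case: (spoke_ends p).
- by right; case: (spoke_ends q).
- have onS p' z : nsq p' = r -> spoke p' z -> z = p' \/ r < nsq z.
    move=> p'r [u /=]; rewrite in_itv /= => /andP[u0 u1] <-.
    have [->|un] := eqVneq u 0.
      by left; rewrite /seg !mul0r !addr0 -surjective_pairing.
    right; have up : 0 < u by rewrite lt_neqAle eq_sym un.
    rewrite (_ : nsq _ = (1 + u) ^+ 2 * nsq p'); last by rewrite /nsq /seg /=; ring.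
    by rewrite p'r; nra.
  move=> z [[/(onS _ _ pr)[->|]|[u _ <-]]|/(onS _ _ qr)[->|]]; [by left|by right; right| |by right; left|by right; right].
  right; right; rewrite nsq_rotate (_ : nsq (cis u) = 1); last exact: cis_norm.
  have -> : nsq (2 * p.1, 2 * p.2) = 4 * r by rewrite -pr /nsq /=; ring.
  by rewrite mulr1; lra.
Qed.

(** [r2] and [R2] are the squares of the inner and outer radius. *)
Definition spans_annulus (r2 R2 : R) (U W : set plane) := [/\ connected W, compact W, W `<=` closure U,
  (forall z, W z -> r2 <= nsq z <= R2) &
  W `&` [set z | nsq z = r2] !=set0 /\ W `&` [set z | nsq z = R2] !=set0].

(** Supplies the auxiliary sets of [loop_no_middle_continuum]: [L] joins the outer ends of [W1] and
    [W3] outside the large circle, which encloses the loop, and [D] is the inner disc around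
    [gamma 0]. *)
Lemma loop_spanning_ordered gamma (r2 R2 eta : R) U (W1 W2 W3 : set plane) t1 t2 t3 :
  loop gamma -> gamma 0 = (0, 0) -> (forall t, nsq (gamma t) < R2) ->
  (forall t, eta <= t <= 1 - eta -> r2 < nsq (gamma t)) -> 0 < r2 -> r2 < R2 -> 0 < eta ->
  connected U -> U `&` range gamma = set0 ->
  spans_annulus r2 R2 U W1 -> spans_annulus r2 R2 U W2 -> spans_annulus r2 R2 U W3 ->
  W1 `&` W2 = set0 -> W2 `&` W3 = set0 ->
  W1 (gamma t1) -> W2 (gamma t2) -> W3 (gamma t3) ->
  eta <= t1 -> t1 < t2 -> t2 < t3 -> t3 <= 1 - eta -> False.
Proof.
move=> lg g0 gR gr r0 rR eta0 cU UJ [cW1 kW1 W1U W1an [_ [q1 [W1q q1R]]]].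
move=> [cW2 kW2 W2U W2an [[q [W2q qr]] _]] [cW3 kW3 W3U W3an [_ [q3 [W3q q3R]]]].
move=> W12 W23 W1t W2t W3t te t12 t23 t3e.
have R0 : 0 < R2 by lra.
have [L [kL cL Lq1 Lq3 LR]] := outer_connection R0 q1R q3R.
have LR' z : L z -> R2 <= nsq z by case/LR => [->|[->|/ltW //]]; rewrite ?q1R ?q3R.
have sub0 (S S' : set plane) z : S `&` S' = set0 -> S z -> S' z -> False.
  by move=> E Sz S'z; have : (S `&` S') z by []; rewrite E.
have W2psi z : W2 z -> (W1 `|` L `|` W3) z -> False.
  move=> W2z [[W1z|Lz]|W3z]; [exact: (sub0 _ _ z W12)| |exact: (sub0 _ _ z W23)].
  have [zq|[zq|]] := LR z Lz.
  - by apply: (sub0 _ _ z W12) => //; rewrite zq.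
  - by apply: (sub0 _ _ z W23) => //; rewrite zq.
  - by have := W2an z W2z; lra.
have cg := loop_continuous lg.
have kA : compact (path_arc gamma t1 t3) by exact: arc_compact.
have kpsi : compact (W1 `|` L `|` W3 `|` path_arc gamma t1 t3).
  by do 3!apply: compactU => //.
have nq : ~ (W1 `|` L `|` W3 `|` path_arc gamma t1 t3) q.
  move=> [/(W2psi _ W2q) //|/arcP[u u1 E]]; have := gr u; rewrite -E qr ltxx => H.
  suff : false by []. by apply: H; lra.
have [e e0 He] := closed_ballN (closed_compact_plane kpsi) nq.
have {}He z : ball q e z -> ~ (W1 `|` L `|` W3 `|` path_arc gamma t1 t3) z.
  by move=> qz pz; apply: He; exists z => //; exact: ball_sym.
(* [W2] only reaches the circle bounding the open disc; the small ball around its inner end [q]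
   makes [D] meet it. *)
pose D := [set z | nsq z < r2] `|` ball q e.
have Dn z : D z -> ~ (W1 `|` L `|` W3 `|` path_arc gamma t1 t3) z.
  case=> [/= zr|]; last exact: He.
  move=> [[[/W1an|/LR']|/W3an]|/arcP[u u1 zu]]; [lra|lra|lra|].
  have := gr u; rewrite -zu => H; have : r2 < nsq z by apply: H; lra.
  lra.
apply: (@loop_no_middle_continuum _ gamma U W1 W2 W3 L D t1 t2 t3) => //.
- by rewrite -subset0 => z [/LR' Lz [u _ uz]]; have := gR u; rewrite uz; lra.
- by exists q1.
- by exists q3.
- by rewrite -subset0 => z [W2z /W2psi]; apply.
- apply: connectedU.
  + pose k := Num.min (e / (2 * (1 + `|q.1| + `|q.2|))) (1 / 2).
    have n1 := normr_ge0 q.1; have n2 := normr_ge0 q.2.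
    have den : 0 < 2 * (1 + `|q.1| + `|q.2|) by lra.
    have k0 : 0 < k by rewrite lt_min !divr_gt0.
    have [ke k2] : k <= e / (2 * (1 + `|q.1| + `|q.2|)) /\ k <= 1 / 2 by rewrite !ge_min !lexx orbT.
    have {}ke : k * (2 * (1 + `|q.1| + `|q.2|)) <= e by rewrite -ler_pdivlMr.
    exists ((1 - k) * q.1, (1 - k) * q.2); split => /=.
      rewrite (_ : nsq _ = (1 - k) ^+ 2 * nsq q); last by rewrite /nsq /=; ring.
      by rewrite qr gtr_pMl //; nra.
    have small (c : R) : `|c - (1 - k) * c| = k * `|c|.
      by rewrite (_ : c - _ = k * c); [rewrite normrM gtr0_norm|ring].
    by apply/plane_ballE; rewrite /= !small; split; nra.
  + apply: (@star_connected _ (0, 0)).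
      by rewrite /= /nsq /= expr0n /= addr0.
    move=> p t /= pr /andP[t0 t1'].
    rewrite (_ : nsq _ = t ^+ 2 * nsq p); last by rewrite /nsq /seg /=; ring.
    by apply: le_lt_trans pr; rewrite ler_piMl ?nsq_ge0 //; nra.
  + apply: (@star_connected _ q); first exact: ballxx.
    move=> p t /plane_ballE[b1 b2] /andP[t0 t1']; apply/plane_ballE; rewrite /seg /=.
    have small (c d : R) : `|c - d| < e -> `|c - (c + t * (d - c))| < e.
      rewrite (_ : c - (c + t * (d - c)) = t * (c - d)); last by ring.
      by rewrite normrM ger0_norm //; have := normr_ge0 (c - d); nra.
    by split; exact: small.
- by apply: openU; [exact: open_nsq_lt|exact: ball_open].
- by left; rewrite /= g0 /nsq /= expr0n /= addr0.
- by rewrite -subset0 => z [/Dn nD pz]; apply: nD; left.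
- by exists q; split => //; right; exact: ballxx.
- lra.
- by rewrite -subset0 => z [/Dn nD pz]; apply: nD; right.
Qed.

(** Disjointness makes the three parameters distinct; whichever one is in the middle, the ordered
    version applies. *)
Lemma loop_spanning_three gamma (r2 R2 eta : R) U (W : 'I_3 -> set plane) (t : 'I_3 -> R) :
  loop gamma -> gamma 0 = (0, 0) -> (forall t, nsq (gamma t) < R2) ->
  (forall t, eta <= t <= 1 - eta -> r2 < nsq (gamma t)) -> 0 < r2 -> r2 < R2 -> 0 < eta ->
  connected U -> U `&` range gamma = set0 ->
  (forall i, spans_annulus r2 R2 U (W i)) ->
  (forall i j, i != j -> W i `&` W j = set0) ->
  (forall i, W i (gamma (t i)) /\ eta <= t i <= 1 - eta) -> False.
Proof.
move=> lg g0 gR gr r0 rR eta0 cU UJ Wan Wd Wt.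
have H i j k : i != j -> j != k -> t i < t j -> t j < t k -> False.
  move=> ij jk tij tjk.
  by apply: (loop_spanning_ordered lg g0 gR gr r0 rR eta0 cU UJ (Wan i) (Wan j) (Wan k)
    (Wd i j ij) (Wd j k jk) (Wt i).1 (Wt j).1 (Wt k).1) => //; have := (Wt i).2; have := (Wt k).2; lra.
have tne i j : i != j -> t i != t j.
  move=> ij; apply/eqP => E; have : (W i `&` W j) (gamma (t i)) by split; [|rewrite E]; case: (Wt i); case: (Wt j).
  by rewrite Wd.
pose a : 'I_3 := Ordinal (isT : (0 < 3)%N).
pose b : 'I_3 := Ordinal (isT : (1 < 3)%N).
pose c : 'I_3 := Ordinal (isT : (2 < 3)%N).
have := tne a b isT; have := tne b c isT; have := tne a c isT.
have Habc := H a b c isT isT; have Hacb := H a c b isT isT.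
have Hbac := H b a c isT isT; have Hbca := H b c a isT isT.
have Hcab := H c a b isT isT; have Hcba := H c b a isT isT.
by case: (ltgtP (t a) (t c)) => // ? _; case: (ltgtP (t b) (t c)) => // ? _;
  case: (ltgtP (t a) (t b)) => // ? _; auto; lra.
Qed.
End Circle.

(** * Stereographic charts of the sphere *)

Section SphereChart.
Variable R : realType.
Local Notation plane := (R * R)%type.
Local Notation P3 := 'rV[R]_3.
Implicit Types (p q x y : P3) (z : plane).

Lemma row_ballE n (p q : 'rV[R]_n) (e : R) : ball p e q <-> 0 < e /\ forall j, `|p ord0 j - q ord0 j| < e.
Proof.
split=> [[e0 H]|[e0 H]]; first by split => // j; exact: (H ord0 j).
by split => // i j; rewrite (ord1 i); exact: H.
Qed.

Lemma row_continuous (T : topologicalType) n (f : T -> 'rV[R]_n) (t : T) :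
  (forall j, f u ord0 j @[u --> t] --> f t ord0 j) -> {for t, continuous f}.
Proof.
move=> cf B /nbhs_ballP[e /= e0 He].
have : \forall u \near t, forall j, `|f t ord0 j - f u ord0 j| < e.
  apply: filter_forall => j; have := cf j (ball (f t ord0 j) e) (nbhsx_ballx _ _ e0).
  exact.
by apply: filterS => u Hu; apply: He; apply/row_ballE.
Qed.

Definition coord3 (k : nat) (p : P3) : R := p ord0 (inord k).

Lemma coord_continuous3 k : continuous (coord3 k).
Proof. by move=> p; exact: coord_continuous. Qed.

Lemma sum3 (F : 'I_3 -> R) : \sum_(i < 3) F i = F (inord 0) + F (inord 1) + F (inord 2).
Proof.
rewrite !big_ord_recl big_ord0 addr0 addrA.
by congr (F _ + F _ + F _); apply: val_inj; rewrite /= inordK.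
Qed.

Lemma coord_ext p q : coord3 0 p = coord3 0 q -> coord3 1 p = coord3 1 q -> coord3 2 p = coord3 2 q -> p = q.
Proof.
move=> E0 E1 E2; apply/rowP; case=> [[|[|[|//]]] Hi].
- by move: E0; rewrite /coord3 (_ : inord 0 = Ordinal Hi) //; apply: val_inj; rewrite /= inordK.
- by move: E1; rewrite /coord3 (_ : inord 1 = Ordinal Hi) //; apply: val_inj; rewrite /= inordK.
- by move: E2; rewrite /coord3 (_ : inord 2 = Ordinal Hi) //; apply: val_inj; rewrite /= inordK.
Qed.

Definition vec3 (a b c : R) : P3 := \row_j (if j == inord 0 then a else if j == inord 1 then b else c).

Lemma coord_vec3 a b c : [/\ coord3 0 (vec3 a b c) = a, coord3 1 (vec3 a b c) = b & coord3 2 (vec3 a b c) = c].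
Proof.
have E (i j : nat) : (i < 3)%N -> (j < 3)%N -> (inord i == inord j :> 'I_3) = (i == j).
  by move=> i3 j3; rewrite -val_eqE /= !inordK.
by rewrite /coord3 /vec3 !mxE !E.
Qed.

Definition dot p q := coord3 0 p * coord3 0 q + coord3 1 p * coord3 1 q + coord3 2 p * coord3 2 q.

Lemma sphereE p : sphere p <-> dot p p = 1.
Proof. by rewrite /sphere /= sum3 /dot !expr2. Qed.

Lemma dot_continuous q : continuous (dot ^~ q).
Proof.
move=> p; exact: (cvgD (cvgD (cvgMr_tmp (@coord_continuous3 0 p)) (cvgMr_tmp (@coord_continuous3 1 p)))
  (cvgMr_tmp (@coord_continuous3 2 p))).
Qed.

Lemma dotC p q : dot p q = dot q p. Proof. by rewrite /dot; ring. Qed.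

Lemma dot_lt1 p q : sphere p -> sphere q -> p <> q -> dot p q < 1.
Proof.
move=> /sphereE Sp /sphereE Sq pq.
have s0 := sqr_ge0 (coord3 0 p - coord3 0 q); have s1 := sqr_ge0 (coord3 1 p - coord3 1 q).
have s2 := sqr_ge0 (coord3 2 p - coord3 2 q).
have H : (coord3 0 p - coord3 0 q) ^+ 2 + (coord3 1 p - coord3 1 q) ^+ 2 + (coord3 2 p - coord3 2 q) ^+ 2
    = 2 - 2 * dot p q.
  transitivity (dot p p + dot q q - 2 * dot p q); first by rewrite /dot; ring.
  by rewrite Sp Sq; ring.
rewrite lt_neqAle; apply/andP; split; last by lra.
apply/eqP => E; apply: pq; rewrite E in H.
have E0 : (coord3 0 p - coord3 0 q) ^+ 2 = 0 by lra.
have E1 : (coord3 1 p - coord3 1 q) ^+ 2 = 0 by lra.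
have E2 : (coord3 2 p - coord3 2 q) ^+ 2 = 0 by lra.
by apply: coord_ext; apply/eqP; rewrite -subr_eq0 -sqrf_eq0 (E0, E1, E2).
Qed.

(* The symmetric matrix (a b y0; b c y1; y0 y1 y2) is the Householder reflection exchanging
   [y] and the third basis vector, so its rows and columns are the same orthonormal frame. *)
Lemma reflection_frame (y0 y1 y2 : R) : y0 ^+ 2 + y1 ^+ 2 + y2 ^+ 2 = 1 ->
  exists a b c, [/\ a ^+ 2 + b ^+ 2 + y0 ^+ 2 = 1, b ^+ 2 + c ^+ 2 + y1 ^+ 2 = 1,
    a * b + b * c + y0 * y1 = 0, a * y0 + b * y1 + y0 * y2 = 0 & b * y0 + c * y1 + y1 * y2 = 0].
Proof.
move=> E; have [y21|y21] := eqVneq y2 1.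
  have s0 := sqr_ge0 y0; have s1 := sqr_ge0 y1.
  have /eqP : y0 ^+ 2 = 0 by move: E; rewrite y21; lra.
  have /eqP : y1 ^+ 2 = 0 by move: E; rewrite y21; lra.
  rewrite !sqrf_eq0 => /eqP -> /eqP ->; exists 1, 0, 1.
  by split; rewrite ?y21; ring.
pose d := 1 - y2; have d0 : d != 0 by rewrite subr_eq0 eq_sym.
pose i := d^-1; have di : d * i = 1 by rewrite divff.
have Ed : y0 ^+ 2 + y1 ^+ 2 = d * (2 - d) by rewrite /d; lra.
have k1 : (y0 ^+ 2 + y1 ^+ 2) * i = 2 - d by rewrite Ed mulrAC di mul1r.
have k2 : (y0 ^+ 2 + y1 ^+ 2) * i * i = 2 * i - 1.
  by rewrite k1 mulrBl di.
have y2d : y2 = 1 - d by rewrite /d; ring.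
exists (1 - y0 ^+ 2 * i), (- (y0 * y1 * i)), (1 - y1 ^+ 2 * i); split.
- transitivity (1 + y0 ^+ 2 * ((y0 ^+ 2 + y1 ^+ 2) * i * i - 2 * i + 1)); first by ring.
  by rewrite k2; ring.
- transitivity (1 + y1 ^+ 2 * ((y0 ^+ 2 + y1 ^+ 2) * i * i - 2 * i + 1)); first by ring.
  by rewrite k2; ring.
- transitivity (y0 * y1 * ((y0 ^+ 2 + y1 ^+ 2) * i * i - 2 * i + 1)); first by ring.
  by rewrite k2; ring.
- transitivity (y0 * (1 - (y0 ^+ 2 + y1 ^+ 2) * i + y2)); first by ring.
  by rewrite k1 y2d; ring.
- transitivity (y1 * (1 - (y0 ^+ 2 + y1 ^+ 2) * i + y2)); first by ring.
  by rewrite k1 y2d; ring.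
Qed.

Lemma continuous_div (T : topologicalType) (f g : T -> R) (t : T) :
  {for t, continuous f} -> {for t, continuous g} -> g t != 0 ->
  {for t, continuous (fun u => f u / g u)}.
Proof. by move=> cf cg g0; apply: cvgM => //; exact: cvgV. Qed.

(* Stereographic projection from [y], translated so that [x] goes to the origin. *)
Lemma sphere_chart x y : sphere x -> sphere y -> x <> y ->
  exists (Psi : P3 -> plane) (sigma : plane -> P3) (k : R),
    [/\ 0 < k, continuous sigma, forall z, sphere (sigma z) /\ sigma z <> y & forall z, Psi (sigma z) = z] /\
    [/\ forall p, sphere p -> p <> y -> sigma (Psi p) = p,
        forall p, sphere p -> p <> y -> {for p, continuous Psi} &
        forall p, sphere p -> p <> y -> nsq (Psi p) * (1 - dot p y) = k * (1 - dot p x)].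
Proof.
move=> Sx Sy xy; have /sphereE Dy := Sy; have /sphereE Dx := Sx.
have E6 : coord3 0 y ^+ 2 + coord3 1 y ^+ 2 + coord3 2 y ^+ 2 = 1 by move: Dy; rewrite /dot !expr2.
have [a [b [c [E1 E2 E3 E4 E5]]]] := reflection_frame E6.
have lt1 p : sphere p -> p <> y -> 0 < 1 - dot p y.
  by move=> Sp py; rewrite subr_gt0 dot_lt1.
(* [A], [B] and the product with [y] are coordinates in an orthonormal frame with third vector [y].
   The symmetry of the frame matrix gives the inversion formulas [inv0] to [inv2]. *)
pose A p := a * coord3 0 p + b * coord3 1 p + coord3 0 y * coord3 2 p.
pose B p := b * coord3 0 p + c * coord3 1 p + coord3 1 y * coord3 2 p.
have inv0 p : coord3 0 p = a * A p + b * B p + coord3 0 y * dot p y.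
  transitivity ((a ^+ 2 + b ^+ 2 + coord3 0 y ^+ 2) * coord3 0 p + (a * b + b * c + coord3 0 y * coord3 1 y) * coord3 1 p
    + (a * coord3 0 y + b * coord3 1 y + coord3 0 y * coord3 2 y) * coord3 2 p); last by rewrite /A /B /dot; ring.
  by rewrite E1 E3 E4; ring.
have inv1 p : coord3 1 p = b * A p + c * B p + coord3 1 y * dot p y.
  transitivity ((b ^+ 2 + c ^+ 2 + coord3 1 y ^+ 2) * coord3 1 p + (a * b + b * c + coord3 0 y * coord3 1 y) * coord3 0 p
    + (b * coord3 0 y + c * coord3 1 y + coord3 1 y * coord3 2 y) * coord3 2 p); last by rewrite /A /B /dot; ring.
  by rewrite E2 E3 E5; ring.
have inv2 p : coord3 2 p = coord3 0 y * A p + coord3 1 y * B p + coord3 2 y * dot p y.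
  transitivity ((coord3 0 y ^+ 2 + coord3 1 y ^+ 2 + coord3 2 y ^+ 2) * coord3 2 p + (a * coord3 0 y + b * coord3 1 y + coord3 0 y * coord3 2 y) * coord3 0 p
    + (b * coord3 0 y + c * coord3 1 y + coord3 1 y * coord3 2 y) * coord3 1 p); last by rewrite /A /B /dot; ring.
  by rewrite E6 E4 E5; ring.
have parseval p q : dot p q = A p * A q + B p * B q + dot p y * dot q y.
  rewrite {1}/dot (inv0 p) (inv1 p) (inv2 p).
  transitivity (A p * (a * coord3 0 q + b * coord3 1 q + coord3 0 y * coord3 2 q) +
    B p * (b * coord3 0 q + c * coord3 1 q + coord3 1 y * coord3 2 q) +
    dot p y * (coord3 0 q * coord3 0 y + coord3 1 q * coord3 1 y + coord3 2 q * coord3 2 y)); first by ring.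
  by [].
pose xa := A x / (1 - dot x y); pose xb := B x / (1 - dot x y).
pose Psi p : plane := (A p / (1 - dot p y) - xa, B p / (1 - dot p y) - xb).
pose N z := (z.1 + xa) ^+ 2 + (z.2 + xb) ^+ 2.
have N0 z : 0 <= N z by rewrite addr_ge0 ?sqr_ge0.
have N1 z : N z + 1 != 0 by rewrite gt_eqF //; have := N0 z; lra.
(* Inverse stereographic projection in frame coordinates, after undoing the translation by
   [(xa, xb)]. *)
pose s1 z := 2 * (z.1 + xa) / (N z + 1).
pose s2 z := 2 * (z.2 + xb) / (N z + 1).
pose s3 z := (N z - 1) / (N z + 1).
pose sigma z : P3 := vec3 (a * s1 z + b * s2 z + coord3 0 y * s3 z)
  (b * s1 z + c * s2 z + coord3 1 y * s3 z) (coord3 0 y * s1 z + coord3 1 y * s2 z + coord3 2 y * s3 z).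
have As z : A (sigma z) = s1 z.
  have [F0 F1 F2] := coord_vec3 (a * s1 z + b * s2 z + coord3 0 y * s3 z)
    (b * s1 z + c * s2 z + coord3 1 y * s3 z) (coord3 0 y * s1 z + coord3 1 y * s2 z + coord3 2 y * s3 z).
  rewrite /A F0 F1 F2.
  transitivity ((a ^+ 2 + b ^+ 2 + coord3 0 y ^+ 2) * s1 z + (a * b + b * c + coord3 0 y * coord3 1 y) * s2 z
    + (a * coord3 0 y + b * coord3 1 y + coord3 0 y * coord3 2 y) * s3 z); first by ring.
  by rewrite E1 E3 E4; ring.
have Bs z : B (sigma z) = s2 z.
  have [F0 F1 F2] := coord_vec3 (a * s1 z + b * s2 z + coord3 0 y * s3 z)
    (b * s1 z + c * s2 z + coord3 1 y * s3 z) (coord3 0 y * s1 z + coord3 1 y * s2 z + coord3 2 y * s3 z).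
  rewrite /B F0 F1 F2.
  transitivity ((b ^+ 2 + c ^+ 2 + coord3 1 y ^+ 2) * s2 z + (a * b + b * c + coord3 0 y * coord3 1 y) * s1 z
    + (b * coord3 0 y + c * coord3 1 y + coord3 1 y * coord3 2 y) * s3 z); first by ring.
  by rewrite E2 E3 E5; ring.
have Ys z : dot (sigma z) y = s3 z.
  have [F0 F1 F2] := coord_vec3 (a * s1 z + b * s2 z + coord3 0 y * s3 z)
    (b * s1 z + c * s2 z + coord3 1 y * s3 z) (coord3 0 y * s1 z + coord3 1 y * s2 z + coord3 2 y * s3 z).
  rewrite /dot F0 F1 F2.
  transitivity ((coord3 0 y ^+ 2 + coord3 1 y ^+ 2 + coord3 2 y ^+ 2) * s3 z + (a * coord3 0 y + b * coord3 1 y + coord3 0 y * coord3 2 y) * s1 z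
    + (b * coord3 0 y + c * coord3 1 y + coord3 1 y * coord3 2 y) * s2 z); first by ring.
  by rewrite E6 E4 E5; ring.
have s3y z : 1 - s3 z = 2 / (N z + 1) by rewrite /s3; field.
have Ssig z : sphere (sigma z).
  apply/sphereE; rewrite parseval As Bs Ys.
  transitivity ((4 * N z + (N z - 1) ^+ 2) / (N z + 1) ^+ 2).
    rewrite /s1 /s2 /s3; have -> : 4 * N z = (2 * (z.1 + xa)) ^+ 2 + (2 * (z.2 + xb)) ^+ 2 by rewrite /N; ring.
    by field.
  by field.
have x1 := lt1 x Sx xy.
exists Psi, sigma, (2 / (1 - dot x y)); split; split.
- by rewrite divr_gt0.
- have c1 : continuous (fun z : plane => z.1 + xa).
    by move=> z; apply: cvgD; [exact: continuous_fst|exact: cvg_cst].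
  have c2 : continuous (fun z : plane => z.2 + xb).
    by move=> z; apply: cvgD; [exact: continuous_snd|exact: cvg_cst].
  have cN : continuous N.
    move=> z; rewrite /N; under eq_fun do rewrite !expr2.
    by apply: cvgD; apply: cvgM; [exact: c1|exact: c1|exact: c2|exact: c2].
  have cN1 : continuous (fun z => N z + 1) by move=> z; apply: cvgD; [exact: cN|exact: cvg_cst].
  have cs1 : continuous s1.
    move=> z; apply: (@continuous_div _ (fun z => 2 * (z.1 + xa)) (fun z => N z + 1) z); [|exact: cN1|exact: N1].
    by apply: cvgMl_tmp; exact: c1.
  have cs2 : continuous s2.
    move=> z; apply: (@continuous_div _ (fun z => 2 * (z.2 + xb)) (fun z => N z + 1) z); [|exact: cN1|exact: N1].
    by apply: cvgMl_tmp; exact: c2.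
  have cs3 : continuous s3.
    move=> z; apply: (@continuous_div _ (fun z => N z - 1) (fun z => N z + 1) z); [|exact: cN1|exact: N1].
    by apply: cvgB; [exact: cN|exact: cvg_cst].
  have lin u v w : continuous (fun z => u * s1 z + v * s2 z + w * s3 z).
    by move=> z; exact: (cvgD (cvgD (cvgMl_tmp (cs1 z)) (cvgMl_tmp (cs2 z))) (cvgMl_tmp (cs3 z))).
  move=> z; apply: row_continuous => j.
  have E u : sigma u ord0 j = if j == inord 0 then a * s1 u + b * s2 u + coord3 0 y * s3 u else
      if j == inord 1 then b * s1 u + c * s2 u + coord3 1 y * s3 u
      else coord3 0 y * s1 u + coord3 1 y * s2 u + coord3 2 y * s3 u by rewrite /sigma /vec3 mxE.
  rewrite E (eq_fun E).
  by case: ifP => _; [exact: lin|case: ifP => _; exact: lin].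
- move=> z; split; first exact: Ssig.
  move=> E; have := Ys z; rewrite E Dy => H; have := s3y z; rewrite -H subrr => /esym/eqP.
  by rewrite mulf_eq0 invr_eq0 (negbTE (N1 z)) orbF pnatr_eq0.
- move=> z; rewrite /Psi As Bs Ys s3y /s1 /s2 [RHS]surjective_pairing.
  by congr pair; field; rewrite (N1 z).
- move=> p Sp py; have p1 := lt1 p Sp py; have /sphereE Dp := Sp.
  have pn : 1 - dot p y != 0 by rewrite gt_eqF.
  have NP : N (Psi p) = (1 + dot p y) / (1 - dot p y).
    rewrite /N /Psi /= !subrK.
    transitivity ((A p * A p + B p * B p) / (1 - dot p y) ^+ 2); first by field.
    have -> : A p * A p + B p * B p = 1 - dot p y * dot p y by have := parseval p p; lra.
    by field.
  have NP1 : N (Psi p) + 1 = 2 / (1 - dot p y) by rewrite NP; field.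
  have S1 : s1 (Psi p) = A p.
    by rewrite /s1 NP1 /Psi /= subrK; field.
  have S2 : s2 (Psi p) = B p.
    by rewrite /s2 NP1 /Psi /= subrK; field.
  have S3 : s3 (Psi p) = dot p y.
    by rewrite /s3 NP1 NP; field.
  rewrite /sigma S1 S2 S3 -inv0 -inv1 -inv2.
  by apply: coord_ext; have [] := coord_vec3 (coord3 0 p) (coord3 1 p) (coord3 2 p).
- move=> p Sp py; have p1 := lt1 p Sp py.
  have cA u v w : continuous (fun p => u * coord3 0 p + v * coord3 1 p + w * coord3 2 p).
    by move=> q; exact: (cvgD (cvgD (cvgMl_tmp (@coord_continuous3 0 q)) (cvgMl_tmp (@coord_continuous3 1 q)))
      (cvgMl_tmp (@coord_continuous3 2 q))).
  have cd : {for p, continuous (fun q => 1 - dot q y)}.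
    exact: (cvgB (cvg_cst _) (@dot_continuous y p)).
  have cP (F : P3 -> R) : continuous F -> {for p, continuous (fun q => F q / (1 - dot q y))}.
    by move=> cF; apply: (@continuous_div P3 F _ p (cF p) cd); rewrite gt_eqF.
  exact: (cvg_pair_point (cvgB (cP A (cA _ _ _)) (cvg_cst _)) (cvgB (cP B (cA _ _ _)) (cvg_cst _))).
(* On the sphere [1 - dot p q] is half the squared distance, so [nsq (Psi p)] is a constant multiple
   of the squared ratio of the distances from [p] to [x] and to [y]. *)
- move=> p Sp py; have p1 := lt1 p Sp py; have /sphereE Dp := Sp.
  have pn : 1 - dot p y != 0 by rewrite gt_eqF.
  have xn : 1 - dot x y != 0 by rewrite gt_eqF.
  have Ep : A p ^+ 2 + B p ^+ 2 = 1 - dot p y ^+ 2 by have := parseval p p; rewrite !expr2; lra.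
  have Ex : A x ^+ 2 + B x ^+ 2 = 1 - dot x y ^+ 2 by have := parseval x x; rewrite !expr2; lra.
  have Epx : A p * A x + B p * B x = dot p x - dot p y * dot x y by rewrite (parseval p x); ring.
  transitivity ((A p ^+ 2 + B p ^+ 2) / (1 - dot p y) + (A x ^+ 2 + B x ^+ 2) * (1 - dot p y) / (1 - dot x y) ^+ 2
     - 2 * (A p * A x + B p * B x) / (1 - dot x y)).
    by rewrite /nsq /Psi /xa /xb /=; field; rewrite pn xn.
  by rewrite Ep Ex Epx; field; rewrite pn xn.
Qed.
End SphereChart.

(** * Hausdorff convergence *)

Section HausdorffSelection.
Variable R : realType.
Local Notation P3 := 'rV[R]_3.
Implicit Types (K : set P3) (P Q : nat -> set P3) (A : set nat).

Definition unbounded_set A := forall N, exists2 n, (N <= n)%N & A n.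

Definition within_radius (e : R) (X Y : set P3) := forall p, X p -> exists2 q, Y q & ball p e q.

Lemma finite_net K (e : R) : 0 < e -> compact K ->
  exists l : seq P3, forall z, K z -> exists2 c, c \in l & ball c e z.
Proof.
move=> e0; rewrite compact_cover => /(_ P3 setT (fun c => ball c e)).
case; first by move=> c _; exact: ball_open.
  by move=> z _; exists z => //; exact: ballxx.
move=> D _ DK; exists (finmap.enum_fset D) => z /DK[c /= cD cz].
by exists c.
Qed.

Lemma unbounded_split A (B : nat -> Prop) : unbounded_set A ->
  unbounded_set (A `&` [set n | B n]) \/ unbounded_set (A `&` [set n | ~ B n]).
Proof.
move=> uA; apply: contrapT => /not_orP[/existsNP[N HN] /existsNP[M HM]].
have [n nNM An] := uA (N + M)%N.
have [Bn|nBn] := pselect (B n).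
  by apply: HN; exists n => //; exact: leq_trans (leq_addr _ _) nNM.
by apply: HM; exists n => //; exact: leq_trans (leq_addl _ _) nNM.
Qed.

(** Pigeonhole over a finite [e / 2]-net: ball by ball, keep infinitely many indices whose sets all
    hit it or all miss it. The surviving sets hit the same balls. *)
Lemma unbounded_refine P K (e : R) A : compact K -> (forall n, P n `<=` K) -> 0 < e ->
  unbounded_set A -> exists A', [/\ A' `<=` A, unbounded_set A' &
    forall i j, A' i -> A' j -> within_radius e (P i) (P j)].
Proof.
move=> cK PK e0 uA; have e20 : 0 < e / 2 by rewrite divr_gt0.
have [l Hl] := finite_net e20 cK.
pose hit c n := exists2 p, P n p & ball c (e / 2) p.
have [A' [A'A uA' HA']] : exists A', [/\ A' `<=` A, unbounded_set A' &
    forall c, c \in l -> (forall n, A' n -> hit c n) \/ (forall n, A' n -> ~ hit c n)].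
  elim: l {Hl} => [|c l [A' [A'A uA' HA']]]; first by exists A; split => // c; rewrite in_nil.
  have [u|u] := unbounded_split (hit c) uA'.
    exists (A' `&` [set n | hit c n]); split => // [n [/A'A]//|c'].
    rewrite inE => /orP[/eqP -> |/HA' H]; first by left => n [].
    by case: H => H; [left|right] => n [/H].
  exists (A' `&` [set n | ~ hit c n]); split => // [n [/A'A]//|c'].
  rewrite inE => /orP[/eqP -> |/HA' H]; first by right => n [].
  by case: H => H; [left|right] => n [/H].
exists A'; split => // i j Ai Aj p Pp.
have [c cl cp] := Hl p (PK i p Pp).
case: (HA' c cl) => [/(_ j Aj)[q Pq cq]|/(_ i Ai) nh]; last by exfalso; apply: nh; exists p.
by exists q => //; rewrite [e]splitr; apply: ball_triangle cq; exact: ball_sym.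
Qed.

Lemma cauchy_subsequence P K : compact K -> (forall n, P n `<=` K) ->
  exists phi : nat -> nat, (forall i j, (i < j)%N -> (phi i < phi j)%N) /\
    forall e : R, 0 < e -> exists N, forall i j, (N <= i)%N -> (N <= j)%N ->
      within_radius e (P (phi i)) (P (phi j)).
Proof.
move=> cK PK.
(* A state is an infinite index set with a chosen member. The next refinement uses mesh
   [1 / (n + 1)] for the chosen index [n]; as these indices strictly increase, the meshes tend to
   0. *)
pose X := {s : set nat * nat | unbounded_set s.1 /\ s.1 s.2}.
pose S (s s' : X) := [/\ (sval s').1 `<=` (sval s).1, ((sval s).2 < (sval s').2)%N &
  forall i j, (sval s').1 i -> (sval s').1 j -> within_radius ((sval s).2.+1%:R)^-1 (P i) (P j)].
have step (s : X) : {s' : X | S s s'}.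
  apply: cid; case: s => [[A n] /= [uA An]].
  have inv0 : 0 < (n.+1%:R : R)^-1 by rewrite invr_gt0.
  have [A' [A'A uA' HA']] := unbounded_refine cK PK inv0 uA.
  have [n' nn' An'] := uA' n.+1.
  by exists (exist _ (A', n') (conj uA' An')); split.
have u0 : unbounded_set setT by move=> N; exists N.
have [f [f0 fS]] := dependent_choice step (exist _ (setT, 0%N) (conj u0 I) : X).
have mono i j : (i <= j)%N -> (sval (f j)).1 `<=` (sval (f i)).1.
  move=> /subnK <-; elim: (j - i)%N => [//|d IH]; rewrite addSn.
  by case: (fS (d + i)%N) => H _ _; exact: subset_trans H IH.
have incr i j : (i < j)%N -> ((sval (f i)).2 < (sval (f j)).2)%N.
  elim: j => [//|j IH]; rewrite ltnS leq_eqVlt => /orP[/eqP ->|/IH lt].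
    by case: (fS j).
  by apply: (ltn_trans lt); case: (fS j).
have ge i : (i <= (sval (f i)).2)%N.
  elim: i => [//|i IH]; apply: (leq_ltn_trans IH); exact: incr.
exists (fun i => (sval (f i)).2); split => // e e0.
pose N := Num.bound e^-1.
exists N.+1 => i j Ni Nj p Pp.
have mem k : (N.+1 <= k)%N -> (sval (f N.+1)).1 (sval (f k)).2.
  by move=> Nk; apply: (mono _ _ Nk); case: (f k) => [[? ?] []].
have [_ _ H] := fS N.
have [q Pq pq] := H _ _ (mem i Ni) (mem j Nj) p Pp.
exists q => //; apply: le_ball pq.
have NB : e^-1 < N%:R by apply: archi_boundP; rewrite invr_ge0 ltW.
rewrite -[e]invrK lef_pV2 ?posrE ?invr_gt0 //.
apply/ltW/(lt_le_trans NB); rewrite ler_nat; apply: leq_trans (ge N) _; exact: leqnSn.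
Qed.

(* The limit is the set of cluster points of a subsequence that is Cauchy for the Hausdorff
   distance. *)
Lemma hausdorff_subsequence P K : compact K -> closed K -> (forall n, P n `<=` K) ->
  exists (phi : nat -> nat) L, [/\ forall i j, (i < j)%N -> (phi i < phi j)%N,
    hausdorff_cvg (P \o phi) L & L `<=` K].
Proof.
move=> cK clK PK; have [phi [mono Hphi]] := cauchy_subsequence cK PK.
pose Q n := P (phi n); have QK n : Q n `<=` K by exact: PK.
pose L := [set q | forall e : R, 0 < e -> forall N, exists2 n, (N <= n)%N & exists2 p, Q n p & ball q e p].
have LK : L `<=` K.
  move=> q Lq; apply: clK => B /nbhs_ballP[e /= e0 eB].
  by have [n _ [p Qp /eB Bp]] := Lq e e0 0%N; exists p; split => //; exact: QK Qp.
exists phi, L; split => //; split.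
  move=> q clq e e0 N; have e20 : 0 < e / 2 by rewrite divr_gt0.
  have [q' [Lq' qq']] := clq _ (nbhsx_ballx q _ e20).
  have [n Nn [p Qp q'p]] := Lq' _ e20 N.
  by exists n => //; exists p => //; rewrite [e]splitr; exact: ball_triangle qq' q'p.
move=> e e0; have e20 : 0 < e / 2 by rewrite divr_gt0.
have [N HN] := Hphi _ e20.
exists N => // n /= Nn; split; last first.
  move=> q Lq; have [m Nm [p Qp qp]] := Lq _ e20 N.
  have [p' Qp' pp'] := HN m n Nm Nn p Qp.
  by exists p' => //; rewrite [e]splitr; exact: ball_triangle qp pp'.
move=> p Qp; apply: contrapT => nL.
(* Without limit points near [p], compactness yields one index, encoded as the inverse of [d],
   beyond which no [Q m] meets the ball around [p]. This contradicts the Cauchy property. *)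
have [d d0 Hd] : exists2 d : R, 0 < d & forall z, K z -> ball p (e / 2) z -> forall m, d^-1 <= m%:R -> ~ Q m z.
  apply: (@compact_uniform _ _ K (fun d z => ball p (e / 2) z -> forall m, d^-1 <= m%:R -> ~ Q m z)) => //.
    move=> d d' z d'0 dd' H bz m md; apply: H => //; apply: le_trans md.
    by rewrite lef_pV2 // posrE (lt_le_trans d'0).
  move=> z Kz; have [bz|nbz] := pselect (ball p e z); last first.
    exists (e / 2) => // z' Kz' zz' pz' m _ _; apply: nbz.
    by rewrite [e]splitr; apply: ball_triangle pz' (ball_sym zz').
  have : ~ L z by move=> Lz; apply: nL; exists z.
  move=> /existsNP[d /not_implyP[d0 /existsNP[M HM]]].
  exists (Num.min d M.+1%:R^-1); first by rewrite lt_min d0 invr_gt0 ltr0Sn.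
  move=> z' Kz' zz' pz' m md Qz'; apply: HM; exists m; last first.
    by exists z' => //; apply: le_ball zz'; rewrite ge_min lexx.
  apply: ltnW; rewrite -(ler_nat R); apply: le_trans md.
  rewrite -[leLHS]invrK lef_pV2 ?posrE ?invr_gt0 ?lt_min ?d0 ?invr_gt0 ?ltr0Sn //.
  by rewrite ge_min lexx orbT.
pose M := Num.bound d^-1.
have MB : d^-1 < M%:R by apply: archi_boundP; rewrite invr_ge0 ltW.
have [q Qq pq] := HN n (N + M)%N Nn (leq_addr _ _) p Qp.
apply: (Hd q (QK _ _ Qq) pq (N + M)%N) => //.
by apply: (le_trans (ltW MB)); rewrite ler_nat leq_addl.
Qed.

Lemma hausdorff_cvg_meets P L J : hausdorff_cvg P L -> compact J ->
  (forall n, P n `&` J !=set0) -> L `&` J !=set0.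
Proof.
move=> [clL cv] cJ PJ; apply: contrapT => nLJ.
have [e e0 He] : exists2 e : R, 0 < e & forall z, J z -> forall q, L q -> ~ ball z e q.
  apply: compact_uniform => //.
    by move=> d d' z _ dd' H q Lq bq; apply: (H q Lq); exact: le_ball bq.
  move=> z Jz; have : open (~` L) by exact: closed_openC.
  have nLz : (~` L) z by move=> Lz; apply: nLJ; exists z.
  rewrite openE => /(_ z nLz) /nbhs_ballP[d /= d0 Hd]; exists (d / 2); first by rewrite divr_gt0.
  move=> z' Jz' zz' q Lq z'q; apply: (Hd q) => //.
  by rewrite [d]splitr; exact: ball_triangle zz' z'q.
have [N _ HN] := cv e e0.
have [p [Pp Jp]] := PJ N.
have [/(_ p Pp)[q Lq pq] _] := HN N (leqnn N).
exact: (He p Jp q Lq pq).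
Qed.

Lemma infinite_injection (T : Type) (A : set T) : ~ finite_set A ->
  exists f : nat -> T, injective f /\ forall n, A (f n).
Proof.
move=> /infiniteP/card_leP[f].
exists (fun n => sval (f (exist _ n (mem_set I)))); split.
  move=> m n /val_inj E.
  have := 'inj_f (mem_set I) (mem_set I) E.
  by move=> /(congr1 sval).
by move=> n; apply/set_mem; exact: (svalP (f _)).
Qed.
End HausdorffSelection.

(** * Apollonius circles on the sphere *)

Section ApolloniusCircles.
Variable R : realType.
Local Notation plane := (R * R)%type.
Local Notation P3 := 'rV[R]_3.
Implicit Types (p q x y : P3) (z : plane) (r : R).

(* The sign of [gap r x y] tells on which side of the circle |p - x|^2 = r |p - y|^2 of the
   sphere the point [p] lies. *)
Definition gap r x y p := (1 - dot p x) - r * (1 - dot p y).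
Definition apollonius_circle r x y := [set p : P3 | sphere p /\ gap r x y p = 0].
Definition apollonius_band r x y := [set p : P3 | [/\ sphere p, 0 < gap r x y p & 0 < gap r y x p]].

Lemma gap_continuous r x y : continuous (gap r x y).
Proof.
move=> p; have c q : {for p, continuous (fun u => 1 - dot u q)}.
  exact: (cvgB (cvg_cst _) (@dot_continuous R q p)).
exact: (cvgB (c x) (cvgMl_tmp (c y))).
Qed.

Lemma open_gap_gt r x y (c : R) : open [set p | c < gap r x y p].
Proof. by apply: (open_comp (f := gap r x y)) (@open_gt R c) => p _; exact: gap_continuous. Qed.

Lemma open_gap_lt r x y (c : R) : open [set p | gap r x y p < c].
Proof. by apply: (open_comp (f := gap r x y)) (@open_lt R c) => p _; exact: gap_continuous. Qed.

Lemma closed_gap_ge r x y (c : R) : closed [set p | c <= gap r x y p].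
Proof. by apply: (preimage_closed (f := gap r x y)) (@closed_ge R c) => p _; exact: gap_continuous. Qed.

Lemma closed_gap_le r x y (c : R) : closed [set p | gap r x y p <= c].
Proof. by apply: (preimage_closed (f := gap r x y)) (@closed_le R c) => p _; exact: gap_continuous. Qed.

Lemma sphere_closed : closed (@sphere R).
Proof.
have -> : @sphere R = [set p | dot p p = 1] by apply/seteqP; split=> p /sphereE.
have c : continuous (fun p : P3 => dot p p).
  move=> p; have cc k := @coord_continuous3 R k p.
  exact: (cvgD (cvgD (cvgM (cc 0%N) (cc 0%N)) (cvgM (cc 1%N) (cc 1%N))) (cvgM (cc 2%N) (cc 2%N))).
by apply: (preimage_closed (f := fun p : P3 => dot p p)) (@closed_eq R 1) => p _; exact: c.
Qed.

Lemma dot_le1 p q : sphere p -> sphere q -> dot p q <= 1.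
Proof.
move=> Sp Sq; have [->|/(dot_lt1 Sp Sq)/ltW //] := pselect (p = q).
by move/sphereE: Sq => ->.
Qed.

Lemma sphere_ball p x (e : R) : 0 < e -> sphere p -> sphere x -> 2 * (1 - dot p x) < e ^+ 2 -> ball x e p.
Proof.
move=> e0 /sphereE Sp /sphereE Sx H; apply/row_ballE; split => // j.
have E : (coord3 0 x - coord3 0 p) ^+ 2 + (coord3 1 x - coord3 1 p) ^+ 2 + (coord3 2 x - coord3 2 p) ^+ 2 = 2 * (1 - dot p x).
  transitivity (dot p p + dot x x - 2 * dot p x); first by rewrite /dot; ring.
  by rewrite Sp Sx; ring.
have s0 := sqr_ge0 (coord3 0 x - coord3 0 p); have s1 := sqr_ge0 (coord3 1 x - coord3 1 p).
have s2 := sqr_ge0 (coord3 2 x - coord3 2 p).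
have : (x ord0 j - p ord0 j) ^+ 2 < e ^+ 2.
  have [m m3 ->] : exists2 m, (m < 3)%N & j = inord m by exists j => //; rewrite inord_val.
  by case: m m3 => [|[|[|//]]] _; rewrite -!/(coord3 _ _); lra.
by rewrite -[(_ - _) ^+ 2]real_normK ?num_real // ltr_pXn2r ?nnegrE ?normr_ge0 ?ltW.
Qed.

Lemma sigma_circle (sigma : plane -> P3) (a : R) : 0 < a -> continuous sigma -> injective sigma ->
  (forall z, sphere (sigma z)) -> simple_closed_curve (sigma @` [set z | nsq z = a]).
Proof.
move=> a0 cs inj Ss; pose w := Num.sqrt a; have w0 : 0 < w by rewrite sqrtr_gt0.
have w2 : w ^+ 2 = a by rewrite sqr_sqrtr // ltW.
pose i0 : 'I_2 := ord0; pose i1 : 'I_2 := lift ord0 ord0.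
pose g (c : 'rV[R]_2) : plane := (w * c ord0 i0, w * c ord0 i1).
have circE c : @circle R c <-> c ord0 i0 ^+ 2 + c ord0 i1 ^+ 2 = 1.
  by rewrite /circle /= !big_ord_recl big_ord0 addr0.
have im : (sigma \o g) @` @circle R = sigma @` [set z | nsq z = a].
  apply/seteqP; split=> [_ [c /circE C <-]|_ [z /= za <-]].
    by exists (g c) => //=; rewrite /nsq /g /= !exprMn -mulrDr C mulr1.
  exists (\row_j (if j == i0 then z.1 / w else z.2 / w)).
    by apply/circE; rewrite !mxE /= !expr_div_n w2 -mulrDl -/(nsq z) za divff ?gt_eqF.
  have D u : w * (u / w) = u by rewrite mulrC divfK // gt_eqF.
  by rewrite /= /g !mxE /= !D -surjective_pairing.
exists (sigma \o g); split.
- apply: continuous_subspaceT => c; apply: continuous_comp; last exact: cs.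
  have cc j := @coord_continuous R 1 2 ord0 j c.
  exact: (cvg_pair_point (cvgMl_tmp (cc i0)) (cvgMl_tmp (cc i1))).
- move=> c d _ _ /inj[/(mulfI (lt0r_neq0 w0)) E0 /(mulfI (lt0r_neq0 w0)) E1].
  apply/rowP => j; have ji : j = i0 \/ j = i1.
    by case: j => [[|[|//]] Hj]; [left|right]; exact: val_inj.
  by case: ji => ->; [exact: E0|exact: E1].
- by rewrite im => _ [z _ <-]; exact: Ss.
- by rewrite im.
Qed.

(** Every circle in the annulus meets one fixed radial segment, so the annulus is a union of
    connected sets through [c]. *)
Lemma connected_annulus (a b : R) : 0 < a -> a < b -> connected [set z : plane | a < nsq z < b].
Proof.
move=> a0 ab; pose ray := [set z : plane | [/\ a < nsq z < b, z.2 = 0 & 0 < z.1]].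
pose c : plane := (Num.sqrt ((a + b) / 2), 0).
have b0 : 0 < b by lra.
have nc : nsq c = (a + b) / 2 by rewrite /nsq /= expr0n addr0 sqr_sqrtr //; lra.
have rc : ray c by split => //=; [rewrite nc; lra|rewrite sqrtr_gt0; lra].
have cray : connected ray.
  apply: (@star_connected R _ c rc) => p t [np p2 p1] /andP[t0 t1].
  have E : (seg c p t).2 = 0 by rewrite /seg /= p2; ring.
  have s1 : 0 < (seg c p t).1.
    by rewrite /seg /=; apply: convex_gt0 => //; case: rc.
  have np' : a < p.1 ^+ 2 < b by move: np; rewrite /nsq p2 expr0n addr0.
  have nc' : a < c.1 ^+ 2 < b by move: nc; rewrite /nsq /= expr0n addr0 => ->; lra.
  split => //; rewrite /nsq E expr0n addr0.
  have c1 : 0 < c.1 by case: rc.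
  move: np' nc' p1 c1 s1; rewrite /seg /=; move: p.1 (Num.sqrt _) => u v /andP[u1 u2] /andP[v1 v2] u0 v0 s0.
  have [uv|vu] := leP u v.
    have l1 : u <= v + t * (u - v) by nra.
    have l2 : v + t * (u - v) <= v by nra.
    by apply/andP; split; nra.
  have l1 : v <= v + t * (u - v) by nra.
  have l2 : v + t * (u - v) <= u by nra.
  by apply/andP; split; nra.
pose circ (s : R) := ray `|` (fun t => (s * (cis t).1, s * (cis t).2) : plane) @` `[- 1, 1].
have -> : [set z : plane | a < nsq z < b] = \bigcup_(s in [set s | 0 < s /\ a < s ^+ 2 < b]) circ s.
  apply/seteqP; split=> [z /= nz|z [s [s0 sab]]].
    have n0 : 0 < nsq z by lra.
    have sn : 0 < Num.sqrt (nsq z) by rewrite sqrtr_gt0.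
    have s2 : Num.sqrt (nsq z) ^+ 2 = nsq z by rewrite sqr_sqrtr // ltW.
    have [|t t1 tE] := @cis_surj R (z.1 / Num.sqrt (nsq z)) (z.2 / Num.sqrt (nsq z)).
      by rewrite !expr_div_n -mulrDl s2 divff // gt_eqF.
    exists (Num.sqrt (nsq z)); first by rewrite /= s2.
    right; exists t; first by rewrite /= in_itv.
    have D u : Num.sqrt (nsq z) * (u / Num.sqrt (nsq z)) = u by rewrite mulrC divfK // gt_eqF.
    by rewrite tE /= !D -surjective_pairing.
  case=> [[]//|[t _ <-]] /=.
  rewrite (_ : nsq _ = s ^+ 2 * nsq (cis t)); last by rewrite /nsq /=; ring.
  by rewrite (_ : nsq (cis t) = 1) ?mulr1 //; exact: cis_norm.
apply: bigcup_connected; first by exists c => s _; left.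
move=> s [s0 /andP[sa sb]]; apply: connectedU => //.
  exists (s, 0); split.
    split => //=; rewrite /nsq /= expr0n addr0; lra.
  exists 0; first by rewrite /= in_itv /=; lra.
  by rewrite /cis !mulr0 cos0 sin0 /= mulr1 mulr0.
apply: connected_continuous_connected; first exact: segment_connected.
apply: continuous_subspaceT => t.
have cc := @cis_continuous R t.
apply: cvg_pair_point; apply: cvgMl_tmp.
  exact: (continuous_comp cc (@continuous_fst R _)).
exact: (continuous_comp cc (@continuous_snd R _)).
Qed.

Section Chart.
Variables (x y : P3) (r : R).
Hypotheses (Sx : sphere x) (Sy : sphere y) (xy : x <> y) (r0 : 0 < r) (r1 : r < 1).

(** In the chart projecting from [y], the two circles are centred at the origin with squared radii
    [r * k] and [k / r], and the band is the annulus between them. *)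
Lemma chart_gap : exists (Psi : P3 -> plane) (sigma : plane -> P3) (k : R),
  [/\ 0 < k, continuous sigma, forall z, sphere (sigma z), injective sigma &
     forall p, sphere p -> p <> y -> sigma (Psi p) = p] /\
  [/\ forall z, (0 < gap r x y (sigma z)) = (r * k < nsq z),
      forall z, (gap r x y (sigma z) = 0) <-> nsq z = r * k &
      forall z, (0 < gap r y x (sigma z)) = (nsq z < k / r)].
Proof.
have [Psi [sigma [k [[k0 cs Ss Ps] [sP cP nP]]]]] := sphere_chart Sx Sy xy.
exists Psi, sigma, k; split.
  split => //; first by move=> z; case: (Ss z).
  by move=> z w E; rewrite -(Ps z) E Ps.
have w0 z : 0 < 1 - dot (sigma z) y.
  by rewrite subr_gt0; apply: dot_lt1 => //; case: (Ss z).
have E z : k * (1 - dot (sigma z) x) = nsq z * (1 - dot (sigma z) y).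
  by case: (Ss z) => S1 S2; rewrite -nP // Ps.
have E1 z : k * gap r x y (sigma z) = (1 - dot (sigma z) y) * (nsq z - r * k).
  by rewrite /gap mulrBr E; ring.
have E2 z : k * gap r y x (sigma z) = (1 - dot (sigma z) y) * (k - r * nsq z).
  by rewrite /gap mulrBr (mulrCA k r) E; ring.
split=> z.
- by rewrite -(pmulr_rgt0 _ k0) E1 pmulr_rgt0 // subr_gt0.
- split=> [g0|n0].
    move: (E1 z); rewrite g0 mulr0 => /esym/eqP; rewrite mulf_eq0 (gt_eqF (w0 z)) /= subr_eq0.
    by move/eqP.
  move: (E1 z); rewrite n0 subrr mulr0 => /eqP; rewrite mulf_eq0 (gt_eqF k0) /=.
  by move/eqP.
- by rewrite -(pmulr_rgt0 _ k0) E2 pmulr_rgt0 // subr_gt0 ltr_pdivlMr // mulrC.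
Qed.

Lemma gap_pole : 0 < gap r x y y.
Proof. by have := dot_lt1 Sx Sy xy; have /sphereE := Sy; rewrite /gap (dotC y x) => -> ; lra. Qed.

Lemma gap_pole' : gap r y x y < 0.
Proof.
have := dot_lt1 Sx Sy xy; have /sphereE := Sy; rewrite /gap (dotC y x) => -> H.
by rewrite subrr sub0r oppr_lt0 mulr_gt0 // subr_gt0.
Qed.

Lemma apollonius_circle_simple : simple_closed_curve (apollonius_circle r x y).
Proof.
have [Psi [sigma [k [[k0 cs Ss inj sP] [_ gE _]]]]] := chart_gap.
have -> : apollonius_circle r x y = sigma @` [set z | nsq z = r * k].
  apply/seteqP; split=> [p [Sp gp]|_ [z /= nz <-]]; last by split => //; apply/gE.
  have py : p <> y by move=> E; move: gp; rewrite E => gp; move: gap_pole; rewrite gp ltxx.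
  by exists (Psi p); [apply/gE; rewrite sP|exact: sP].
by apply: sigma_circle => //; rewrite mulr_gt0.
Qed.

Lemma apollonius_band_chart : exists (sigma : plane -> P3) (k : R),
  [/\ 0 < k, continuous sigma, forall z, sphere (sigma z) &
    apollonius_band r x y = sigma @` [set z | r * k < nsq z < k / r]].
Proof.
have [Psi [sigma [k [[k0 cs Ss inj sP] [g1 _ g2]]]]] := chart_gap.
exists sigma, k; split => //; apply/seteqP; split=> [p [Sp gp gp']|_ [z /= /andP[n1 n2] <-]].
  have py : p <> y by move=> E; move: gp'; rewrite E; have := gap_pole'; lra.
  by exists (Psi p); [rewrite /= -g1 -g2 sP // gp gp'|exact: sP].
by split => //; rewrite ?g1 ?g2.
Qed.

Lemma apollonius_band_connected : connected (apollonius_band r x y).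
Proof.
have [sigma [k [k0 cs _ ->]]] := apollonius_band_chart.
apply: connected_continuous_connected; last exact: continuous_subspaceT.
apply: connected_annulus; first by rewrite mulr_gt0.
have rr : r * r < 1 by move: r0 r1 => ? ?; nra.
by rewrite ltr_pdivlMr // mulrAC gtr_pMl.
Qed.

Lemma apollonius_band_nonempty : apollonius_band r x y !=set0.
Proof.
have [sigma [k [k0 cs _ ->]]] := apollonius_band_chart.
exists (sigma (Num.sqrt k, 0)), (Num.sqrt k, 0) => //=.
rewrite /nsq /= expr0n addr0 sqr_sqrtr ?ltW // gtr_pMl // r1 /= ltr_pdivlMr // gtr_pMr //.
Qed.

Lemma closure_band_circle p : apollonius_circle r x y p -> closure (apollonius_band r x y) p.
Proof.
move=> [Sp gp]; have r0' := r0; have r1' := r1.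
have [Psi [sigma [k [[k0 cs Ss inj sP] [g1 gE g2]]]]] := chart_gap.
have py : p <> y by move=> E; move: gp; rewrite E => gp; move: gap_pole; rewrite gp ltxx.
have nP : nsq (Psi p) = r * k by apply/gE; rewrite sP.
move=> B nB; have /nbhs_ballP[e /= e0 He] : nbhs (Psi p) (sigma @^-1` B).
  by apply: cs; rewrite sP.
pose z := Psi p; have n1 := normr_ge0 z.1; have n2 := normr_ge0 z.2.
have den : 0 < 2 * (1 + `|z.1| + `|z.2|) by lra.
(* The image of [p] is pushed outward by the factor [1 + t]: the first bound keeps it within [e],
   the second keeps it inside the outer circle. *)
pose t := Num.min (e / (2 * (1 + `|z.1| + `|z.2|))) ((1 - r) / 4).
have t0 : 0 < t by rewrite lt_min !divr_gt0 //; lra.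
have [te tr] : t <= e / (2 * (1 + `|z.1| + `|z.2|)) /\ t <= (1 - r) / 4 by rewrite !ge_min !lexx orbT.
have {}te : t * (2 * (1 + `|z.1| + `|z.2|)) <= e by rewrite -ler_pdivlMr.
pose z' : plane := ((1 + t) * z.1, (1 + t) * z.2).
have nz' : nsq z' = (1 + t) ^+ 2 * (r * k) by rewrite -nP -/z /nsq /=; ring.
have rk : 0 < r * k by rewrite mulr_gt0.
exists (sigma z'); split; last first.
  apply: He; have small (c : R) : `|c - (1 + t) * c| = t * `|c|.
    have -> : c - (1 + t) * c = - (t * c) by ring.
    by rewrite normrN normrM (gtr0_norm t0).
  by apply/plane_ballE; rewrite /= !small; split; nra.
split; [exact: Ss|rewrite g1 nz' ltr_pMl //; nra|].
rewrite g2 nz' ltr_pdivlMr //.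
have -> : (1 + t) ^+ 2 * (r * k) * r = ((1 + t) * r) ^+ 2 * k by ring.
rewrite gtr_pMl //; have l1 : 0 < (1 + t) * r by rewrite mulr_gt0 //; lra.
have l2 : (1 + t) * r < 1 by nra.
nra.
Qed.
End Chart.

Lemma closure_band x y r : sphere x -> sphere y -> x <> y -> 0 < r -> r < 1 ->
  closure (apollonius_band r x y) = [set p | [/\ sphere p, 0 <= gap r x y p & 0 <= gap r y x p]].
Proof.
move=> Sx Sy xy r0 r1; apply/seteqP; split=> [p clp|p [Sp g1 g2]].
  split.
  - by apply: sphere_closed; apply: closureS clp => q [].
  - by apply: (@closed_gap_ge r x y 0); apply: closureS clp => q [_ /ltW].
  - by apply: (@closed_gap_ge r y x 0); apply: closureS clp => q [_ _ /ltW].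
have [E|n1] := eqVneq (gap r x y p) 0; first exact: closure_band_circle.
have [E|n2] := eqVneq (gap r y x p) 0.
  have : closure (apollonius_band r y x) p.
    by apply: closure_band_circle => // E'; apply: xy.
  by apply: closureS => q [].
by apply: subset_closure; split => //; rewrite lt_neqAle eq_sym ?n1 ?n2.
Qed.

Lemma apollonius_U_between x y r : sphere x -> sphere y -> x <> y -> 0 < r -> r < 1 ->
  U_between (apollonius_circle r x y) (apollonius_circle r y x) (apollonius_band r x y).
Proof.
move=> Sx Sy xy r0 r1; split.
  have [z0 Uz] := apollonius_band_nonempty Sx Sy xy r0 r1.
  have Usub : apollonius_band r x y `<=` @sphere R `\` (apollonius_circle r x y `|` apollonius_circle r y x).
    by move=> p [Sp g1 g2]; split => // -[] [_ E]; [move: g1|move: g2]; rewrite E ltxx.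
  exists z0; first exact: Usub.
  apply/seteqP; split.
    by apply: connected_component_max => //; exact: apollonius_band_connected.
  move=> p zp.
  (* Off the two circles neither gap vanishes, so its sign is constant on a component. *)
  have sgn (a b : P3) : (forall q, connected_component (@sphere R `\` (apollonius_circle r x y `|` apollonius_circle r y x)) z0 q ->
      gap r a b q != 0) -> 0 < gap r a b z0 -> 0 < gap r a b p.
    move=> ne; apply: (@connected_loc_const _ _ (fun q => 0 < gap r a b q)
      (component_connected (A := @sphere R `\` (apollonius_circle r x y `|` apollonius_circle r y x)) (x := z0)) _ _ _ _ zp).
      move=> q /ne; case: (ltgtP (gap r a b q) 0) => // gq _.
        have := @open_gap_lt r a b 0; rewrite openE => /(_ q gq); apply: filterS => u /= gu _.
        by split; lra.
      have := @open_gap_gt r a b 0; rewrite openE => /(_ q gq); apply: filterS => u /= gu _.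
      by split.
    by apply: connected_component_refl; exact: Usub.
  have [Sp _] := connected_component_sub zp.
  case: Uz => _ g1 g2; split => //; apply: sgn => // q /connected_component_sub[Sq nq].
    by apply/eqP => E; apply: nq; left.
  by apply/eqP => E; apply: nq; right.
rewrite closure_band //; apply/seteqP; split=> [p [[Sp g1 g2] nU]|p].
  have [E|n1] := eqVneq (gap r x y p) 0; first by left.
  have [E|n2] := eqVneq (gap r y x p) 0; first by right.
  by exfalso; apply: nU; split => //; rewrite lt_neqAle eq_sym ?n1 ?n2.
have other (a b : P3) : sphere a -> sphere b -> a <> b -> apollonius_circle r a b p -> 0 < gap r b a p.
  move=> Sa Sb ab [Sp]; rewrite /gap.
  have d1 := dot_le1 Sp Sa; have d2 := dot_le1 Sp Sb.
  have [pb|pb] := pselect (p = b).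
    have := dot_lt1 Sb Sa (fun E => ab (esym E)); rewrite pb; have /sphereE -> := Sb; nra.
  by have := dot_lt1 Sp Sb pb; nra.
have yx : y <> x by move=> E; apply: xy.
move=> [Jp|Jp].
  have := other _ _ Sx Sy xy Jp; case: Jp => Sp E g2; split; first by split; rewrite ?E // ltW.
  by move=> [_]; rewrite E ltxx.
have := other _ _ Sy Sx yx Jp; case: Jp => Sp E g2; split; first by split; rewrite ?E // ltW.
by move=> [_ _]; rewrite E ltxx.
Qed.
End ApolloniusCircles.

(** * From S(x) to the Schönflies relation *)

Section SToSchoenflies.
Variable R : realType.
Local Notation P3 := 'rV[R]_3.
Implicit Types (K : set P3) (p q x y : P3) (r : R).

Lemma dot_geN1 p q : sphere p -> sphere q -> - 1 <= dot p q.
Proof.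
move=> /sphereE Sp /sphereE Sq.
have s0 := sqr_ge0 (coord3 0 p + coord3 0 q); have s1 := sqr_ge0 (coord3 1 p + coord3 1 q).
have s2 := sqr_ge0 (coord3 2 p + coord3 2 q).
have : (coord3 0 p + coord3 0 q) ^+ 2 + (coord3 1 p + coord3 1 q) ^+ 2 + (coord3 2 p + coord3 2 q) ^+ 2
    = 2 + 2 * dot p q.
  transitivity (dot p p + dot q q + 2 * dot p q); first by rewrite /dot; ring.
  by rewrite Sp Sq; ring.
by lra.
Qed.

(** A nonpositive gap gives [1 - dot p x <= 2 * r], so the squared distance to [x] is at most
    [4 * r]; the constant 8 makes this strictly less than [e ^+ 2]. *)
Lemma gap_le0_ball r x y p (e : R) : 0 < e -> 0 < r -> 8 * r <= e ^+ 2 ->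
  sphere x -> sphere y -> sphere p -> gap r x y p <= 0 -> ball x e p.
Proof.
move=> e0 r0 re Sx Sy Sp; rewrite /gap => g; apply: sphere_ball => //.
have := dot_geN1 Sp Sy => d; have e2 : 0 < e ^+ 2 by rewrite exprn_gt0.
have : r * (1 - dot p y) <= r * 2 by rewrite ler_pM2l //; lra.
by lra.
Qed.

Lemma gap_disjoint r x y p : 0 < r -> r < 1 -> sphere x -> sphere y -> x <> y -> sphere p ->
  gap r x y p <= 0 -> 0 < gap r y x p.
Proof.
move=> r0 r1 Sx Sy xy Sp; rewrite /gap => g.
have d1 := dot_le1 Sp Sx; have d2 := dot_le1 Sp Sy.
have [py|py] := pselect (p = y).
  have := dot_lt1 Sy Sx (fun E => xy (esym E)); move: g; rewrite py; have /sphereE -> := Sy.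
  by rewrite subrr mulr0; lra.
have d3 := dot_lt1 Sp Sy py; nra.
Qed.

Lemma gap_self r x y : 0 < r -> sphere x -> sphere y -> x <> y -> gap r x y x < 0.
Proof.
move=> r0 Sx Sy xy; have := dot_lt1 Sx Sy xy; rewrite /gap; have /sphereE -> := Sx.
by rewrite subrr sub0r oppr_lt0 => ?; rewrite mulr_gt0 // subr_gt0.
Qed.

Lemma rel_boundary_gap K r x y : K `<=` @sphere R -> closed K ->
  rel_boundary K ([set p | gap r x y p < 0] `&` K) `<=` apollonius_circle r x y.
Proof.
move=> KS clK p [[clp Kp] np]; split; first exact: KS.
have g1 : gap r x y p <= 0.
  by apply: (@closed_gap_le R r x y 0); apply: closureS clp => q [/ltW].
by apply/eqP; rewrite eq_le g1 leNgt; apply/negP => g2; apply: np.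
Qed.

Lemma closed_apollonius_circle r x y : closed (apollonius_circle r x y).
Proof.
have -> : apollonius_circle r x y = @sphere R `&` ([set p | 0 <= gap r x y p] `&` [set p | gap r x y p <= 0]).
  apply/seteqP; split=> [p [Sp E]|p [Sp [/= g1 g2]]]; first by rewrite /= E lexx.
  by split => //; apply/eqP; rewrite eq_le g2.
apply: closedI; first exact: sphere_closed.
by apply: closedI; [exact: closed_gap_ge|exact: closed_gap_le].
Qed.

Lemma S_set_sub_closure K x y : compact K -> K `<=` @sphere R -> K x -> S_set K x y ->
  closure (schoenflies_rel K) (x, y).
Proof.
move=> cK KS Kx [Ky nsep].
have [<-|xy] := pselect (x = y).
  by apply: subset_closure; split => //; split => //; left.
move=> B /nbhs_ballP[e /= e0 He].
pose r := Num.min (1 / 2) (e ^+ 2 / 8).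
have e2 : 0 < e ^+ 2 by rewrite exprn_gt0.
have r0 : 0 < r by rewrite lt_min !divr_gt0.
have [r2 re] : r <= 1 / 2 /\ r <= e ^+ 2 / 8 by rewrite !ge_min !lexx orbT.
have r1 : r < 1 by lra.
have {}re : 8 * r <= e ^+ 2 by lra.
have Sx := KS x Kx; have Sy := KS y Ky.
have yx : y <> x by move=> E; exact: xy.
have clK : closed K by apply: compact_closed cK; exact: norm_hausdorff.
pose Ux := [set p | gap r x y p < 0] `&` K; pose Uy := [set p | gap r y x p < 0] `&` K.
set J1 := apollonius_circle r x y; set J2 := apollonius_circle r y x.
set U := apollonius_band r x y.
have inf : ~ finite_set [set C | components (K `\` (Ux `|` Uy)) C /\
    C `&` rel_boundary K Ux !=set0 /\ C `&` rel_boundary K Uy !=set0].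
  move=> fin; apply: nsep; exists Ux, Uy; split.
    split; [by exists [set p | gap r x y p < 0] => //; exact: open_gap_lt
      |by exists [set p | gap r y x p < 0] => //; exact: open_gap_lt|by move=> ? []|by move=> ? []|].
    rewrite -subset0 => p [[/= g1 Kp] [/= g2 _]].
    have := gap_disjoint r0 r1 Sx Sy xy (KS p Kp) (ltW g1); lra.
  by split; [split => //; exact: gap_self|split => //; split => //; exact: gap_self].
have [P [Pinj HP]] := infinite_injection inf.
(* Hence the crossing components in the definition of [S_set] are literally components as required
   by [schoenflies_rel]. *)
have KE : K `\` (Ux `|` Uy) = closure U `&` K.
  rewrite /U closure_band //; apply/seteqP; split=> [p [Kp np]|p [[Sp g1 g2] Kp]].
    split => //; split; [exact: KS|rewrite leNgt; apply/negP => g; apply: np; left; split|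
      rewrite leNgt; apply/negP => g; apply: np; right; split] => //.
  by split => // -[[/= g _]|[/= g _]]; [rewrite leNgt g in g1|rewrite leNgt g in g2].
have PK n : P n `<=` K.
  by case: (HP n) => [[z _ ->] _] p /connected_component_sub[].
have [phi [L [mono cv LK]]] := hausdorff_subsequence cK clK PK.
have meetJ n : (P \o phi) n `&` (J1 `&` K) !=set0 /\ (P \o phi) n `&` (J2 `&` K) !=set0.
  case: (HP (phi n)) => _ [[p [Pp bp]] [q [Pq bq]]]; split.
    by exists p; split => //; split; [exact: rel_boundary_gap bp|exact: PK Pp].
  by exists q; split => //; split; [exact: rel_boundary_gap bq|exact: PK Pq].
have cJ r' x' y' : compact (apollonius_circle r' x' y' `&` K).
  by apply: (subclosed_compact _ cK) => [|? []//]; apply: closedI => //; exact: closed_apollonius_circle.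
have [x' [Lx' [Jx' Kx']]] := hausdorff_cvg_meets cv (cJ r x y) (fun n => (meetJ n).1).
have [y' [Ly' [Jy' Ky']]] := hausdorff_cvg_meets cv (cJ r y x) (fun n => (meetJ n).2).
have J12 : J1 `&` J2 = set0.
  rewrite -subset0 => p [[Sp g1] [_ g2]].
  by have := gap_disjoint r0 r1 Sx Sy xy Sp; rewrite g1 g2 lexx ltxx => /(_ isT).
(* The related pair lies on the circles around [x] and [y], not at the centres; this is why the
   closure of the relation appears. *)
exists (x', y'); split; last first.
  apply: He; split => /=.
    by case: Jx' => Sp g; apply: (gap_le0_ball e0 r0 re Sx Sy) => //; rewrite g.
  by case: Jy' => Sp g; apply: (gap_le0_ball e0 r0 re Sy Sx) => //; rewrite g.
split => //; split => //; right; split => /=.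
  move=> E; have : (J1 `&` J2) x' by split; [exact: Jx'|rewrite E; exact: Jy'].
  by rewrite J12.
  exists J1, J2, U; split; first by split => //; exact: apollonius_circle_simple.
split; first exact: apollonius_U_between.
exists (P \o phi), L; split => //.
- move=> i j /Pinj E; have [ij|ij|//] := ltngtP i j.
    by have := mono _ _ ij; rewrite E ltnn.
  by have := mono _ _ ij; rewrite E ltnn.
- by move=> n; rewrite -KE; case: (HP (phi n)).
- move=> n; have [[p [Pp [Jp _]]] [q [Pq [Jq _]]]] := meetJ n.
  by split; [exists p|exists q]; split.
Qed.
End SToSchoenflies.

(** * From the Schönflies relation to S(x) *)

Section SchoenfliesToS.
Variable R : realType.
Local Notation plane := (R * R)%type.
Local Notation P3 := 'rV[R]_3.
Implicit Types (K : set P3) (p q x y : P3) (r : R).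

Lemma simple_closed_curve_loop (J : set P3) x : simple_closed_curve J -> J x ->
  exists gamma : R -> P3, [/\ loop gamma, range gamma = J & gamma 0 = x].
Proof.
move=> [f [cf inj fS ->]] [c0 Cc0 fc0].
pose i0 : 'I_2 := ord0; pose i1 : 'I_2 := lift ord0 ord0.
have circE c : @circle R c <-> c ord0 i0 ^+ 2 + c ord0 i1 ^+ 2 = 1.
  by rewrite /circle /= !big_ord_recl big_ord0 addr0.
pose e (t : R) : 'rV[R]_2 := \row_j (if j == i0 then (cis t).1 else (cis t).2).
have e0 t : e t ord0 i0 = (cis t).1 by rewrite mxE.
have e1 t : e t ord0 i1 = (cis t).2 by rewrite mxE.
have ext (c d : 'rV[R]_2) : c ord0 i0 = d ord0 i0 -> c ord0 i1 = d ord0 i1 -> c = d.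
  move=> E0 E1; apply/rowP => j; have ji : j = i0 \/ j = i1.
    by case: j => [[|[|//]] Hj]; [left|right]; exact: val_inj.
  by case: ji => ->.
have eC t : circle (e t) by apply/circE; rewrite e0 e1; exact: cis_norm.
have ce : continuous e.
  move=> t; apply: row_continuous => j; have cc := @cis_continuous R t.
  have E u : e u ord0 j = if j == i0 then (cis u).1 else (cis u).2 by rewrite mxE.
  rewrite E (eq_fun E); case: ifP => _.
    exact: (continuous_comp cc (@continuous_fst R _)).
  exact: (continuous_comp cc (@continuous_snd R _)).
have esurj c : circle c -> exists t, e t = c.
  by move=> /circE/cis_surj[t _ tE]; exists t; apply: ext; rewrite ?e0 ?e1 tE.
have [tau taue] := esurj c0 Cc0.
exists (fun t => f (e (tau + t))); split.
- split.
  + move=> t; have cfe : f @ within (@circle R) (nbhs (e (tau + t))) --> f (e (tau + t)).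
      by move/subspace_continuousP: cf; apply; exact: eC.
    have ct : e (tau + u) @[u --> t] --> e (tau + t).
      apply: (@continuous_comp _ _ _ (fun u => tau + u) e); last exact: ce.
      by apply: cvgD; [exact: cvg_cst|exact: cvg_id].
    move=> B nB; have H : nbhs (e (tau + t)) [set c | circle c -> B (f c)] := cfe B nB.
    by apply: (@filterS R (nbhs t) (nbhs_filter t) _ _ _ (ct _ H)) => u /= Hu; exact: Hu (eC _).
  + by move=> t; congr f; apply: ext; rewrite ?e0 ?e1 addrA cisD1.
  + move=> s t st /(inj _ _ (mem_set (eC _)) (mem_set (eC _))) E.
    apply: (addrI tau); apply: cis_inj; first by rewrite opprD addrACA subrr add0r.
    by rewrite [LHS]surjective_pairing -e0 -e1 E e0 e1 -surjective_pairing.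
- apply/seteqP; split=> [_ [t _ <-]|_ [c Cc <-]]; first by exists (e (tau + t)).
  have [t te] := esurj c Cc; exists (t - tau) => //.
  by rewrite addrC subrK te.
- by rewrite addr0 taue.
Qed.

Lemma sphere_antipode p : sphere p -> exists2 q : P3, sphere q & q <> p.
Proof.
have [E0 E1 E2] := coord_vec3 (- coord3 0 p) (- coord3 1 p) (- coord3 2 p).
move=> /sphereE Sp; exists (vec3 (- coord3 0 p) (- coord3 1 p) (- coord3 2 p)).
  by apply/sphereE; rewrite -Sp /dot E0 E1 E2; ring.
move=> E; move: E0 E1 E2 Sp; rewrite E /dot => E0 E1 E2.
have -> : coord3 0 p = 0 by lra.
have -> : coord3 1 p = 0 by lra.
have -> : coord3 2 p = 0 by lra.
by rewrite !mulr0 !addr0 => /esym/eqP; rewrite oner_eq0.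
Qed.

(** The neighbourhood is a small cap: the side of an Apollonius circle for [z] and some other point
    [w] of the sphere, which is a disc in the chart projecting from [w]. *)
Lemma sphere_locally_connected z (B : set P3) : sphere z -> nbhs z B ->
  exists N : set P3, [/\ open N, N z, N `&` @sphere R `<=` B & connected (N `&` @sphere R)].
Proof.
move=> Sz /nbhs_ballP[e /= e0 He]; have [w Sw wz] := sphere_antipode Sz.
have zw : z <> w by move=> E; exact: wz.
pose r := Num.min (1 / 2) (e ^+ 2 / 8).
have e2 : 0 < e ^+ 2 by rewrite exprn_gt0.
have r0 : 0 < r by rewrite lt_min !divr_gt0.
have [r2 re] : r <= 1 / 2 /\ r <= e ^+ 2 / 8 by rewrite !ge_min !lexx orbT.
have r1 : r < 1 by lra.
have {}re : 8 * r <= e ^+ 2 by lra.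
exists [set p | gap r z w p < 0]; split.
- exact: open_gap_lt.
- exact: gap_self.
- by move=> p [/= g Sp]; apply: He; apply: (gap_le0_ball e0 r0 re Sz Sw) => //; exact: ltW.
have [Psi [sigma [k [[k0 cs Ss Ps] [sP cP nP]]]]] := sphere_chart Sz Sw zw.
have gE q : sphere q -> q <> w -> (gap r z w q < 0) = (nsq (Psi q) < r * k).
  move=> Sq qw; have d := dot_lt1 Sq Sw qw; have := nP q Sq qw; rewrite /gap => E.
  have d0 : 0 < 1 - dot q w by lra.
  rewrite -[RHS](ltr_pM2r d0) E -[LHS](pmulr_rlt0 _ k0) mulrBr -[RHS]subr_lt0.
  by congr (_ < _); ring.
rewrite (_ : _ `&` _ = sigma @` [set u | nsq u < r * k]).
  apply: connected_continuous_connected; last exact: continuous_subspaceT.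
  have rk : 0 < r * k by rewrite mulr_gt0.
  apply: (@star_connected R _ (0, 0)); first by rewrite /= /nsq /= expr0n /= addr0.
  move=> p t /= pr /andP[t0 t1].
  rewrite (_ : nsq _ = t ^+ 2 * nsq p); last by rewrite /nsq /seg /=; ring.
  by apply: le_lt_trans pr; rewrite ler_piMl ?nsq_ge0 //; nra.
apply/seteqP; split=> [q [/= g Sq]|_ [u /= nu <-]].
  have qw : q <> w.
    move=> E; have := gap_disjoint r0 r1 Sz Sw zw Sq (ltW g).
    by have := gap_self r0 Sw Sz wz; rewrite E; lra.
  by exists (Psi q); [rewrite /= -gE|exact: sP].
have [Su uw] := Ss u; split => //=.
by rewrite gE // Ps.
Qed.

Lemma component_sphere_open (F : set P3) z : closed F -> sphere z ->
  exists O : set P3, open O /\ O `&` @sphere R = connected_component (@sphere R `\` F) z.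
Proof.
move=> clF Sz; set U := connected_component _ z.
pose O := \bigcup_(N in [set N | open N /\ N `&` @sphere R `<=` U]) N.
exists O; split; first by apply: bigcup_open => N [].
apply/seteqP; split=> [p [[N [oN NU] Np] Sp]|p Up]; first exact: NU.
have [Sp nFp] := connected_component_sub Up.
have nF : nbhs p (~` F) by apply: open_nbhs_nbhs; split => //; exact: closed_openC.
have [N [oN Np NF cN]] := sphere_locally_connected Sp nF.
split => //; exists N => //; split => // q Nq.
apply: (connected_component_trans Up); exists (N `&` @sphere R) => //.
by split => // t [Nt St]; split => //; exact: NF.
Qed.

Lemma continuum_image (Psi : P3 -> plane) (X : set P3) : (forall p, X p -> {for p, continuous Psi}) ->
  {within X, continuous Psi}.
Proof. by move=> cP; apply: continuous_in_subspaceT => p /set_mem; exact: cP. Qed.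

(** Transport of [loop_spanning_three] through the chart projecting from [y]. The loop and the
    continua avoid the pole because their gap at [y] is nonnegative; for [U] this is a
    hypothesis. *)
Lemma loop_three_continua_sphere x y r eta (gamma : R -> P3) (U : set P3) (W : 'I_3 -> set P3) (t : 'I_3 -> R) :
  sphere x -> sphere y -> x <> y -> 0 < r -> r < 1 -> 0 < eta ->
  loop gamma -> gamma 0 = x -> range gamma `<=` @sphere R ->
  (forall s, 0 < gap r y x (gamma s)) ->
  (forall s, eta <= s <= 1 - eta -> 0 < gap r x y (gamma s)) ->
  connected U -> U `<=` @sphere R -> ~ U y -> U `&` range gamma = set0 ->
  (forall i, [/\ connected (W i), compact (W i), W i `<=` closure U `&` @sphere R,
    forall p, W i p -> 0 <= gap r x y p /\ 0 <= gap r y x p &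
    (exists2 p, W i p & gap r x y p <= 0) /\ (exists2 p, W i p & gap r y x p <= 0)]) ->
  (forall i j, i != j -> W i `&` W j = set0) ->
  (forall i, W i (gamma (t i)) /\ eta <= t i <= 1 - eta) -> False.
Proof.
move=> Sx Sy xy r0 r1 eta0 lg g0 gS gy gx cU US nUy UJ HW Wd Wt.
have [Psi [sigma [k [[k0 cs Ss Ps] [sP cP nP]]]]] := sphere_chart Sx Sy xy.
have w0 p : sphere p -> p <> y -> 0 < 1 - dot p y by move=> Sp py; rewrite subr_gt0 dot_lt1.
have E1 p : sphere p -> p <> y -> k * gap r x y p = (1 - dot p y) * (nsq (Psi p) - r * k).
  by move=> Sp py; rewrite /gap mulrBr -nP //; ring.
have E2 p : sphere p -> p <> y -> k * gap r y x p = (1 - dot p y) * (k - r * nsq (Psi p)).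
  by move=> Sp py; rewrite /gap mulrBr (mulrCA k r) -nP //; ring.
have yx : y <> x by move=> E; exact: xy.
have gyy := gap_self r0 Sy Sx yx.
have ny p : 0 <= gap r y x p -> p <> y by move=> g E; move: g; rewrite E; lra.
have gne s : gamma s <> y by apply: ny; rewrite ltW.
have gSs s : sphere (gamma s) by apply: gS; exists s.
have Pinj p q : sphere p -> p <> y -> sphere q -> q <> y -> Psi p = Psi q -> p = q.
  by move=> Sp py Sq qy E; rewrite -(sP p Sp py) E sP.
have [cg per ginj] := lg.
have lG : loop (Psi \o gamma).
  split => [s|s|s u su /= E]; first by apply: continuous_comp; [exact: cg|exact: cP].
    by rewrite /= per.
  by apply: ginj => //; exact: Pinj E.
have WS i p : W i p -> sphere p by case: (HW i) => _ _ WU _ _ /WU[].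
have Wy i p : W i p -> p <> y by case: (HW i) => _ _ _ Wg _ /Wg[_ /ny].
have Uy p : U p -> p <> y by move=> Up E; apply: nUy; rewrite -E.
have rk : 0 < r * k by rewrite mulr_gt0.
apply: (@loop_spanning_three R (Psi \o gamma) (r * k) (k / r) eta (Psi @` U) (fun i => Psi @` W i) t lG) => //.
- have n0 : nsq (Psi x) = 0.
    have := nP x Sx xy; have /sphereE -> := Sx; rewrite subrr mulr0 => /eqP.
    by rewrite mulf_eq0 (gt_eqF (w0 x Sx xy)) orbF => /eqP.
  rewrite /= g0 [LHS]surjective_pairing; move: n0; rewrite /nsq.
  have s1 := sqr_ge0 (Psi x).1; have s2 := sqr_ge0 (Psi x).2 => H.
  have /eqP z1 : (Psi x).1 ^+ 2 = 0 by lra.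
  have /eqP z2 : (Psi x).2 ^+ 2 = 0 by lra.
  by move: z1 z2; rewrite !sqrf_eq0 => /eqP -> /eqP ->.
- move=> s /=; have := E2 _ (gSs s) (gne s).
  have := mulr_gt0 k0 (gy s) => h1 h2; move: h1; rewrite h2 pmulr_rgt0 ?w0 // subr_gt0.
  by rewrite ltr_pdivlMr // mulrC.
- move=> s se /=; have := E1 _ (gSs s) (gne s).
  by have := mulr_gt0 k0 (gx s se) => h1 h2; move: h1; rewrite h2 pmulr_rgt0 ?w0 // subr_gt0.
- rewrite ltr_pdivlMr //; have rr : r * r < 1 by nra.
  by rewrite mulrAC gtr_pMl.
- apply: connected_continuous_connected => //; apply: continuum_image => p Up.
  by apply: cP; [exact: US|exact: Uy].
- rewrite -subset0 => _ [[p Up <-] [s _ /= E]].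
  have ps : p = gamma s by apply: Pinj => //; [exact: US|exact: Uy].
  have : (U `&` range gamma) p by split; [exact: Up|exists s].
  by rewrite UJ.
- move=> i; have [cW kW WU Wg [[p Wp gp] [q Wq gq]]] := HW i.
  have cPW : {within W i, continuous Psi}.
    by apply: continuum_image => u Wu; apply: cP; [exact: WS Wu|exact: Wy Wu].
  split.
  + exact: connected_continuous_connected.
  + exact: continuous_compact.
  + move=> _ [u Wu <-] B nB; have [clU _] := WU u Wu.
    have [v [Uv Bv]] := clU _ (cP u (WS _ _ Wu) (Wy _ _ Wu) B nB).
    by exists (Psi v); split => //; exists v.
  + move=> _ [u Wu <-]; have [g1 g2] := Wg u Wu; have Su := WS _ _ Wu; have uy := Wy _ _ Wu.
    have := mulr_ge0 (ltW k0) g1; rewrite E1 // pmulr_rge0 ?w0 // subr_ge0 => ->.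
    have := mulr_ge0 (ltW k0) g2; rewrite E2 // pmulr_rge0 ?w0 // subr_ge0 => h.
    by rewrite ler_pdivlMr // mulrC.
  + split.
      exists (Psi p); split; first by exists p.
      have Sp := WS _ _ Wp; have py := Wy _ _ Wp; have [g1 _] := Wg p Wp.
      have gp0 : gap r x y p = 0 by apply/eqP; rewrite eq_le gp.
      have := E1 p Sp py; rewrite gp0 mulr0 => /esym/eqP.
      by rewrite mulf_eq0 (gt_eqF (w0 p Sp py)) /= subr_eq0 => /eqP.
    exists (Psi q); split; first by exists q.
    have Sq := WS _ _ Wq; have qy := Wy _ _ Wq; have [_ g2] := Wg q Wq.
    have gq0 : gap r y x q = 0 by apply/eqP; rewrite eq_le gq.
    have := E2 q Sq qy; rewrite gq0 mulr0 => /esym/eqP.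
    rewrite mulf_eq0 (gt_eqF (w0 q Sq qy)) /= subr_eq0 => /eqP E.
    by rewrite /= E mulrAC divff ?mul1r // gt_eqF.
- move=> i j ij; rewrite -subset0 => _ [[p Wp <-] [q Wq E]].
  have pq : q = p.
    by apply: Pinj => //; [exact: WS Wq|exact: Wy Wq|exact: WS Wp|exact: Wy Wp].
  have : (W i `&` W j) p by split; [exact: Wp|rewrite -pq; exact: Wq].
  by rewrite Wd.
- by move=> i; have [Wi te] := Wt i; split => //; exists (gamma (t i)).
Qed.
End SchoenfliesToS.

(** * Infinitely many crossing components for a related pair *)

Section Separation.
Variable R : realType.
Local Notation P3 := 'rV[R]_3.
Implicit Types (K U : set P3) (p q x y : P3) (r e eta : R).

Lemma compact_closed3 (A : set P3) : compact A -> closed A.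
Proof. by apply: compact_closed; exact: norm_hausdorff. Qed.

Lemma loop_compact3 (gamma : R -> P3) : loop gamma -> compact (range gamma).
Proof.
move=> lg; rewrite (loop_range 0 lg); apply: continuous_compact; last exact: segment_compact.
by apply: continuous_subspaceT; exact: loop_continuous.
Qed.

(** Continuity at 0 gives [eta] first: parameters closer than [eta] to an end of the period are
    mapped into [V]. The remaining arc is compact and misses [gamma 0], which then leaves room for
    [e]. *)
Lemma loop_escape (gamma : R -> P3) (V F : set P3) : loop gamma -> open V -> V (gamma 0) ->
  closed F -> ~ F (gamma 0) -> exists e eta : R, [/\ 0 < e, 0 < eta,
    ball (gamma 0) e `<=` V, (forall p, ball (gamma 0) e p -> ~ F p) &
    (forall s, eta <= s <= 1 - eta -> ~ ball (gamma 0) e (gamma s)) /\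
    forall p, range gamma p -> ~ V p -> exists2 s, eta <= s <= 1 - eta & p = gamma s].
Proof.
move=> lg oV V0 clF F0; have cg := loop_continuous lg.
have /(cg 0)/nbhs_ballP[d /= d0 Hd] : nbhs (gamma 0) V by exact: open_nbhs_nbhs.
pose eta := Num.min (d / 2) (1 / 4).
have eta0 : 0 < eta by rewrite lt_min !divr_gt0.
have [etad eta4] : eta <= d / 2 /\ eta <= 1 / 4 by rewrite !ge_min !lexx orbT.
pose A := path_arc gamma eta (1 - eta).
have clA : closed A.
  apply: compact_closed3; apply: continuous_compact; last exact: segment_compact.
  exact: continuous_subspaceT.
have nA : ~ A (gamma 0).
  move=> /arcP[u u1 /(loop_inj lg) E]; have : 0 = u by apply: E; rewrite sub0r normrN ger0_norm; lra.
  lra.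
have /nbhs_ballP[e /= e0 He] : nbhs (gamma 0) (V `&` ~` (F `|` A)).
  apply: open_nbhs_nbhs; split; last by split => // -[].
  by apply: openI => //; apply: closed_openC; exact: closedU.
exists e, eta; split => //.
- by move=> p /He[].
- by move=> p /He[_ nFA] Fp; apply: nFA; left.
split=> [s s1 /He[_ nFA]|p rp]; first by apply: nFA; right; exact: arc_mem.
have : range gamma p by []; rewrite (loop_range 0 lg) add0r => /arcP[u /andP[u0 u1] ->] nV.
exists u => //.
have near0 v : `|v| < d -> V (gamma v).
  by move=> vd; apply: Hd; rewrite /ball /= sub0r normrN.
rewrite !leNgt; apply/andP; split; apply/negP => u2; apply: nV.
  by apply: near0; rewrite ger0_norm; lra.
case: lg => _ per _; rewrite -[u](subrK 1) per; apply: near0.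
by rewrite ler0_norm; lra.
Qed.

(** Stated for one curve through [x] so that it serves [J1] and, with [x] and [y] exchanged, [J2].
    Three of the infinitely many touching continua suffice. *)
Lemma curve_side_contradiction x y r ex ey eta (gamma : R -> P3) U (W : nat -> set P3) :
  sphere x -> sphere y -> x <> y -> 0 < r -> r < 1 -> 0 < eta ->
  0 < ex -> 0 < ey -> 8 * r <= ex ^+ 2 -> 8 * r <= ey ^+ 2 ->
  loop gamma -> gamma 0 = x -> range gamma `<=` @sphere R ->
  (forall p, ball y ey p -> ~ range gamma p) ->
  (forall s, eta <= s <= 1 - eta -> ~ ball x ex (gamma s)) ->
  connected U -> U `<=` @sphere R -> ~ U y -> U `&` range gamma = set0 ->
  (forall i, [/\ connected (W i), compact (W i), W i `<=` closure U `&` @sphere R,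
    forall p, W i p -> 0 <= gap r x y p /\ 0 <= gap r y x p &
    (exists2 p, W i p & gap r x y p <= 0) /\ (exists2 p, W i p & gap r y x p <= 0)]) ->
  (forall i j, i <> j -> W i `&` W j = set0) ->
  ~ finite_set [set i | exists2 s, eta <= s <= 1 - eta & W i (gamma s)] -> False.
Proof.
move=> Sx Sy xy r0 r1 eta0 ex0 ey0 rx ry lg g0 gS gy gx cU US nUy UJ HW Wd inf.
have [h [hinj Hh]] := infinite_injection inf.
have /choice[s Hs] (i : 'I_3) : exists s, W (h i) (gamma s) /\ eta <= s <= 1 - eta.
  by have [s s1 Ws] := Hh i; exists s.
have gSs u : sphere (gamma u) by apply: gS; exists u.
apply: (@loop_three_continua_sphere R x y r eta gamma U (fun i => W (h i)) s) => //.
- move=> u; rewrite ltNge; apply/negP => g.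
  by apply: (gy (gamma u)); [apply: (gap_le0_ball ey0 r0 ry Sy Sx)|exists u].
- move=> u u1; rewrite ltNge; apply/negP => g.
  by apply: (gx u u1); apply: (gap_le0_ball ex0 r0 rx Sx Sy).
- move=> i j ij; apply: Wd => /hinj E; move/eqP: ij; apply; exact: val_inj.
Qed.

Lemma infinite_fiber (T : Type) (F : nat -> T) (A : set T) : finite_set A -> (forall n, A (F n)) ->
  exists2 a, A a & ~ finite_set [set n | F n = a].
Proof.
move=> fA AF; apply: contrapT => H; apply: infinite_nat.
rewrite (_ : [set: nat] = \bigcup_(a in A) [set n | F n = a]).
  by apply: bigcup_finite => // a Aa; apply: contrapT => nf; apply: H; exists a.
by apply/seteqP; split=> // n _; exists (F n).
Qed.

Lemma schoenflies_infinite_components K x y Vx Vy : compact K -> K `<=` @sphere R ->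
  open Vx -> open Vy -> Vx x -> Vy y -> (Vx `&` K) `&` (Vy `&` K) = set0 -> x <> y ->
  schoenflies_rel K (x, y) ->
  ~ finite_set [set C | components (K `\` ((Vx `&` K) `|` (Vy `&` K))) C /\
      C `&` rel_boundary K (Vx `&` K) !=set0 /\ C `&` rel_boundary K (Vy `&` K) !=set0].
Proof.
move=> cK KS oVx oVy Vxx Vyy dis xy [/= Kx [Ky [//|[_ [J1 [J2 [U [[sJ1 sJ2 J12 J1x J2y]]]]]]]]].
move=> [[[z0 Fz0 UE] bdU] [P0 [L [Pinj Pcomp _ [clL cv] [Lx Ly]]]]] fin.
have Sx := KS x Kx; have Sy := KS y Ky; have clK := compact_closed3 cK.
have yx : y <> x by move=> E; exact: xy.
have [g1 [lg1 rg1 g10]] := simple_closed_curve_loop sJ1 J1x.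
have [g2 [lg2 rg2 g20]] := simple_closed_curve_loop sJ2 J2y.
have clJ1 : closed J1 by rewrite -rg1; apply: compact_closed3; exact: loop_compact3.
have clJ2 : closed J2 by rewrite -rg2; apply: compact_closed3; exact: loop_compact3.
have J1S : J1 `<=` @sphere R by case: sJ1 => f [_ _ fS ->].
have J2S : J2 `<=` @sphere R by case: sJ2 => f [_ _ fS ->].
have nJ2x : ~ J2 x by move=> J2x; have : (J1 `&` J2) x by []; rewrite J12.
have nJ1y : ~ J1 y by move=> J1y; have : (J1 `&` J2) y by []; rewrite J12.
rewrite -g10 in Vxx nJ2x; rewrite -g20 in Vyy nJ1y.
have [ex [etax [ex0 etax0 exV exJ [exg Jx]]]] := loop_escape lg1 oVx Vxx clJ2 nJ2x.
have [ey [etay [ey0 etay0 eyV eyJ [eyg Jy]]]] := loop_escape lg2 oVy Vyy clJ1 nJ1y.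
rewrite g10 in Vxx nJ2x exV exJ exg; rewrite g20 in Vyy nJ1y eyV eyJ eyg.
(* So small that the caps around [x] and [y] fit in the balls of radius [ex] and [ey], hence in [Vx]
   and [Vy], each missing the curve through the other point. *)
pose r := Num.min (1 / 2) (Num.min (ex ^+ 2 / 8) (ey ^+ 2 / 8)).
have r0 : 0 < r by rewrite !lt_min !divr_gt0 // exprn_gt0.
have [r2 rx ry] : [/\ r <= 1 / 2, r <= ex ^+ 2 / 8 & r <= ey ^+ 2 / 8] by rewrite !ge_min !lexx !orbT.
have r1 : r < 1 by lra.
have {}rx : 8 * r <= ex ^+ 2 by lra.
have {}ry : 8 * r <= ey ^+ 2 by lra.
have cU : connected U by rewrite UE; exact: component_connected.
have USJ p : U p -> sphere p /\ ~ (J1 `|` J2) p by rewrite UE => /connected_component_sub[].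
have US : U `<=` @sphere R by move=> p /USJ[].
have clJ : closed (J1 `|` J2) by exact: closedU.
(* An open set of the ambient space cutting [U] out of the sphere: points of [closure U] outside
   [V'] are on [J1] or [J2]. *)
have [V' [oV' V'U]] := component_sphere_open clJ Fz0.1.
rewrite -UE in V'U.
have clUS : closure U `<=` @sphere R.
  by move=> p clp; apply: sphere_closed; exact: closureS clp.
have UV' p : U p -> V' p by rewrite -V'U => -[].
have bd p : closure U p -> ~ V' p -> (J1 `|` J2) p.
  by move=> clp nO; rewrite -bdU; split => // /UV'.
have nUx : ~ U x by move=> /USJ[_]; apply; left.
have nUy : ~ U y by move=> /USJ[_]; apply; right.
pose A := [set p : P3 | gap r x y p < 0]; pose B := [set p : P3 | gap r y x p < 0].
have oA : open A by exact: open_gap_lt.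
have oB : open B by exact: open_gap_lt.
have AV p : sphere p -> gap r x y p <= 0 -> Vx p.
  by move=> Sp g; apply: exV; exact: gap_le0_ball g.
have BV p : sphere p -> gap r y x p <= 0 -> Vy p.
  by move=> Sp g; apply: eyV; exact: gap_le0_ball g.
have [N HN] : exists N, forall n, (N <= n)%N -> P0 n `&` A !=set0 /\ P0 n `&` B !=set0.
  have hits q (V : set P3) : L q -> open V -> V q -> exists N, forall n, (N <= n)%N -> P0 n `&` V !=set0.
    move=> Lq oV Vq; have /nbhs_ballP[d /= d0 dV] : nbhs q V by exact: open_nbhs_nbhs.
    have [N _ HN] := cv d d0; exists N => n Nn.
    by have [_ /(_ q Lq)[p Pp /dV Vp]] := HN n Nn; exists p.
  have [N1 H1] := hits x A Lx oA (gap_self r0 Sx Sy xy).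
  have [N2 H2] := hits y B Ly oB (gap_self r0 Sy Sx yx).
  exists (N1 + N2)%N => n Nn; split; first by apply: H1; exact: leq_trans (leq_addr _ _) Nn.
  by apply: H2; exact: leq_trans (leq_addl _ _) Nn.
pose P n := P0 (N + n)%N.
have PA n : P n `&` A !=set0 by have [] := HN _ (leq_addr n N).
have PB n : P n `&` B !=set0 by have [] := HN _ (leq_addr n N).
have kUK : compact (closure U `&` K).
  by apply: (subclosed_compact _ cK) => [|? []//]; apply: closedI => //; exact: closed_closure.
have clUK := compact_closed3 kUK.
have PUK n : P n `<=` closure U `&` K by rewrite /P; case: (Pcomp (N + n)%N) => z _ -> p /connected_component_sub.
have cP n : connected (P n) by rewrite /P; case: (Pcomp (N + n)%N) => z _ ->; exact: component_connected.
have kP n : compact (P n) by rewrite /P; case: (Pcomp (N + n)%N) => z _ ->; exact: component_compact.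
have Pmax n X q : connected X -> X `<=` closure U `&` K -> X q -> P n q -> X `<=` P n.
  rewrite /P; case: (Pcomp (N + n)%N) => z _ -> cX XUK Xq zq t Xt.
  by apply: (connected_component_trans zq); exists X.
have Pdis n m q : P n q -> P m q -> n = m.
  move=> Pn Pm; suff /Pinj/addnI : P n = P m by [].
  by apply/seteqP; split; [exact: Pmax Pn Pm|exact: Pmax Pm Pn].
have PK n p : P n p -> K p by move=> /PUK[].
have PS n p : P n p -> sphere p by move=> /PK/KS.
have /choice[T HT] n : exists T0, [/\ connected T0, compact T0, T0 `<=` P n, T0 `&` (A `|` B) = set0 &
    T0 `&` closure (P n `&` A) !=set0 /\ T0 `&` closure (P n `&` B) !=set0].
  apply: continuum_between => //; first exact: compact_closed3.
  rewrite -subset0 => p [[/= Ap Bp] Pp].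
  by have := gap_disjoint r0 r1 Sx Sy xy (PS _ _ Pp) (ltW Ap); move: Bp; rewrite /B /=; lra.
have TP n : T n `<=` P n by case: (HT n).
have TA n p : T n p -> 0 <= gap r x y p /\ 0 <= gap r y x p.
  case: (HT n) => _ _ _ TAB _ Tp; split; rewrite leNgt; apply/negP => g.
    by have : (T n `&` (A `|` B)) p by [split => //; left]; rewrite TAB.
  by have : (T n `&` (A `|` B)) p by [split => //; right]; rewrite TAB.
have Tx n : exists2 p, T n p & gap r x y p <= 0.
  case: (HT n) => _ _ _ _ [[p [Tp clp]] _]; exists p => //.
  by apply: (@closed_gap_le R r x y 0); apply: closureS clp => q [_ /ltW].
have Ty n : exists2 p, T n p & gap r y x p <= 0.
  case: (HT n) => _ _ _ _ [_ [p [Tp clp]]]; exists p => //.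
  by apply: (@closed_gap_le R r y x 0); apply: closureS clp => q [_ /ltW].
(* Two nested crossings are needed: [T n] runs between the small circular caps, as the planar
   argument demands, while [Q n] runs between [Vx] and [Vy] and so lies in one crossing component of
   [M]. *)
have /choice[Q HQ] n : exists Q0, [/\ connected Q0, compact Q0, Q0 `<=` T n, Q0 `&` (Vx `|` Vy) = set0 &
    Q0 `&` closure (T n `&` Vx) !=set0 /\ Q0 `&` closure (T n `&` Vy) !=set0].
  case: (HT n) => cT kT _ _ _; apply: continuum_between => //; first exact: compact_closed3.
  - rewrite -subset0 => p [[Vxp Vyp] /TP/PK Kp].
    by have : ((Vx `&` K) `&` (Vy `&` K)) p by []; rewrite dis.
  - by have [p Tp g] := Tx n; exists p; split => //; apply: AV => //; exact: PS (TP _ _ Tp).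
  - by have [p Tp g] := Ty n; exists p; split => //; apply: BV => //; exact: PS (TP _ _ Tp).
set M := K `\` ((Vx `&` K) `|` (Vy `&` K)) in fin.
have QT n : Q n `<=` T n by case: (HQ n).
have QM n : Q n `<=` M.
  case: (HQ n) => _ _ _ QV _ p Qp; split; first exact: PK (TP _ _ (QT _ _ Qp)).
  move=> VV; have : (Q n `&` (Vx `|` Vy)) p by split => //; case: VV => -[]; [left|right].
  by rewrite QV.
have /choice[q Hq] n : exists q, Q n q /\ closure (T n `&` Vx) q.
  by case: (HQ n) => _ _ _ _ [[q []]]; exists q.
pose C n := connected_component M (q n).
have QC n : Q n `<=` C n.
  by apply: connected_component_max; [case: (Hq n)|exact: QM|case: (HQ n)].
have bdV V n p : V `<=` Vx `|` Vy -> closure (T n `&` V) p -> Q n p -> rel_boundary K (V `&` K) p.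
  move=> VV clp Qp; have [Kp nV] := QM _ _ Qp; split.
    by split => //; apply: closureS clp => t [/TP/PK].
  move=> [/VV Vp _]; apply: nV; case: Vp; [left|right]; split => //.
(* Finitely many crossing components for infinitely many [Q n]: one of them, [C0], contains
   infinitely many. *)
have [|C0 [C0comp _] C0inf] := @infinite_fiber _ C _ fin.
  move=> n; split; first by exists (q n) => //; case: (Hq n) => /QM.
  split; first by exists (q n); case: (Hq n) => Qq clq; split; [exact: QC|apply: bdV Qq => // t; left].
  case: (HQ n) => _ _ _ _ [_ [t [Qt clt]]].
  by exists t; split; [exact: QC|apply: bdV Qt => // ? ; right].
have [h [hinj hC]] := infinite_injection C0inf.
have C0M : C0 `<=` M by rewrite -(hC 0%N) => p /connected_component_sub.
have cC0 : connected C0 by rewrite -(hC 0%N); exact: component_connected.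
have clM : closed M.
  rewrite /M -setIUl setDIr setDv setU0 setDE; apply: closedI => //.
  by apply: open_closedC; exact: openU.
have kM : compact M by apply: (subclosed_compact clM cK) => ? [].
have kC0 : compact C0 by rewrite -(hC 0%N); exact: component_compact.
have C0q n : C0 (q (h n)) by rewrite -(hC n); apply: QC; case: (Hq (h n)).
have Pq n : P n (q n) by apply: TP; apply: QT; case: (Hq n).
have nC0U : ~ C0 `<=` closure U.
  move=> C0U; have C0P : C0 `<=` P (h 0%N).
    by apply: (Pmax _ _ (q (h 0%N))) => // p Cp; split; [exact: C0U|case: (C0M p Cp)].
  by have /hinj := Pdis _ _ _ (C0P _ (C0q 1%N)) (Pq (h 1%N)).
(* Still contained in [P (h n)], hence disjoint for different [n], but by boundary bumping it
   reaches a point [w n] of [J1] or [J2]. *)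
pose Q' n := connected_component (C0 `&` closure U) (q (h n)).
have clC0U : closed (C0 `&` closure U).
  by apply: closedI; [exact: compact_closed3|exact: closed_closure].
have kC0U : compact (C0 `&` closure U) by apply: (subclosed_compact clC0U kC0) => ? [].
have Uq n : closure U (q (h n)) by case: (PUK _ _ (Pq (h n))).
have Q'q n : Q' n (q (h n)) by exact: connected_component_refl.
have Q'sub n p : Q' n p -> C0 p /\ closure U p by move=> /connected_component_sub[].
have /choice[w Hw] n : exists w, Q' n w /\ ~ V' w.
  have CVU : C0 `&` V' `<=` closure U.
    by move=> p [/C0M[/KS Sp _] Op]; apply: subset_closure; rewrite -V'U.
  have [w [Qw nO]] := component_reaches_boundary cC0 kC0 (compact_closed3 kC0)
     (@closed_closure _ U) oV' CVU (C0q n) (Uq n) nC0U.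
  by exists w.
(* The two parts share [q (h n)]: [T] provides the crossing from cap to cap, [Q'] the contact with a
   curve at a point outside [Vx] and [Vy]. *)
pose W n := T (h n) `|` Q' n.
have Q'P n : Q' n `<=` P (h n).
  apply: (Pmax _ _ (q (h n))) => //; first exact: component_connected.
  by move=> p /Q'sub[/C0M[Kp _] Up].
have WP n : W n `<=` P (h n) by move=> p [/TP|/Q'P].
have nV p : C0 p -> ~ Vx p /\ ~ Vy p.
  by move=> /C0M[Kp nVV]; split => Vp; apply: nVV; [left|right].
have HW n : [/\ connected (W n), compact (W n), W n `<=` closure U `&` @sphere R,
    forall p, W n p -> 0 <= gap r x y p /\ 0 <= gap r y x p &
    (exists2 p, W n p & gap r x y p <= 0) /\ (exists2 p, W n p & gap r y x p <= 0)].
  case: (HT (h n)) => cT kT _ _ _; split.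
  - apply: connectedU => //; last exact: component_connected.
    by exists (q (h n)); split => //; apply: QT; case: (Hq (h n)).
  - by apply: compactU => //; exact: component_compact.
  - by move=> p /WP/PUK[clp Kp]; split => //; exact: KS.
  - move=> p [/TA //|/Q'sub[/[dup] /nV[nx ny] /C0M[Kp _] _]].
    by split; rewrite leNgt; apply/negP => g; [apply: nx; apply: AV|apply: ny; apply: BV];
      [exact: KS|exact: ltW|exact: KS|exact: ltW].
  - by have [a Ta ga] := Tx (h n); have [b Tb gb] := Ty (h n); split; [exists a|exists b] => //; left.
have Wd i j : i <> j -> W i `&` W j = set0.
  move=> ij; rewrite -subset0 => p [/WP Wi /WP Wj]; apply: ij; apply: hinj; exact: Pdis Wi Wj.
have wJ n : J1 (w n) \/ J2 (w n).
  by case: (Hw n) => Qw nO; apply: bd => //; case: (Q'sub _ _ Qw).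
have Ww n : W n (w n) by right; case: (Hw n).
have wV n : ~ Vx (w n) /\ ~ Vy (w n) by apply: nV; case: (Hw n) => /Q'sub[].
have UJ1 : U `&` range g1 = set0.
  by rewrite rg1 -subset0 => p [/USJ[_ nJ] J1p]; apply: nJ; left.
have UJ2 : U `&` range g2 = set0.
  by rewrite rg2 -subset0 => p [/USJ[_ nJ] J2p]; apply: nJ; right.
(* Every index belongs to [J1] or to [J2] according to [w n]; each class is finite, as three of its
   continua would be contradictory. *)
apply: infinite_nat.
rewrite (_ : [set: nat] = [set n | J1 (w n)] `|` [set n | J2 (w n)]); last first.
  by apply/seteqP; split=> // n _; exact: wJ.
rewrite finite_setU; split; apply: contrapT => inf.
- apply: (@curve_side_contradiction x y r ex ey etax g1 U W) => //; rewrite ?rg1 //.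
  apply: sub_infinite_set inf => n /= J1w; rewrite -rg1 in J1w.
  by have [s s1 ws] := Jx _ J1w (wV n).1; exists s => //; rewrite -ws.
- apply: (@curve_side_contradiction y x r ey ex etay g2 U W) => //; rewrite ?rg2 //.
    by move=> n; have [? ? ? Wg [? ?]] := HW n; split => // p /Wg[].
  apply: sub_infinite_set inf => n /= J2w; rewrite -rg2 in J2w.
  by have [s s1 ws] := Jy _ J2w (wV n).2; exists s => //; rewrite -ws.
Qed.

(** Neighbourhoods separating [x] and [y] also contain a related pair near [(x, y)]. Their
    disjointness within [K] makes this pair off-diagonal, so the crossing argument applies to it
    directly. *)
Lemma closure_sub_S_set K x y : compact K -> K `<=` @sphere R -> K x ->
  closure (schoenflies_rel K) (x, y) -> S_set K x y.
Proof.
move=> cK KS Kx clxy; have clK := compact_closed3 cK; split.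
  apply: clK => B nB; have nB2 : nbhs (x, y) [set z : P3 * P3 | B z.2].
    by apply: (@cvg_snd _ _ (nbhs x) (nbhs y)); exact: nB.
  by have [[x' y'] [[_ [/= Ky' _]] By']] := clxy _ nB2; exists y'.
move=> [Ux [Uy [[[Vx oVx UxE] [Vy oVy UyE] UxK UyK dis] [Uxx [Uyy fin]]]]].
rewrite UxE in Uxx dis fin; rewrite UyE in Uyy dis fin.
have nV : nbhs (x, y) (Vx `*` Vy).
  exists (Vx, Vy) => //=; split; apply: open_nbhs_nbhs; split => //; [exact: Uxx.1|exact: Uyy.1].
have [[x' y'] [rel [/= Vx' Vy']]] := clxy _ nV.
have [/= Kx' [/= Ky' _]] := rel.
apply: (schoenflies_infinite_components cK KS oVx oVy Vx' Vy' dis _ rel fin).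
by move=> E; rewrite -E in Vy'; have : ((Vx `&` K) `&` (Vy `&` K)) x' by []; rewrite dis.
Qed.
End Separation.

Theorem theorem4p3 (R : realType) (K : set 'rV[R]_3) :
  compact K -> K `<=` @sphere R ->
  forall x, K x -> S_set K x = closed_rel_section K x.
Proof.
move=> cK KS x Kx; apply/seteqP; split=> y; first exact: S_set_sub_closure.
exact: closure_sub_S_set.
Qed.
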